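(* Let $X,U,Y$ be complex Banach spaces and $1\le p<\infty$. Let $\{e^{tA}\}_{t\ge0}$ be a strongly continuous semigroup generated by $A$ on $X$, and assume $1\in\rho(e^{2\pi A})$. Let $\Gamma_{per}$ denote the generator of the induced evolution semigroup on $L^p([0,2\pi],X)$. Let $B\in\mathcal L(U,X)$ and $C\in\mathcal L(X,Y)$. Then $$\frac1{\|\mathcal C\Gamma_{per}^{-1}\mathcal B\|}\le rc^1_{stab}(e^{2\pi A},B,C)\le\frac1{\sup_{k\in\mathbb Z}\|C(A-ik)^{-1}B\|}.$$ If $U$ and $Y$ are Hilbert spaces and $p=2$, then equalities hold.
   Context: $1/0:=\infty$. The evolution semigroup on $L^p([0,2\pi],X)$ is the strongly continuous semigroup $(E^t_{per}f)(s)=e^{tA}f([s-t]\ (\mathrm{mod}\ 2\pi))$; since $1\in\rho(e^{2\pi A})$, its generator $\Gamma_{per}$ is invertible. $\mathcal B:L^p([0,2\pi],U)\to L^p([0,2\pi],X)$ and $\mathcal C:L^p([0,2\pi],X)\to L^p([0,2\pi],Y)$ are pointwise application of $B$ and $C$; $\|\mathcal C\Gamma_{per}^{-1}\mathcal B\|$ is the norm in $\mathcal L(L^p([0,2\pi],U),L^p([0,2\pi],Y))$. The pointwise stability radius (for the point $1$) is $$rc^1_{stab}(e^{2\pi A},B,C)=\sup\{r>0:\ \Delta\in\mathcal L(Y,U),\ \|\Delta\|\le r\ \Rightarrow\ 1\in\rho(e^{2\pi(A+B\Delta C)})\},$$ where $\{e^{t(A+B\Delta C)}\}_{t\ge0}$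 is the semigroup generated by $A+B\Delta C$ and the implication is required for all such $\Delta$. *)

(* Defs.v *)
From HB Require Import structures.
From mathcomp Require Import all_boot all_order all_algebra complex ring_quotient.
From mathcomp Require Import all_classical all_reals all_analysis measurable_realfun.

Set Implicit Arguments.
Unset Strict Implicit.
Unset Printing Implicit Defensive.
Import Order.TTheory GRing.Theory Num.Theory.
Import numFieldNormedType.Exports.
Local Open Scope classical_set_scope.
Local Open Scope ring_scope.

(* In a normedModType over R[i] the norm `|x| is an element of R[i] (with zero
   imaginary part); rnorm is the same number as an element of R. *)
Definition rnorm (R : realType) (V : normedModType R[i]) (x : V) : R :=
  complex.Re `|x|.

Section rnorm_theory.
Context (R : realType) (V : normedModType R[i]).
Implicit Types x y : V.

Lemma rnormC x : (rnorm x)%:C%C = `|x|.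
Proof.
rewrite /rnorm; have := normr_ge0 x; rewrite lecE => /andP[/eqP Im0 _].
by apply/eqP; rewrite eq_complex/= Im0 !eqxx.
Qed.

Lemma rnorm_ge0 x : 0 <= rnorm x.
Proof. by rewrite -lecR rnormC; exact: normr_ge0. Qed.

Lemma ler_rnormD x y : rnorm (x + y) <= rnorm x + rnorm y.
Proof. by rewrite -lecR rmorphD /= !rnormC ler_normD. Qed.

Lemma rnormZ a x : rnorm (a *: x) = rnorm (a : R[i]^o) * rnorm x.
Proof. by apply: (@complexI R); rewrite rmorphM /= !rnormC normrZ. Qed.

Lemma rnorm0 : rnorm (0 : V) = 0.
Proof. by rewrite /rnorm normr0. Qed.

Lemma rnorm_eq0 x : rnorm x = 0 -> x = 0.
Proof. by move=> x0; apply/normr0_eq0; rewrite -rnormC x0. Qed.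

Lemma rnormB x y : rnorm (x - y) = rnorm (y - x).
Proof. by rewrite /rnorm distrC. Qed.

Lemma ler_dist_rnorm x y : `|rnorm x - rnorm y| <= rnorm (x - y).
Proof.
have H (u v : V) : rnorm u - rnorm v <= rnorm (u - v).
  by rewrite lerBlDr; have := ler_rnormD (u - v) v; rewrite subrK.
by rewrite ler_norml H andbT lerNl opprB (rnormB x) H.
Qed.

Lemma cvg_rnorm (T : Type) (F : set_system T) (FF : Filter F) (f : T -> V) x :
  f t @[t --> F] --> x -> rnorm (f t) @[t --> F] --> rnorm x.
Proof.
move=> fx; apply/cvgrPdist_lt => e e0.
have e0' : 0 < e%:C%C by rewrite ltcR.
move/cvgrPdist_lt : fx => /(_ _ e0'); apply: filterS => t.
by rewrite -rnormC ltcR; apply: le_lt_trans; exact: ler_dist_rnorm.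
Qed.

End rnorm_theory.

Section strongly_measurable.
Context d (T : measurableType d) (R : realType) (V : normedModType R[i]).
Implicit Types f g : T -> V.

Definition simple_function (W : Type) (s : T -> W) : Prop :=
  finite_set (range s) /\ forall v, measurable (s @^-1` [set v]).

Definition strongly_measurable f : Prop :=
  exists s_ : nat -> T -> V, (forall n, simple_function (s_ n)) /\
    (forall x, s_ n x @[n --> \oo] --> f x).

Lemma simple_function_preimage (W : Type) (s : T -> W) (A : set W) :
  simple_function s -> measurable (s @^-1` A).
Proof.
move=> [fs ms].
have -> : s @^-1` A = \bigcup_(v in range s `&` A) (s @^-1` [set v]).
  apply/seteqP; split => [x Ax|x [v [_ Av]] /= ->//].
  by exists (s x) => //; split => //; exists x.
by apply: fin_bigcup_measurable => //; exact: finite_setIl.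
Qed.

Lemma simple_function2 (W1 W2 W : Type) (h : W1 -> W2 -> W) s1 s2 :
  simple_function s1 -> simple_function s2 ->
  simple_function (fun x => h (s1 x) (s2 x)).
Proof.
move=> S1 S2; split.
  apply: (@sub_finite_set _ _ [set h u v | u in range s1 & v in range s2]).
    by move=> _ [x _ <-]; exists (s1 x); [exists x|exists (s2 x) => //; exists x].
  by apply: finite_image2; [exact: S1.1|exact: S2.1].
move=> w.
have -> : (fun x => h (s1 x) (s2 x)) @^-1` [set w] =
    \bigcup_(u in range s1) (s1 @^-1` [set u] `&` s2 @^-1` [set v | h u v = w]).
  apply/seteqP; split => [x hx|x [u _] [/= -> //]].
  by exists (s1 x) => //; exists x.
apply: fin_bigcup_measurable; first exact: S1.1.
by move=> u _; apply: measurableI; apply: simple_function_preimage.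
Qed.

Lemma simple_function_cst (W : Type) (w : W) : simple_function (fun=> w).
Proof.
split; first by apply: (@sub_finite_set _ _ [set w]) => // _ [x _ <-].
move=> v; have [wv|wv] := pselect (w = v).
  by rewrite (_ : _ @^-1` _ = setT)//; apply/seteqP; split.
by rewrite (_ : _ @^-1` _ = set0)//; apply/seteqP; split.
Qed.

Lemma strongly_measurable_cst (v : V) : strongly_measurable (fun=> v).
Proof.
exists (fun _ _ => v); split => [n|x]; first exact: simple_function_cst.
exact: cvg_cst.
Qed.

Lemma strongly_measurableD f g :
  strongly_measurable f -> strongly_measurable g -> strongly_measurable (f \+ g).
Proof.
move=> [s [ss sf]] [r [rs rg]]; exists (fun n x => s n x + r n x).
split=> [n|x]; first exact: simple_function2.
by apply: cvgD; [exact: sf|exact: rg].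
Qed.

Lemma strongly_measurableZ (a : R[i]) f :
  strongly_measurable f -> strongly_measurable (fun x => a *: f x).
Proof.
move=> [s [ss sf]]; exists (fun n x => a *: s n x); split=> [n|x].
  exact: (simple_function2 (fun u _ => a *: u) (ss n) (ss n)).
by apply: cvgZr; exact: sf.
Qed.

Lemma measurable_rnorm f :
  strongly_measurable f -> measurable_fun setT (fun x => rnorm (f x)).
Proof.
move=> [s [ss sf]].
apply: (@measurable_fun_cvg _ _ _ _ (fun n x => rnorm (s n x))).
  move=> n _ Y mY; rewrite setTI.
  rewrite (_ : _ @^-1` Y = s n @^-1` [set v | Y (rnorm v)])//.
  exact: simple_function_preimage.
by move=> x _; apply: cvg_rnorm; exact: sf.
Qed.

End strongly_measurable.


Section Lp.
Context d (T : measurableType d) (R : realType).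
Variables (mu : {measure set T -> \bar R}) (p : R) (p1 : 1 <= p).
Variable V : normedModType R[i].
Implicit Types f g : T -> V.

Definition Lp_norm f : \bar R := 'N[mu]_p%:E[EFin \o (fun x => rnorm (f x))].

Definition in_Lp f : Prop := strongly_measurable f /\ (Lp_norm f < +oo)%E.

Let p0 : p != 0. Proof. by rewrite gt_eqF// (lt_le_trans ltr01). Qed.

Lemma Lp_norm_ge0 f : (0 <= Lp_norm f)%E.
Proof. exact: Lnorm_ge0. Qed.

Lemma Lp_norm_le f (h : T -> R) : strongly_measurable f -> measurable_fun setT h ->
  (forall x, rnorm (f x) <= h x) -> (Lp_norm f <= 'N[mu]_p%:E[EFin \o h])%E.
Proof.
move=> mf mh fh; rewrite /Lp_norm unlock.
have mpow (k : T -> R) : measurable_fun setT k ->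
    measurable_fun setT (fun x => (`|(EFin \o k) x| `^ p)%E).
  move=> mk; apply: (measurableT_comp (measurable_poweR p)).
  by apply: measurableT_comp => //; exact/measurable_EFinP.
apply: gt0_ler_poweR; rewrite ?invr_ge0 ?(le_trans ler01)//.
- by rewrite in_itv/= leey integral_ge0// => x _; exact: poweR_ge0.
- by rewrite in_itv/= leey integral_ge0// => x _; exact: poweR_ge0.
apply: ge0_le_integral => //.
- by move=> x _; exact: poweR_ge0.
- by apply: mpow; exact: measurable_rnorm.
- exact: mpow.
move=> x _; apply: gt0_ler_poweR; rewrite ?(le_trans ler01)//.
- by rewrite in_itv/= leey andbT.
- by rewrite in_itv/= leey andbT.
rewrite lee_fin ger0_norm ?rnorm_ge0// (le_trans (fh x))//.
exact: ler_norm.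
Qed.

Lemma Lp_normD f g : strongly_measurable f -> strongly_measurable g ->
  (Lp_norm (f \+ g)%R <= Lp_norm f + Lp_norm g)%E.
Proof.
move=> mf mg; apply: (le_trans (Lp_norm_le (h := fun x => rnorm (f x) + rnorm (g x)) _ _ _)).
- exact: strongly_measurableD.
- by apply: measurable_funD; exact: measurable_rnorm.
- by move=> x; exact: ler_rnormD.
exact: (@minkowski_EFin _ _ _ mu _ _ p (measurable_rnorm mf) (measurable_rnorm mg)).
Qed.

Lemma Lp_norm_cst0 : Lp_norm (fun=> 0) = 0%E.
Proof.
rewrite /Lp_norm (_ : EFin \o _ = cst 0%E) ?Lnorm0//.
by apply/funext => x /=; rewrite rnorm0.
Qed.

Lemma Lp_normZ (a : R[i]) f : strongly_measurable f ->
  Lp_norm (fun x => a *: f x) = ((rnorm (a : R[i]^o))%:E * Lp_norm f)%E.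
Proof.
move=> mf; rewrite /Lp_norm unlock; set c := rnorm (a : R[i]^o).
have c0 : 0 <= c by exact: rnorm_ge0.
under eq_integral => x _ do
  rewrite /= rnormZ -/c normrM powRM// EFinM.
rewrite ge0_integralZl//; last first.
  apply/measurable_EFinP; apply: (measurableT_comp (measurable_powR p)).
  by apply: measurableT_comp => //; exact: measurable_rnorm.
rewrite poweRM ?lee_fin ?powR_ge0 ?integral_ge0//.
by rewrite poweR_EFin -powRrM mulfV// powRr1 ?normr_ge0// ger0_norm.
Qed.

Lemma Lp_norm_eq0 f : strongly_measurable f -> Lp_norm f = 0%E ->
  {ae mu, forall x, f x = 0}.
Proof.
move=> mf /Lnorm_eq0_eq0; have mrf : measurable_fun setT (EFin \o (fun x => rnorm (f x))).
  by apply/measurable_EFinP; exact: measurable_rnorm.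
move=> /(_ mrf); rewrite lte_fin (lt_le_trans ltr01)// => /(_ isT).
move=> fx0; apply: filterS fx0 => x /(_ I) [] /rnorm_eq0 //.
Qed.

Lemma ae_Lp_norm f g : strongly_measurable f -> strongly_measurable g ->
  {ae mu, forall x, f x = g x} -> Lp_norm f = Lp_norm g.
Proof.
move=> mf mg fg; rewrite /Lp_norm unlock; congr (_ `^ _)%E.
have mpow k : strongly_measurable k ->
    measurable_fun setT (fun x => (`|(EFin \o (fun x => rnorm (k x))) x| `^ p)%E).
  move=> mk; apply: (measurableT_comp (measurable_poweR p)).
  by apply: measurableT_comp => //; apply/measurable_EFinP; exact: measurable_rnorm.
apply: ge0_ae_eq_integral => //; try exact: mpow.
- by move=> x _; exact: poweR_ge0.
- by move=> x _; exact: poweR_ge0.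
by apply: filterS fg => x /= -> .
Qed.

(* The proof p1 occurs in the type so that the instances below can find it. *)
Definition Lp_pred_def (_ : 1 <= p) : {pred T -> V} := mem [set f | in_Lp f].
Local Notation Lp_pred := (Lp_pred_def p1).

Lemma Lp_predP f : (f \in Lp_pred) <-> in_Lp f.
Proof. by rewrite /Lp_pred_def !inE. Qed.

Lemma Lp_submod_closed : submod_closed Lp_pred.
Proof.
split=> [|a f g /Lp_predP[mf lf] /Lp_predP[mg lg]]; apply/Lp_predP.
  by split; [exact: strongly_measurable_cst|rewrite Lp_norm_cst0 ltry].
have maf := strongly_measurableZ a mf.
split; first exact: strongly_measurableD.
apply: le_lt_trans (Lp_normD maf mg) _; rewrite lte_add_pinfty// Lp_normZ//.
by rewrite lte_mul_pinfty// lee_fin rnorm_ge0.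
Qed.

HB.instance Definition _ := GRing.isSubmodClosed.Build _ _ Lp_pred Lp_submod_closed.

Record Lp_fun := MkLpFun { Lp_fun_val :> T -> V ; _ : Lp_fun_val \in Lp_pred }.
HB.instance Definition _ := [isSub for Lp_fun_val].
HB.instance Definition _ := [Choice of Lp_fun by <:].
HB.instance Definition _ := [SubChoice_isSubLmodule of Lp_fun by <:].

Lemma Lp_funP (f : Lp_fun) : in_Lp f.
Proof. exact/Lp_predP/valP. Qed.

Definition Lp_null : {pred Lp_fun} := mem [set f : Lp_fun | {ae mu, forall x, f x = 0}].

Lemma Lp_nullP (f : Lp_fun) : (f \in Lp_null) <-> {ae mu, forall x, f x = 0}.
Proof. by rewrite /Lp_null !inE. Qed.

Lemma Lp_null_zmod_closed : zmod_closed Lp_null.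
Proof.
split=> [|f g /Lp_nullP f0 /Lp_nullP g0]; apply/Lp_nullP; first exact: aeW.
by apply: filterS2 f0 g0 => x /= fx gx; rewrite -[LHS]/(f x - g x) fx gx subrr.
Qed.

HB.instance Definition _ := GRing.isZmodClosed.Build _ Lp_null Lp_null_zmod_closed.

Local Open Scope quotient_scope.

Definition Lp : Type := Quotient.quot Lp_null.
HB.instance Definition _ := GRing.Zmodule.on Lp.
HB.instance Definition _ := EqQuotient.on Lp.

Implicit Types F G : Lp.

Lemma Lp_eqP (f g : Lp_fun) :
  \pi_Lp f = \pi_Lp g <-> {ae mu, forall x, f x = g x}.
Proof.
have -> : (\pi_Lp f = \pi_Lp g) <-> (f - g \in Lp_null).
  by split=> [/eqP|H]; [rewrite -Quotient.idealrBE|apply/eqP; rewrite -Quotient.idealrBE].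
rewrite Lp_nullP; split; apply: filterS => x /=.
  by rewrite -[LHS]/(f x - g x) => /eqP; rewrite subr_eq0 => /eqP.
by move=> fg; rewrite -[LHS]/(f x - g x) fg subrr.
Qed.

Lemma Lp_piD (f g : Lp_fun) : \pi_Lp (f + g) = \pi_Lp f + \pi_Lp g.
Proof. by rewrite piE. Qed.

Definition Lp_scale (a : R[i]) F : Lp := \pi_Lp (a *: repr F).

Lemma Lp_piZ a (f : Lp_fun) : \pi_Lp (a *: f) = Lp_scale a (\pi_Lp f).
Proof.
apply/Lp_eqP; have : \pi_Lp f = \pi_Lp (repr (\pi_Lp f)) by rewrite reprK.
move=> /Lp_eqP; apply: filterS => x /= fx.
by rewrite -[LHS]/(a *: f x) fx.
Qed.

Lemma Lp_scalerA a b F : Lp_scale a (Lp_scale b F) = Lp_scale (a * b) F.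
Proof. by rewrite -[F]reprK -(Lp_piZ b) -(Lp_piZ a) -(Lp_piZ (a * b)) scalerA. Qed.

Lemma Lp_scale1r : left_id 1 Lp_scale.
Proof. by move=> F; rewrite -[F]reprK -Lp_piZ scale1r. Qed.

Lemma Lp_scalerDr : right_distributive Lp_scale +%R.
Proof.
by move=> a F G; rewrite -[F]reprK -[G]reprK -Lp_piD -!Lp_piZ -Lp_piD scalerDr.
Qed.

Lemma Lp_scalerDl F : {morph Lp_scale^~ F : a b / a + b}.
Proof. by move=> a b; rewrite -[F]reprK -!Lp_piZ -Lp_piD scalerDl. Qed.

HB.instance Definition _ := GRing.Zmodule_isLmodule.Build R[i] Lp
  Lp_scalerA Lp_scale1r Lp_scalerDr Lp_scalerDl.

Definition Lp_val F : T -> V := repr F.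

Definition Lp_normr F : R[i] := (fine (Lp_norm (Lp_val F)))%:C%C.

Lemma Lp_normr_pi (f : Lp_fun) : Lp_normr (\pi_Lp f) = (fine (Lp_norm f))%:C%C.
Proof.
rewrite /Lp_normr; congr ((fine _)%:C%C).
apply: ae_Lp_norm; [exact: (Lp_funP _).1|exact: (Lp_funP _).1|].
by apply/Lp_eqP; rewrite reprK.
Qed.

Lemma Lp_norm_fin (f : Lp_fun) : Lp_norm f \is a fin_num.
Proof. by rewrite ge0_fin_numE ?Lp_norm_ge0//; exact: (Lp_funP _).2. Qed.

Lemma Lp_ler_normD F G : Lp_normr (F + G) <= Lp_normr F + Lp_normr G.
Proof.
rewrite -[F]reprK -[G]reprK -Lp_piD !Lp_normr_pi -raddfD lecR.
rewrite -fineD ?Lp_norm_fin// fine_le ?fin_numD ?Lp_norm_fin//.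
exact: (Lp_normD (Lp_funP (repr F)).1 (Lp_funP (repr G)).1).
Qed.

Lemma Lp_normrZ a F : Lp_normr (a *: F) = `|a| * Lp_normr F.
Proof.
rewrite -[F]reprK -[_ *: _]Lp_piZ !Lp_normr_pi.
rewrite (Lp_normZ a (Lp_funP (repr F)).1) fineM ?Lp_norm_fin//.
by rewrite rmorphM /= rnormC.
Qed.

Lemma Lp_normr_eq0 F : Lp_normr F = 0 -> F = 0.
Proof.
rewrite -[F]reprK Lp_normr_pi => /eqP; rewrite (_ : 0 = 0%:C%C)// (inj_eq (@complexI R)).
rewrite -eqe fineK ?Lp_norm_fin// => /eqP f0.
have -> : 0 = \pi_Lp 0 :> Lp by rewrite !piE.
by apply/Lp_eqP; exact: (Lp_norm_eq0 (Lp_funP _).1).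
Qed.

HB.instance Definition _ := Lmodule_isNormed.Build R[i] Lp
  Lp_ler_normD Lp_normrZ Lp_normr_eq0.

(* The class of f in Lp, with the default value 0 when f is not in Lp. The
   default never matters below: Lp_class is only applied to the image of an
   element of Lp under a pointwise bounded operator (see in_Lp_comp), possibly
   after a rotation of [0, 2 pi], and such a function is in Lp. *)
Definition Lp_class (f : T -> V) : Lp := \pi_Lp (insubd 0 f : Lp_fun).

End Lp.
Arguments Lp_class {d T R} mu {p} p1 {V} f.

Lemma Lp_classK d (T : measurableType d) (R : realType)
    (mu : {measure set T -> \bar R}) (p : R) (p1 : 1 <= p)
    (V : normedModType R[i]) (f : T -> V) :
  in_Lp mu p f -> {ae mu, forall x, Lp_val (Lp_class mu p1 f) x = f x}.
Proof.
move=> /Lp_predP H; have fLp := H p1.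
have : \pi_(Lp mu p1 V)%qT (repr (Lp_class mu p1 f)) = Lp_class mu p1 f.
  by rewrite reprK.
by move=> /Lp_eqP; apply: filterS => x; rewrite insubdK.
Qed.

Definition bounded_operator (R : realType) (V W : normedModType R[i])
    (f : V -> W) : Prop :=
  linear f /\ continuous f.

Definition opnorm (R : realType) (V W : normedModType R[i]) (f : V -> W) : \bar R :=
  ereal_sup [set (rnorm (f x))%:E | x in [set x | rnorm x <= 1]].

Definition Lp_map d (T : measurableType d) (R : realType)
    (mu : {measure set T -> \bar R}) (p : R) (p1 : 1 <= p)
    (V W : normedModType R[i]) (f : V -> W) (F : Lp mu p1 V) : Lp mu p1 W :=
  Lp_class mu p1 (f \o Lp_val F).

Section pointwise_operators.
Context (R : realType) (V W : normedModType R[i]) (f : V -> W).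
Hypothesis bf : bounded_operator f.

Lemma bounded_operator_rnorm :
  exists2 M, 0 <= M & forall x, rnorm (f x) <= M * rnorm x.
Proof.
have [lf cf] := bf.
pose fl := HB.pack_for {linear V -> W} f (GRing.isLinear.Build _ _ _ _ _ lf).
have := cf; rewrite -[f]/(fl : V -> W) => /linear_bounded_continuous.
move=> /linear_boundedP [M [Mreal MP]].
pose K := `|M| + 1.
have K0 : 0 <= K by rewrite addr_ge0.
have MK : M < K by rewrite ltr_pwDr// real_ler_norm.
exists (complex.Re K); first by move: K0; rewrite lecE => /andP[].
move=> x; rewrite -lecR rmorphM /= !rnormC.
suff -> : (complex.Re K)%:C%C = K by exact: MP.
by apply/eqP; move: K0; rewrite lecE eq_complex /= => /andP[/eqP -> _]; rewrite !eqxx.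
Qed.

Lemma in_Lp_comp d (T : measurableType d) (mu : {measure set T -> \bar R})
    (p : R) (p1 : 1 <= p) (g : T -> V) :
  in_Lp mu p g -> in_Lp mu p (f \o g).
Proof.
move=> [mg lg]; have [M M0 fM] := bounded_operator_rnorm.
have mfg : strongly_measurable (f \o g).
  have [s [ss sg]] := mg; exists (fun n => f \o s n); split=> [n|x].
    exact: (simple_function2 (fun u _ => f u) (ss n) (ss n)).
  by apply: (cvg_comp _ _ (sg x)); exact: bf.2.
split=> //; pose a := M%:C%C.
apply: (@le_lt_trans _ _ (Lp_norm mu p (fun x => a *: g x))).
  apply: Lp_norm_le => //.
    by apply: measurable_rnorm; exact: strongly_measurableZ.
  move=> x; rewrite rnormZ (le_trans (fM _))// ler_wpM2r ?rnorm_ge0//.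
  by rewrite /rnorm ger0_norm// ler0c.
by rewrite Lp_normZ// lte_mul_pinfty// lee_fin rnorm_ge0.
Qed.

End pointwise_operators.

(* An unbounded operator on V is represented by its graph. *)
Section operators.
Context (R : realType) (V : normedModType R[i]).
Implicit Types A : set (V * V).

Definition op_graph (f : V -> V) : set (V * V) := [set xy | xy.2 = f xy.1].

Definition op_add A (f : V -> V) : set (V * V) :=
  [set xy | exists2 z, A (xy.1, z) & xy.2 = z + f xy.1].

Definition op_subs A (l : R[i]) : set (V * V) := op_add A (fun x => - (l *: x)).

(* The inverse of A, when A is a bijection from its domain onto V. *)
Definition op_inv A : V -> V := fun y => xget 0 [set x | A (x, y)].

Definition resolvent_set A : set R[i] :=
  [set l | (forall y, exists! x, op_subs A l (x, y)) /\
           bounded_operator (op_inv (op_subs A l))].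

(* Only the values T t with 0 <= t are relevant. *)
Definition C0_semigroup (T : R -> V -> V) : Prop :=
  [/\ forall t, 0 <= t -> bounded_operator (T t),
      T 0 = id,
      forall s t, 0 <= s -> 0 <= t -> T (s + t) = T s \o T t &
      forall x, T t x @[t --> 0^'+] --> x].

Definition generator (T : R -> V -> V) : set (V * V) :=
  [set xy | t^-1%:C%C *: (T t xy.1 - xy.1) @[t --> 0^'+] --> xy.2].

Definition generates A (T : R -> V -> V) : Prop :=
  C0_semigroup T /\ generator T = A.

End operators.

Section evolution_semigroup.
Context (R : realType).

Definition mod2pi (x : R) : R := x - (2 * pi) * (Num.floor (x / (2 * pi)))%:~R.

(* Lebesgue measure on [0, 2 pi], as a measure on R vanishing outside. *)
Definition leb2pi : {measure set (measurableTypeR R) -> \bar R} :=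
  mrestr lebesgue_measure (measurable_itv `[0, 2 * pi]%R).

Definition evolution_semigroup (p : R) (p1 : 1 <= p) (X : normedModType R[i])
    (T : R -> X -> X) (t : R) (F : Lp leb2pi p1 X) : Lp leb2pi p1 X :=
  Lp_class leb2pi p1 (fun s => T t (Lp_val F (mod2pi (s - t)))).

End evolution_semigroup.

(* By bounded perturbation A + B D C generates a semigroup S whenever A does,
   and S is unique on nonnegative times. *)
Definition rc_stab1 (R : realType) (X U Y : normedModType R[i])
    (A : set (X * X)) (B : U -> X) (C : X -> Y) : \bar R :=
  ereal_sup [set r%:E | r in [set r : R | 0 < r /\
    forall D : Y -> U, bounded_operator D -> (opnorm D <= r%:E)%E ->
      exists2 S : R -> X -> X, generates (op_add A (B \o D \o C)) S &
        resolvent_set (op_graph (S (2 * pi))) 1]].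

Definition is_hilbert (R : realType) (H : completeNormedModType R[i]) : Prop :=
  exists ip : {dot H for Num.conj}, forall x : H, `|x| ^+ 2 = ip x x.

(* Main.v *)
(* For bounded [D], the evolution semigroup of [A + B D C] on [Lp] is generated by
   [Gamma + B D C] acting pointwise, and the generator of an evolution semigroup is invertible
   exactly when [1] is in the resolvent set of the semigroup at time [2 pi].

   Lower bound: if [||D|| ||C Gamma^-1 B|| < 1], then [Gamma + B D C] is invertible by a Neumann
   series for [1 + C Gamma^-1 B D], so that [D] is not destabilizing.

   Upper bound: if [||C (A - ik)^-1 B u|| > 1/r] with [||u|| <= 1], a norming functional gives an
   operator [D] of rank one with [||D|| <= r] for which [(A - ik)^-1 B u] is an eigenvector of
   [A + B D C] with eigenvalue [ik], hence a nonzero fixed vector of the semigroup at time [2 pi].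

   Hilbert case: [C Gamma^-1 B] maps [s |-> e^(iks) u] to [s |-> e^(iks) C (A - ik)^-1 B u], so by
   Pythagoras and density of the trigonometric polynomials its norm on [L2] is at most
   [sup_k ||C (A - ik)^-1 B||], which closes the chain of inequalities. *)

From HB Require Import structures.
Require Import Defs.
From mathcomp Require Import all_boot all_order all_algebra complex.
From mathcomp Require Import all_classical all_reals all_analysis measurable_realfun.
From mathcomp Require Import ring lra zify.

Set Implicit Arguments.
Unset Strict Implicit.
Unset Printing Implicit Defensive.
Import Order.TTheory GRing.Theory Num.Theory.
Import numFieldNormedType.Exports.
Local Open Scope classical_set_scope.
Local Open Scope ring_scope.

(** Paths in a Banach space are integrated by explicit step sums, derivatives are replaced by
    estimates on small intervals around a point, and both are globalised by induction along an
    interval. The obstacle in the equivalence is the return from [Lp] to [X]: elements of [Lp] are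
    only known almost everywhere, so a solution of [S (2 pi) z - z = x] cannot be read off at the
    endpoint of a path. Instead [Gamma u = S(.) x] is solved, which gives [S (2 pi) u(s) - u(s)] in
    closed form for almost every [s]; at one good [s], where [u(s)] is also controlled by the norm
    of [u], an algebraic correction yields [z]. Strong limits on [Lp], for every [p], are checked on
    the functions [e^(iks) x] alone, so density of the trigonometric polynomials is needed well
    before the Hilbert case; it is obtained from half-lines by a Dynkin argument. Multiplication by
    [e^(-ikt)] leaves a semigroup unchanged at time [2 pi], which reduces every [ik] to [0], for
    resolvents and for eigenvectors. Orthogonality in [L2] enters only as [|x + y| = |x - y|]. *)

Lemma subrACA (G : zmodType) (a b c d : G) : a - b - (c - d) = a - c - (b - d).
Proof. by rewrite !opprB addrACA [RHS]addrACA; congr (_ + _); exact: addrC. Qed.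

(** Serves to spread an error [e] over an interval of length [t]; the [+ 1] admits [t = 0]. *)
Lemma mul_frac_le (R : realFieldType) (t e : R) : 0 <= t -> 0 <= e -> t * (e / (t + 1)) <= e.
Proof.
move=> t0 e0; rewrite mulrCA ler_piMr// ler_pdivrMr ?ltr_wpDl// mul1r.
by rewrite lerDl.
Qed.

(** * Real-valued norms, sequences and linear maps *)

Section rnorm_tools.
Context (R : realType) (V : normedModType R[i]).
Implicit Types x y z : V.

Lemma rnormN x : rnorm (- x) = rnorm x.
Proof. by rewrite /rnorm normrN. Qed.

Lemma rnormZr (a : R) x : rnorm (a%:C%C *: x) = `|a| * rnorm x.
Proof.
rewrite rnormZ; congr (_ * _); apply: (@complexI R).
by rewrite rnormC normc_def /= expr0n /= addr0 sqrtr_sqr.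
Qed.

Lemma rnormZp (a : R) x : 0 <= a -> rnorm (a%:C%C *: x) = a * rnorm x.
Proof. by move=> a0; rewrite rnormZr ger0_norm. Qed.

Lemma rscalerA (a b : R) x : a%:C%C *: (b%:C%C *: x) = (a * b)%:C%C *: x.
Proof. by rewrite scalerA -(rmorphM (real_complex R)). Qed.

Lemma rscaleVK (a : R) x : a != 0 -> a%:C%C *: (a^-1%:C%C *: x) = x.
Proof. by move=> a0; rewrite rscalerA mulfV// scale1r. Qed.

Lemma ler_rnormB x y : rnorm (x - y) <= rnorm x + rnorm y.
Proof. by rewrite -(rnormN y); exact: ler_rnormD. Qed.

Lemma ler_rnorm_tri y x z : rnorm (x - z) <= rnorm (x - y) + rnorm (y - z).
Proof. by rewrite -[x - z](subrKA y); exact: ler_rnormD. Qed.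

Lemma rnorm_sum (I : Type) (r : seq I) (P : pred I) (F : I -> V) :
  rnorm (\sum_(i <- r | P i) F i) <= \sum_(i <- r | P i) rnorm (F i).
Proof.
elim/big_rec2 : _ => [|i a v _ h]; first by rewrite rnorm0.
by apply: le_trans (ler_rnormD _ _) _; rewrite lerD2l.
Qed.

(** A positive element of [R[i]] has zero imaginary part, so the radii may be taken real. *)
Lemma cvg_rnormP (T : Type) (F : set_system T) (FF : Filter F) (f : T -> V) x :
  f t @[t --> F] --> x <-> forall e : R, 0 < e -> \forall t \near F, rnorm (x - f t) < e.
Proof.
split=> [/cvgrPdist_lt fx e e0|fx].
  have e0' : 0 < e%:C%C by rewrite ltcR.
  by apply: filterS (fx _ e0') => t; rewrite -rnormC ltcR.
apply/cvgrPdist_lt => e; rewrite ltcE => /andP[/eqP/= Ime Re0].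
have -> : e = (complex.Re e)%:C%C by apply/eqP; rewrite eq_complex/= Ime !eqxx.
by apply: filterS (fx _ Re0) => t; rewrite -rnormC ltcR.
Qed.

Lemma near0rightP (P : R -> Prop) :
  (\forall t \near 0^'+, P t) <-> exists2 d : R, 0 < d & forall t, 0 < t -> t < d -> P t.
Proof.
split=> [/nbhs_ballP[d /= d0 dP]|[d d0 dP]].
  exists d => // t t0 td; apply: dP => //=.
  by rewrite /ball/= sub0r normrN gtr0_norm.
by near=> t; apply: dP => //.
Unshelve. all: by end_near. Qed.

Lemma cvg0right_rnormP (f : R -> V) x :
  f t @[t --> 0^'+] --> x <->
  forall e : R, 0 < e -> exists2 d : R, 0 < d &
    forall t, 0 < t -> t < d -> rnorm (x - f t) < e.
Proof.
split=> [/cvg_rnormP h e /h/near0rightP //|h].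
by apply/cvg_rnormP => e /h/near0rightP.
Qed.

Lemma cvgn_rnormP (u : nat -> V) x :
  u n @[n --> \oo] --> x <->
  forall e : R, 0 < e -> exists N, forall n, (N <= n)%N -> rnorm (x - u n) < e.
Proof.
split=> [/cvg_rnormP h e /h[N _ NP]|h].
  by exists N => n Nn; exact: NP.
by apply/cvg_rnormP => e /h[N NP]; exists N.
Qed.

Lemma cvgn_rnorm_le (u : nat -> V) x (r : R) (N : nat) y :
  u n @[n --> \oo] --> x -> (forall n, (N <= n)%N -> rnorm (u n - y) <= r) ->
  rnorm (x - y) <= r.
Proof.
move=> /cvgn_rnormP ux ur; apply/ler_addgt0Pr => e e0.
have [M MP] := ux _ e0; have := MP _ (leq_maxr N M); have := ur _ (leq_maxl N M).
move=> h1 h2; apply: le_trans (ler_rnorm_tri (u (maxn N M)) _ _) _.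
by rewrite addrC lerD// ltW.
Qed.

Lemma rnorm_lt_all x : (forall e : R, 0 < e -> rnorm x <= e) -> x = 0.
Proof.
move=> h; apply: rnorm_eq0; apply/eqP; rewrite eq_le rnorm_ge0 andbT.
by apply/ler_addgt0Pr => e e0; rewrite add0r h.
Qed.

End rnorm_tools.

Lemma invf_natP (R : realType) (e : R) : 0 < e -> exists N : nat, N.+1%:R^-1 < e.
Proof.
move=> e0; exists (Num.truncn e^-1); rewrite invf_plt ?posrE ?ltr0n//.
exact: truncnS_gt.
Qed.

Section complete.
Context (R : realType) (V : completeNormedModType R[i]).

Lemma rnorm_cauchy_cvg (u : nat -> V) :
  (forall e : R, 0 < e -> exists N, forall m n, (N <= m)%N -> (N <= n)%N ->
     rnorm (u m - u n) <= e) ->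
  exists x : V, u n @[n --> \oo] --> x.
Proof.
move=> h; suff ul : cvgn u by exists (limn u).
apply: (@cauchy_cvg V (u @ \oo)); apply/cauchy_ballP => e /=.
rewrite ltcE => /andP[/eqP/= Ime Re0].
have -> : e = (complex.Re e)%:C%C by apply/eqP; rewrite eq_complex/= Ime !eqxx.
have [N NP] := h _ (divr_gt0 Re0 (ltr0Sn R 1)).
exists (u @` [set n | (N <= n)%N], u @` [set n | (N <= n)%N]).
  by split; exists N => // n Nn; exists n.
move=> [_ _] /= [[m Nm <-] [n Nn <-]]; rewrite -ball_normE /ball_/= -rnormC ltcR.
by apply: le_lt_trans (NP _ _ Nm Nn) _; rewrite ltr_pdivrMr// ltr_pMr// ltr1n.
Qed.

End complete.

Section linear_functions.
Context (R : realType) (V W : normedModType R[i]) (f : V -> W).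
Hypothesis lf : linear f.

Lemma lin0 : f 0 = 0.
Proof.
have := lf 1 0 0; rewrite !scale1r !addr0 => /eqP.
by rewrite -subr_eq0 opprD addrA subrr sub0r oppr_eq0 => /eqP.
Qed.

Lemma linD x y : f (x + y) = f x + f y.
Proof. by have := lf 1 x y; rewrite !scale1r. Qed.

Lemma linZ a x : f (a *: x) = a *: f x.
Proof. by have := lf a x 0; rewrite lin0 !addr0. Qed.

Lemma linN x : f (- x) = - f x.
Proof. by rewrite -scaleN1r linZ scaleN1r. Qed.

Lemma linB x y : f (x - y) = f x - f y.
Proof. by rewrite linD linN. Qed.

Lemma lin_sum (I : Type) (r : seq I) (P : pred I) (F : I -> V) :
  f (\sum_(i <- r | P i) F i) = \sum_(i <- r | P i) f (F i).
Proof. by apply: big_morph; [exact: linD|exact: lin0]. Qed.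

Lemma rnorm_bounded_operator (M : R) :
  (forall x, rnorm (f x) <= M * rnorm x) -> bounded_operator f.
Proof.
move=> fM; split=> // x; apply/cvg_rnormP => e e0.
pose K := `|M| + 1.
have K0 : 0 < K by rewrite ltr_wpDl.
have := @cvg_id _ (nbhs x); move/cvg_rnormP => /(_ _ (divr_gt0 e0 K0)).
apply: filterS => t xt; rewrite -linB; apply: le_lt_trans (fM _) _.
apply: (@le_lt_trans _ _ (K * rnorm (x - t))).
  by rewrite ler_wpM2r ?rnorm_ge0// /K (le_trans (ler_norm _))// lerDl.
by rewrite mulrC -ltr_pdivlMr.
Qed.

End linear_functions.

(** * The uniform boundedness principle *)

Section uniform_boundedness.
Context (R : realType) (V : completeNormedModType R[i]) (W : normedModType R[i]).
Context (I : Type) (F : I -> V -> W).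
Hypothesis bF : forall i, bounded_operator (F i).
Hypothesis ptF : forall x, exists M, forall i, rnorm (F i x) <= M.

(** One step of a nested-ball construction: inside any ball lies a ball of at most half the radius
    on which some member of the family is at least [n]. The premise [0 < s.2] stands under the
    existential so that choice yields a function of all pairs. *)
Let unbounded_on_balls :
  ~ (exists2 M, 0 <= M & forall i x, rnorm (F i x) <= M * rnorm x) ->
  forall (n : nat) (s : V * R), exists s' : V * R, 0 < s.2 ->
    [/\ 0 < s'.2, s'.2 <= s.2 / 2, rnorm (s'.1 - s.1) <= s.2 / 2 &
     exists i, forall y, rnorm (y - s'.1) <= s'.2 -> n%:R <= rnorm (F i y)].
Proof.
move=> H n [x r].
have [r0|r0] := pselect (0 < r); last by exists (x, r) => /= /r0.
have r20 : 0 < r / 2 by rewrite divr_gt0.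
have [[y [i [xy Fy]]]|nH] := pselect
  (exists y i, rnorm (y - x) <= r / 2 /\ n%:R < rnorm (F i y)).
  have [M M0 FM] := bounded_operator_rnorm (bF i).
  (* The second term is the radius within which [F i] varies by at most its excess over [n] at
     [y]. *)
  pose d := Num.min (r / 2) ((rnorm (F i y) - n%:R) / (M + 1)).
  have M1 : 0 < M + 1 by rewrite ltr_wpDl.
  exists (y, d) => _ /=; split.
  - by rewrite lt_min r20 divr_gt0// subr_gt0.
  - by rewrite ge_min lexx.
  - exact: xy.
  exists i => z zy.
  have h : rnorm (F i z - F i y) <= rnorm (F i y) - n%:R.
    rewrite -(linB (bF i).1); apply: le_trans (FM _) _.
    have : rnorm (z - y) <= (rnorm (F i y) - n%:R) / (M + 1).
      by apply: le_trans zy _; rewrite ge_min lexx orbT.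
    rewrite ler_pdivlMr// mulrC; apply: le_trans.
    by rewrite ler_wpM2r ?rnorm_ge0// lerDl.
  have := ler_dist_rnorm (F i z) (F i y); rewrite ler_norml => /andP[+ _].
  by move=> h'; lra.
(* Otherwise the whole family is at most [n] on the ball of radius [r / 2] about [x]; a vector of
   norm [r / 2] is a difference of two points of that ball, so its image has norm at most [2 n]. *)
exfalso; apply: H; exists (n%:R * 2 / (r / 2)).
  by rewrite divr_ge0 ?mulr_ge0 ?ler0n// ltW.
move=> i z; have [->|z0] := eqVneq z 0.
  by rewrite (lin0 (bF i).1) !rnorm0 mulr0.
have nz0 : 0 < rnorm z.
  by rewrite lt_def rnorm_ge0 andbT; apply: contra z0 => /eqP/rnorm_eq0/eqP.
have bd y : rnorm (y - x) <= r / 2 -> rnorm (F i y) <= n%:R.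
  by move=> xy; rewrite leNgt; apply/negP => h; apply: nH; exists y, i.
pose y := x + (r / 2 / rnorm z)%:C%C *: z.
have yx : y - x = (r / 2 / rnorm z)%:C%C *: z by rewrite /y addrC addKr.
have c0 : 0 < r / 2 / rnorm z by rewrite divr_gt0.
have h1 : rnorm (F i y) <= n%:R.
  by apply: bd; rewrite yx rnormZr gtr0_norm// divfK// gt_eqF.
have h2 : rnorm (F i x) <= n%:R by apply: bd; rewrite subrr rnorm0 ltW.
have : rnorm (F i (y - x)) <= n%:R + n%:R.
  by rewrite (linB (bF i).1); apply: le_trans (ler_rnormB _ _) _; rewrite lerD.
rewrite yx (linZ (bF i).1) rnormZr gtr0_norm// -ler_pdivlMl// => /le_trans; apply.
rewrite !invf_div -mulr2n -mulr_natr le_eqVlt; apply/orP; left; apply/eqP.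
by field; rewrite gt_eqF.
Qed.

(** If no uniform bound existed, the nested balls would shrink to a point, and at that point the
    family would exceed its pointwise bound. *)
Lemma uniform_boundedness :
  exists2 M, 0 <= M & forall i x, rnorm (F i x) <= M * rnorm x.
Proof.
apply: contrapT => /unbounded_on_balls H.
have [g gP] := choice (fun ns : nat * (V * R) => H ns.1 ns.2).
pose s := fix s n : V * R := if n is m.+1 then g (m, s m) else (0, 1).
have s0 n : 0 < (s n).2.
  by elim: n => [|n ih] //=; have [] := gP (n, s n) ih.
have sP n := gP (n, s n) (s0 n).
(* Each step moves the centre by at most half the radius and lowers the radius by at least as much;
   in this form the estimate telescopes. *)
have nest n m : (n <= m)%N -> rnorm ((s m).1 - (s n).1) <= (s n).2 - (s m).2.
  elim: m => [|m ih]; first by rewrite leqn0 => /eqP ->; rewrite !subrr rnorm0.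
  rewrite leq_eqVlt => /orP[/eqP ->|]; first by rewrite !subrr rnorm0.
  rewrite ltnS => /ih h; have [_ h1 h2 _] := sP m.
  apply: le_trans (ler_rnorm_tri (s m).1 _ _) _.
  move: h1 h2; rewrite [g _](_ : _ = s m.+1)//= => h1 h2; lra.
have small n : (s n).2 <= n.+1%:R^-1.
  elim: n => [|n ih] /=; first by rewrite invr1.
  have [_ h1 _ _] := sP n; apply: le_trans h1 _.
  rewrite ler_pdivrMr//; apply: le_trans ih _.
  rewrite mulrC ler_pdivlMr ?ltr0n// ler_pdivrMl ?ltr0n//.
  by rewrite mulrC -natrM ler_nat; lia.
have [x xP] : exists x : V, (s n).1 @[n --> \oo] --> x.
  apply: rnorm_cauchy_cvg => e e0.
  have [N NP] := invf_natP e0; exists N => m n.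
  wlog mn : m n / (m <= n)%N.
    move=> W1 hm hn; have [/W1->//|/ltnW/W1 h] := leqP m n.
    by rewrite rnormB h.
  move=> Nm Nn; rewrite rnormB; apply: le_trans (nest _ _ mn) _.
  apply: (@le_trans _ _ (s m).2); first by rewrite gerBl ltW.
  apply: le_trans (small m) _; apply: le_trans (ltW NP).
  by rewrite lef_pV2 ?posrE ?ltr0n// ler_nat ltnS.
have xs n : rnorm (x - (s n).1) <= (s n).2.
  apply: (cvgn_rnorm_le (N := n) xP) => m nm; apply: le_trans (nest _ _ nm) _.
  by rewrite gerBl ltW.
have [M MP] := ptF x.
pose n := (Num.truncn M).+1.
have [_ _ _ [i iP]] := sP n.
have := iP x (xs n.+1); apply/negP; rewrite -ltNge.
apply: le_lt_trans (MP i) _; exact: truncnS_gt.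
Qed.

End uniform_boundedness.

(** * Strongly continuous semigroups *)

Section generator_basics.
Context (R : realType) (V : normedModType R[i]).
Implicit Type T : R -> V -> V.

(** The difference quotient multiplied out by [t], so that remainders can be added and mapped
    without division. *)
Lemma generatorP T x y : generator T (x, y) <->
  forall e : R, 0 < e -> exists2 d : R, 0 < d & forall t, 0 < t -> t < d ->
    rnorm (T t x - x - t%:C%C *: y) <= e * t.
Proof.
have E t : 0 < t -> rnorm (T t x - x - t%:C%C *: y) =
    t * rnorm (y - (t^-1)%:C%C *: (T t x - x)).
  by move=> t0; rewrite -rnormZp ?ltW// scalerBr rscaleVK ?gt_eqF// rnormB.
rewrite /generator /=; split=> [/cvg0right_rnormP h e e0|h].
  have [d d0 dP] := h _ e0; exists d => // t t0 td.
  by rewrite E// mulrC ler_wpM2r ?ltW// ?dP// fmorphV.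
apply/cvg0right_rnormP => e e0.
have [d d0 dP] := h _ (divr_gt0 e0 (ltr0Sn R 1)); exists d => // t t0 td.
have := dP _ t0 td; rewrite E// mulrC ler_pM2r// => h'; apply: le_lt_trans h' _.
by rewrite ltr_pdivrMr// ltr_pMr// ltr1n.
Qed.

End generator_basics.

Section semigroup_bounds.
Context (R : realType) (V : completeNormedModType R[i]) (T : R -> V -> V).
Hypothesis sT : C0_semigroup T.

(** A failure on every [[0, 1 / (n + 1)]] provides times [t n] tending to [0] whose operators have
    norms above [n + 1]. By strong continuity at [0] these operators are pointwise bounded, against
    the uniform boundedness principle. *)
Lemma semigroup_local_bound :
  exists d M : R, [/\ 0 < d, 1 <= M &
    forall t x, 0 <= t -> t <= d -> rnorm (T t x) <= M * rnorm x].
Proof.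
have [bT T0 TD Tc] := sT; apply: contrapT => H.
have {}H (n : nat) : exists tx : R * V, [/\ 0 <= tx.1, tx.1 <= n.+1%:R^-1 &
    n.+1%:R * rnorm tx.2 < rnorm (T tx.1 tx.2)].
  apply: contrapT => nH; apply: H; exists n.+1%:R^-1, n.+1%:R.
  split; rewrite ?invr_gt0 ?ltr0n// ?ler1n// => t x t0 tn.
  by rewrite leNgt; apply/negP => h; apply: nH; exists (t, x).
have {H}[g gP] := choice H.
have [||M M0 MP] := @uniform_boundedness R V V nat (fun n => T (g n).1).
- by move=> n; apply: bT; have [] := gP n.
- move=> x; have /cvg0right_rnormP/(_ _ (@ltr01 R))[d d0 dP] := Tc x.
  have [N NP] := invf_natP d0.
  have S0 : 0 <= \sum_(k < N) rnorm (T (g k).1 x).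
    by apply: sumr_ge0 => *; exact: rnorm_ge0.
  (* The sum covers the finitely many indices whose times may be large, the rest covers the times
     close to [0]. *)
  exists (\sum_(k < N) rnorm (T (g k).1 x) + (rnorm x + 1)) => n.
  have [nN|Nn] := ltnP n N.
    rewrite (bigD1 (Ordinal nN))//= -addrA lerDl addr_ge0 ?addr_ge0 ?rnorm_ge0//.
    by apply: sumr_ge0 => *; exact: rnorm_ge0.
  have [t0 tn _] := gP n.
  apply: le_trans (ler_wpDl S0 (lexx _)).
  have [->|tn0] := eqVneq (g n).1 0; first by rewrite T0 lerDl.
  have tp : 0 < (g n).1 by rewrite lt_def tn0.
  have td : (g n).1 < d.
    apply: le_lt_trans tn _; apply: le_lt_trans NP.
    by rewrite lef_pV2 ?posrE ?ltr0n// ler_nat ltnS.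
  have /ltW h := dP _ tp td; rewrite -{1}[T _ x](subrK x).
  apply: le_trans (ler_rnormD _ _) _.
  by rewrite addrC lerD2l rnormB.
pose n := Num.truncn M; have [_ _] := gP n; apply/negP; rewrite -leNgt.
apply: le_trans (MP _ _) _; rewrite ler_wpM2r ?rnorm_ge0//.
by rewrite ltW// truncnS_gt.
Qed.

(** Cutting [[0, t]] into at most [t / d + 1] pieces of length at most [d] gives the bound
    [M ^ (n + 1)] with [n <= t / d], whence the rate [ln M / d]. *)
Lemma semigroup_growth :
  exists M w : R, [/\ 1 <= M, 0 <= w &
    forall t x, 0 <= t -> rnorm (T t x) <= M * expR (w * t) * rnorm x].
Proof.
have [bT T0 TD Tc] := sT; have [d [M [d0 M1 dM]]] := semigroup_local_bound.
have M0 : 0 < M by rewrite (lt_le_trans ltr01).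
have H n t x : 0 <= t -> t <= n.+1%:R * d -> rnorm (T t x) <= M ^+ n.+1 * rnorm x.
  elim: n t x => [|n ih] t x t0; first by rewrite mul1r expr1; exact: dM.
  move=> tn; have [td|dt] := leP t d.
    apply: le_trans (dM _ _ t0 td) _; rewrite ler_wpM2r ?rnorm_ge0//.
    by rewrite exprS ler_peMr ?(ltW M0)// exprn_ege1.
  have -> : t = d + (t - d) by rewrite addrC subrK.
  have td0 : 0 <= t - d by rewrite subr_ge0 ltW.
  rewrite TD ?(ltW d0)//=; apply: le_trans (dM _ _ (ltW d0) (lexx _)) _.
  rewrite exprS -mulrA ler_wpM2l ?(ltW M0)// ih//.
  by move: tn; rewrite -[n.+2%:R]natr1 mulrDl mul1r -lerBlDr.
exists M, (ln M / d); split=> //; first by rewrite divr_ge0 ?ln_ge0// ltW.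
move=> t x t0; pose n := Num.truncn (t / d).
have td0 : 0 <= t / d by rewrite divr_ge0// ltW.
have /andP[n1 n2] := truncn_itv td0.
apply: le_trans (H n t x t0 _) _.
  by rewrite -ler_pdivrMr// ltW.
rewrite ler_wpM2r ?rnorm_ge0// exprS ler_wpM2l ?(ltW M0)//.
rewrite -[leLHS]lnK ?posrE ?exprn_gt0// ler_expR lnXn// -mulr_natr.
by rewrite -mulrA (mulrC d^-1) ler_wpM2l ?ln_ge0.
Qed.

Lemma semigroup_bound_on (L : R) : exists2 M : R, 0 < M &
  forall t x, 0 <= t -> t <= L -> rnorm (T t x) <= M * rnorm x.
Proof.
have [M [w [M1 w0 Mw]]] := semigroup_growth.
exists (M * expR (w * L)).
  by rewrite mulr_gt0 ?expR_gt0// (lt_le_trans ltr01).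
move=> t x t0 tL; apply: le_trans (Mw _ _ t0) _.
rewrite ler_wpM2r ?rnorm_ge0// ler_wpM2l ?(le_trans ler01)//.
by rewrite ler_expR ler_wpM2l.
Qed.

Lemma semigroup_continuous c x : 0 <= c -> forall e : R, 0 < e ->
  exists2 d : R, 0 < d & forall t y, 0 <= t -> `|t - c| < d -> rnorm (y - x) < d ->
    rnorm (T t y - T c x) < e.
Proof.
move=> c0 e e0; have [bT T0 TD Tc] := sT.
have [M M0 MP] := semigroup_bound_on (c + 1).
have eM0 : 0 < e / 2 / M by rewrite !divr_gt0.
have /cvg0right_rnormP/(_ _ eM0)[d d0 dP] := Tc x.
exists (Num.min (Num.min 1 d) (e / 2 / M)); first by rewrite !lt_min ltr01 d0.
move=> t y t0; rewrite !lt_min => /andP[/andP[tc1 tcd] _] /andP[_ yx].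
have tc : t <= c + 1 by move: tc1; rewrite ltr_norml => /andP[]; lra.
have h1 : rnorm (T t y - T t x) < e / 2.
  rewrite -(linB (bT _ t0).1); apply: le_lt_trans (MP _ _ t0 tc) _.
  by rewrite mulrC -ltr_pdivlMr.
suff h2 : rnorm (T t x - T c x) <= e / 2.
  apply: le_lt_trans (ler_rnorm_tri (T t x) _ _) _.
  by rewrite [ltRHS]splitr ltr_leD.
(* Since [T b x - T a x] is [T a] applied to [T (b - a) x - x], continuity at [0] from the right and
   a local bound give continuity from both sides. *)
have K (a b : R) : 0 <= a -> a < b -> b <= c + 1 -> `|b - a| < d ->
    rnorm (T b x - T a x) <= e / 2.
  move=> a0 ab bc bad; have ba0 : 0 < b - a by rewrite subr_gt0.
  have -> : b = a + (b - a) by rewrite addrC subrK.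
  rewrite TD ?(ltW ba0)//= -(linB (bT _ a0).1).
  apply: le_trans (MP _ _ a0 _) _; first by rewrite (le_trans _ bc)// ltW.
  rewrite mulrC -ler_pdivlMr// rnormB ltW// dP// (le_lt_trans _ bad)//.
  exact: ler_norm.
have [tc'|ct|->] := ltrgtP t c.
- by rewrite rnormB K// ?lerDl// distrC.
- by rewrite K.
- by rewrite subrr rnorm0 divr_ge0// ltW.
Qed.

(** [T t x - x] telescopes into the terms [T (k h) (T h x - x)], and [T h x - x] is [h y] up to
    [o(h)]. This is the formula expressing [T t x - x] as the integral of [T s y], with the integral
    replaced by its Riemann sums. *)
Lemma generator_Riemann_sum x y (t : R) : generator T (x, y) -> 0 <= t ->
  forall e : R, 0 < e -> exists N : nat, forall n, (N <= n)%N ->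
    rnorm (T t x - x -
      (t / n.+1%:R)%:C%C *: \sum_(k < n.+1) T (k%:R * (t / n.+1%:R)) y) <= e.
Proof.
move=> /generatorP gxy t0 e e0; have [bT T0 TD Tc] := sT.
have [M M0 MP] := semigroup_bound_on t.
have t10 : 0 < t + 1 by rewrite ltr_wpDl.
have e'0 : 0 < e / M / (t + 1) by rewrite !divr_gt0.
have [d d0 dP] := gxy _ e'0.
have [N NP] := invf_natP (divr_gt0 d0 t10).
exists N => n Nn.
have n0 : 0 < n.+1%:R :> R by rewrite ltr0n.
pose h := t / n.+1%:R; rewrite -/h.
have h0 : 0 <= h by rewrite divr_ge0// ltW.
have hn : n.+1%:R * h = t by rewrite /h mulrC divfK// gt_eqF.
have -> : T t x - x - h%:C%C *: (\sum_(k < n.+1) T (k%:R * h) y) =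
    \sum_(k < n.+1) T (k%:R * h) (T h x - x - h%:C%C *: y).
  transitivity (\sum_(0 <= k < n.+1) (T (k.+1%:R * h) x - T (k%:R * h) x)
      - h%:C%C *: (\sum_(k < n.+1) T (k%:R * h) y)).
    by rewrite telescope_sumr// hn mul0r T0.
  rewrite big_mkord scaler_sumr -sumrB; apply: eq_bigr => k _.
  have k0 : 0 <= k%:R * h by rewrite mulr_ge0.
  rewrite !(linB (bT _ k0).1) (linZ (bT _ k0).1); congr (_ - _ - _).
  by rewrite -natr1 mulrDl mul1r TD.
apply: le_trans (rnorm_sum _ _ _) _.
have hd : h < d.
  apply: le_lt_trans (_ : t * N.+1%:R^-1 < d).
    by rewrite ler_wpM2l// lef_pV2 ?posrE// ?ltr0n// ler_nat ltnS.
  have := NP; rewrite ltr_pdivlMr// mulrC; apply: le_lt_trans.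
  by rewrite ler_wpM2r ?invr_ge0// lerDl.
(* The step vanishes only for [t = 0]; the estimate from [generatorP] concerns positive times. *)
have [hz|hz] := eqVneq h 0.
  rewrite big1 ?ltW// => k _.
  by rewrite hz mulr0 !T0 /= scale0r !subrr rnorm0.
have hp : 0 < h by rewrite lt_def hz.
apply: (@le_trans _ _ (\sum_(k < n.+1) M * (e / M / (t + 1) * h))).
  apply: ler_sum => k _.
  have k0 : 0 <= k%:R * h by rewrite mulr_ge0.
  apply: le_trans (MP _ _ k0 _) _.
    by rewrite -hn ler_wpM2r// ler_nat ltnW.
  by rewrite ler_wpM2l ?dP// ltW.
rewrite sumr_const card_ord -mulr_natr.
have -> : M * (e / M / (t + 1) * h) * n.+1%:R = e * (t / (t + 1)).
  by rewrite -[X in e * (X / _)]hn; field; rewrite !gt_eqF.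
by rewrite ler_piMr ?ltW// ltr_pdivrMr// mul1r ltrDl.
Qed.

(** The mean value inequality: the Riemann sums of [T s y] differ from [t v] by an average of
    [T s y - v]. *)
Lemma generator_mean x y v (t r : R) : generator T (x, y) -> 0 <= t ->
  (forall s, 0 <= s -> s <= t -> rnorm (T s y - v) <= r) ->
  rnorm (T t x - x - t%:C%C *: v) <= t * r.
Proof.
move=> gxy t0 H; apply/ler_addgt0Pr => e e0.
have [N /(_ N (leqnn _))] := generator_Riemann_sum gxy t0 e0.
have n0 : 0 < N.+1%:R :> R by rewrite ltr0n.
set h := t / _ => hN.
have h0 : 0 <= h by rewrite divr_ge0// ltW.
have hn : N.+1%:R * h = t by rewrite /h mulrC divfK// gt_eqF.
move: h hN h0 hn => h hN h0 hn.
have -> : T t x - x - t%:C%C *: v =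
    (T t x - x - h%:C%C *: \sum_(k < N.+1) T (k%:R * h) y) +
    h%:C%C *: \sum_(k < N.+1) (T (k%:R * h) y - v).
  rewrite sumrB scalerBr addrA subrK; congr (_ - _).
  rewrite sumr_const card_ord -scaler_nat scalerA -hn mulrC; congr (_ *: _).
  by rewrite rmorphM rmorph_nat.
apply: le_trans (ler_rnormD _ _) _; rewrite addrC lerD//.
rewrite rnormZp// -hn -mulrA mulrCA ler_wpM2l//.
apply: le_trans (rnorm_sum _ _ _) _.
apply: (@le_trans _ _ (\sum_(k < N.+1) r)); last first.
  by rewrite sumr_const card_ord mulr_natl.
apply: ler_sum => k _; apply: H; first by rewrite mulr_ge0.
by rewrite -hn ler_wpM2r// ler_nat ltnW.
Qed.

End semigroup_bounds.

(** * Integration of continuous paths *)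

(** Compactness of [[a, b]] in the manner of Cousin's lemma: a property that is additive over
    adjacent intervals and holds on all small intervals around each point holds on [[a, b]]. The
    supremum of the [t] with [Q a t] can be passed unless it is [b]. *)
Lemma interval_induction (R : realType) (a b : R) (Q : R -> R -> Prop) : a <= b ->
  (forall s t u, a <= s -> s <= t -> t <= u -> u <= b -> Q s t -> Q t u -> Q s u) ->
  (forall c, a <= c -> c <= b -> exists2 d, 0 < d & forall s t,
     a <= s -> s <= c -> c <= t -> t <= b -> t - s < d -> Q s t) -> Q a b.
Proof.
move=> ab Qtrans Qloc.
pose S := [set t | [/\ a <= t, t <= b & Q a t]].
have Sa : S a.
  have [d d0 dP] := Qloc a (lexx _) ab.
  by split => //; apply: dP; rewrite ?subrr.
have Sub : has_ubound S by exists b => t [].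
have hS : has_sup S by split => //; exists a.
have ac : a <= sup S by apply: (ub_le_sup Sub).
have cb : sup S <= b by apply: ge_sup => //; [exists a|move=> t []].
have [d d0 dP] := Qloc _ ac cb.
have [t0 [at0 t0b Qat0] t0c] := sup_adherent (divr_gt0 d0 (ltr0Sn R 1)) hS.
have t0s : t0 <= sup S by apply: (ub_le_sup Sub).
(* [t0] lies within [d / 2] to the left of the supremum and [t] within [d / 3] to its right, so the
   interval between them is shorter than [d]. *)
pose t := Num.min b (sup S + d / 3).
have ct : sup S <= t by rewrite le_min cb lerDl divr_ge0// ltW.
have tb : t <= b by rewrite ge_min lexx.
have td : t <= sup S + d / 3 by rewrite ge_min lexx orbT.
have Qt : Q a t.
  by apply: (Qtrans _ t0) => //; [exact: le_trans ct|apply: dP => //; lra].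
have tc : t <= sup S by apply: (ub_le_sup Sub); split => //; exact: le_trans ct.
have : t = b.
  by move: tc; rewrite /t minEle; case: ifP => // _ h; exfalso; lra.
by move=> <-.
Qed.

Section integral.
Context (R : realType) (V : completeNormedModType R[i]).
Implicit Types (g G : R -> V).

Definition cont0 g := forall c, 0 <= c -> forall e : R, 0 < e ->
  exists2 d : R, 0 < d & forall t, 0 <= t -> `|t - c| < d -> rnorm (g t - g c) < e.

(* A form of [G' = g] on the half-line in which the two points straddle [c]. *)
Definition straddle G g := forall c, 0 <= c -> forall e : R, 0 < e ->
  exists2 d : R, 0 < d & forall s t, 0 <= s -> s <= c -> c <= t -> t - s < d ->
    rnorm (G t - G s - (t - s)%:C%C *: g c) <= (t - s) * e.

Let min_diff (s t x y : R) : s <= t -> x <= y ->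
  [/\ 0 <= Num.min t y - Num.min t x - (Num.min s y - Num.min s x),
      y < s -> Num.min t y - Num.min t x - (Num.min s y - Num.min s x) = 0 &
      t < x -> Num.min t y - Num.min t x - (Num.min s y - Num.min s x) = 0].
Proof.
rewrite !minEle => st xy.
by case: (leP t y); case: (leP t x); case: (leP s y); case: (leP s x) => *; split; lra.
Qed.

(** For [t >= 0], the length of the part of the cell from [k / n] to [(k + 1) / n] that lies below
    [t]. *)
Let weight (n k : nat) (t : R) : R :=
  Num.min t (k.+1%:R / n%:R) - Num.min t (k%:R / n%:R).

(** The integral over [[0, t]] of the step function that takes on each cell the value of [g] at the
    left node. With [(n + 1)^2] cells of length [1 / (n + 1)], one index refines the mesh and
    extends the range [[0, n + 1]]. *)
Definition step_sum g (n : nat) (t : R) : V :=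
  \sum_(k < n.+1 * n.+1) (weight n.+1 k t)%:C%C *: g (k%:R / n.+1%:R).

(** Only cells meeting [[s, t]] contribute to the increment, and their weights add up to [t - s]
    because [t] is within range. Nodes sit at the left ends of cells, so values of [g] down to one
    mesh length before [s] matter. *)
Lemma step_sum_near g v (n : nat) (s t e : R) : 0 <= s -> s <= t -> t <= n.+1%:R ->
  (forall r, 0 <= r -> s - n.+1%:R^-1 <= r -> r <= t -> rnorm (g r - v) <= e) ->
  rnorm (step_sum g n t - step_sum g n s - (t - s)%:C%C *: v) <= (t - s) * e.
Proof.
move=> s0 st tn ge.
have n0 : 0 < n.+1%:R :> R by rewrite ltr0n.
pose dw k := weight n.+1 k t - weight n.+1 k s.
have sum_dw : \sum_(k < n.+1 * n.+1) dw k = t - s.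
  have H r : 0 <= r -> r <= n.+1%:R -> \sum_(k < n.+1 * n.+1) weight n.+1 k r = r.
    move=> r0 rn; rewrite -(big_mkord xpredT (fun k => weight n.+1 k r)) telescope_sumr//.
    rewrite natrM mulfK ?gt_eqF// mul0r.
    by rewrite (min_idPl rn) (min_idPr r0) subr0.
  by rewrite /dw sumrB !H// ?(le_trans s0)// (le_trans st).
have wk k : k%:R / n.+1%:R <= k.+1%:R / n.+1%:R :> R.
  by rewrite ler_pM2r ?invr_gt0// ler_nat.
have dw0 k : 0 <= dw k by have [] := min_diff st (wk k).
have dwz k : dw k != 0 -> rnorm (g (k%:R / n.+1%:R) - v) <= e.
  have [_ h1 h2] := min_diff st (wk k).
  rewrite /dw /weight => h; apply: ge; first by rewrite divr_ge0// ltW.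
    rewrite leNgt; apply: contra h => h; rewrite h1//.
    by rewrite -natr1 mulrDl mul1r -ltrBrDr.
  by rewrite leNgt; apply: contra h => h; rewrite h2.
have -> : step_sum g n t - step_sum g n s - (t - s)%:C%C *: v =
    \sum_(k < n.+1 * n.+1) (dw k)%:C%C *: (g (k%:R / n.+1%:R) - v).
  rewrite -sum_dw /step_sum -sumrB rmorph_sum/= scaler_suml -sumrB.
  by apply: eq_bigr => k _; rewrite -scalerBl -rmorphB/= scalerBr.
apply: le_trans (rnorm_sum _ _ _) _.
rewrite -sum_dw mulr_suml; apply: ler_sum => k _; rewrite rnormZp//.
have [->|dk] := eqVneq (dw k) 0; first by rewrite !mul0r.
by rewrite ler_wpM2l// dwz.
Qed.

Lemma step_sum_local g c (e : R) : cont0 g -> 0 <= c -> 0 < e ->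
  exists2 d : R, 0 < d & exists N, forall n s t, (N <= n)%N ->
    0 <= s -> s <= c -> c <= t -> t - s < d ->
    rnorm (step_sum g n t - step_sum g n s - (t - s)%:C%C *: g c) <= (t - s) * e.
Proof.
move=> cg c0 e0; have [d d0 dP] := cg _ c0 _ e0.
have d20 : 0 < d / 2 by rewrite divr_gt0.
exists (Num.min 1 (d / 2)); first by rewrite lt_min ltr01.
have [N NP] := invf_natP d20.
exists (maxn N (Num.truncn (c + 1))) => n s t; rewrite geq_max => /andP[Nn cn].
move=> s0 sc ct; rewrite lt_min => /andP[ts1 tsd].
apply: step_sum_near => //; first exact: le_trans ct.
  have := truncnS_gt (c + 1); have : (Num.truncn (c + 1)).+1%:R <= n.+1%:R :> R.
    by rewrite ler_nat ltnS.
  by move=> h1 h2; lra.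
move=> r r0 sr rt; apply/ltW/dP => //.
have h : n.+1%:R^-1 <= N.+1%:R^-1 :> R by rewrite lef_pV2 ?posrE ?ltr0n// ler_nat ltnS.
move: (n.+1%:R^-1) (N.+1%:R^-1) sr h NP => a b sr h NP.
by rewrite ltr_norml; apply/andP; split; lra.
Qed.

Definition integ g (t : R) : V := lim (step_sum g n t @[n --> \oo]).

Lemma step_sum0 g n : step_sum g n 0 = 0.
Proof.
rewrite /step_sum big1// => k _; rewrite /weight !(min_idPl _) ?divr_ge0//.
by rewrite subrr scale0r.
Qed.

(** The Cauchy property is proved for increments over subintervals, with an error proportional to
    their length. In this form it is additive, and interval induction takes the place of uniform
    continuity of [g]. *)
Lemma integ_cvg g t : cont0 g -> 0 <= t -> step_sum g n t @[n --> \oo] --> integ g t.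
Proof.
move=> cg t0; suff [x xP] : exists x : V, step_sum g n t @[n --> \oo] --> x.
  by rewrite /integ (cvg_lim _ xP).
apply: rnorm_cauchy_cvg => e e0.
have t10 : 0 < t + 1 by rewrite ltr_wpDl.
have e'0 : 0 < e / (t + 1) by rewrite divr_gt0.
pose D m n (s u : R) := rnorm ((step_sum g m u - step_sum g m s) -
  (step_sum g n u - step_sum g n s)).
have : exists N, forall m n, (N <= m)%N -> (N <= n)%N ->
    D m n 0 t <= (t - 0) * (e / (t + 1)).
  apply: (interval_induction (a := 0) (b := t) (Q := fun s u => exists N,
    forall m n, (N <= m)%N -> (N <= n)%N -> D m n s u <= (u - s) * (e / (t + 1)))) => //.
    move=> s u v s0 su uv vt [N1 h1] [N2 h2]; exists (maxn N1 N2) => m n.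
    rewrite !geq_max => /andP[m1 m2] /andP[n1 n2].
    rewrite /D.
    rewrite (_ : _ - _ = (step_sum g m u - step_sum g m s -
      (step_sum g n u - step_sum g n s)) + (step_sum g m v - step_sum g m u -
      (step_sum g n v - step_sum g n u))); last first.
      rewrite addrACA -opprD; congr (_ - _).
        by rewrite [RHS]addrC subrKA.
      by rewrite [RHS]addrC subrKA.
    apply: le_trans (ler_rnormD _ _) _.
    apply: le_trans (lerD (h1 _ _ m1 n1) (h2 _ _ m2 n2)) _.
    by rewrite -mulrDl [u - s + _]addrC subrKA.
  move=> c c0 ct; have e2 : 0 < e / (t + 1) / 2 by rewrite divr_gt0.
  have [d d0 [N NP]] := step_sum_local cg c0 e2.
  exists d => // s u s0 sc cu ut usd; exists N => m n Nm Nn.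
  apply: le_trans (ler_rnorm_tri ((u - s)%:C%C *: g c) _ _) _.
  rewrite (splitr (e / (t + 1))) mulrDr lerD// ?NP// rnormB NP//.
move=> [N NP]; exists N => m n Nm Nn; have := NP m n Nm Nn.
rewrite /D !step_sum0 !subr0 => h; apply: le_trans h _.
exact: mul_frac_le t0 (ltW e0).
Qed.

Lemma integ0 g : integ g 0 = 0.
Proof.
by rewrite /integ; under eq_fun do rewrite step_sum0; exact: lim_cst.
Qed.

Lemma straddle_integ g : cont0 g -> straddle (integ g) g.
Proof.
move=> cg c c0 e e0; have [d d0 [N NP]] := step_sum_local cg c0 e0.
exists d => // s t s0 sc ct tsd.
have t0 : 0 <= t by rewrite (le_trans c0).
have ht := integ_cvg cg t0; have hs := integ_cvg cg s0.
apply: (cvgn_rnorm_le (N := N) (cvgB ht hs)) => n Nn.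
exact: NP.
Qed.

Lemma straddle_bound G g (a b K : R) : straddle G g -> 0 <= a -> a <= b ->
  (forall c, a <= c -> c <= b -> rnorm (g c) <= K) -> rnorm (G b - G a) <= (b - a) * K.
Proof.
move=> sG a0 ab gK; apply/ler_addgt0Pr => e e0.
have ba10 : 0 < b - a + 1 by rewrite ltr_wpDl// subr_ge0.
have e'0 : 0 < e / (b - a + 1) by rewrite divr_gt0.
apply: (@le_trans _ _ ((b - a) * (K + e / (b - a + 1)))); last first.
  by rewrite mulrDr lerD2l mul_frac_le// ?subr_ge0// ltW.
move: (e / _) e'0 => e' e'0.
apply: (interval_induction (Q := fun s t => rnorm (G t - G s) <= (t - s) * (K + e'))) => //.
  move=> s t u as_ st tu ub h1 h2.
  apply: le_trans (ler_rnorm_tri (G t) _ _) _.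
  apply: le_trans (lerD h2 h1) _.
  by rewrite -mulrDl subrKA.
move=> c ac cb; have [d d0 dP] := sG c (le_trans a0 ac) _ e'0.
exists d => // s t as_ sc ct tb tsd.
rewrite -[G t - G s](subrK ((t - s)%:C%C *: g c)).
apply: le_trans (ler_rnormD _ _) _; rewrite addrC mulrDr lerD//.
  by rewrite rnormZp ?subr_ge0 ?(le_trans sc)// ler_wpM2l ?subr_ge0 ?(le_trans sc)// gK.
by apply: dP => //; exact: le_trans as_.
Qed.

(** The factor 2 pays for replacing the exponential by its value at the left end: on intervals
    shorter than [ln 2 / w] it at most doubles. The estimate makes the Volterra operator below a
    contraction in an exponentially weighted norm. *)
Lemma straddle_bound_exp G g (a b K w : R) : straddle G g -> 0 <= a -> a <= b ->
  0 <= K -> 0 < w -> (forall c, a <= c -> c <= b -> rnorm (g c) <= K * expR (w * c)) ->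
  rnorm (G b - G a) <= 2 * K / w * (expR (w * b) - expR (w * a)).
Proof.
move=> sG a0 ab K0 w0 gK; apply/ler_addgt0Pr => e e0.
have ba10 : 0 < b - a + 1 by rewrite ltr_wpDl// subr_ge0.
have e'0 : 0 < e / (b - a + 1) by rewrite divr_gt0.
apply: (@le_trans _ _ (2 * K / w * (expR (w * b) - expR (w * a)) +
    (b - a) * (e / (b - a + 1)))); last first.
  by rewrite lerD2l mul_frac_le// ?subr_ge0// ltW.
move: (e / _) e'0 => e' e'0.
apply: (interval_induction (Q := fun s t => rnorm (G t - G s) <=
  2 * K / w * (expR (w * t) - expR (w * s)) + (t - s) * e')) => //.
  move=> s t u as_ st tu ub h1 h2.
  apply: le_trans (ler_rnorm_tri (G t) _ _) _.
  apply: le_trans (lerD h2 h1) _.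
  by rewrite le_eqVlt; apply/orP; left; apply/eqP; ring.
move=> c ac cb; have [d d0 dP] := sG c (le_trans a0 ac) _ e'0.
have ln20 : 0 < ln 2 :> R by rewrite ln_gt0// ltr1n.
exists (Num.min d (ln 2 / w)); first by rewrite lt_min d0 divr_gt0.
move=> s t as_ sc ct tb; rewrite lt_min => /andP[tsd tsl].
have ts0 : 0 <= t - s by rewrite subr_ge0 (le_trans sc).
rewrite -[G t - G s](subrK ((t - s)%:C%C *: g c)).
apply: le_trans (ler_rnormD _ _) _; rewrite addrC lerD//; last first.
  by apply: dP => //; exact: le_trans as_.
rewrite rnormZp//.
apply: (@le_trans _ _ ((t - s) * (K * (2 * expR (w * s))))).
  rewrite ler_wpM2l//; apply: le_trans (gK _ ac cb) _; rewrite ler_wpM2l//.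
  have -> : w * c = w * (c - s) + w * s by ring.
  rewrite expRD ler_wpM2r ?expR_ge0// -[leRHS]lnK ?posrE// ler_expR.
  by rewrite mulrC -ler_pdivlMr//; lra.
have -> : w * t = w * (t - s) + w * s by ring.
have subMr (x y : R) : x * y - y = (x - 1) * y by rewrite mulrBl mul1r.
rewrite expRD subMr.
have h : w * (t - s) <= expR (w * (t - s)) - 1.
  by have := expR_ge1Dx (w * (t - s)); lra.
have -> : (t - s) * (K * (2 * expR (w * s))) =
    2 * K / w * (w * (t - s) * expR (w * s)) by field; rewrite gt_eqF.
rewrite ler_wpM2l ?divr_ge0 ?mulr_ge0 ?(ltW w0)//.
by rewrite ler_wpM2r ?expR_ge0.
Qed.

Lemma straddleD G g G' g' : straddle G g -> straddle G' g' ->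
  straddle (fun t => G t + G' t) (fun t => g t + g' t).
Proof.
move=> h h' c c0 e e0; have e20 : 0 < e / 2 by rewrite divr_gt0.
have [d d0 dP] := h _ c0 _ e20; have [d' d'0 d'P] := h' _ c0 _ e20.
exists (Num.min d d'); first by rewrite lt_min d0.
move=> s t s0 sc ct; rewrite lt_min => /andP[td td'].
rewrite (_ : _ - _ = (G t - G s - (t - s)%:C%C *: g c) +
    (G' t - G' s - (t - s)%:C%C *: g' c)); last first.
  by rewrite [RHS]addrACA [in RHS](addrACA (G t)) -!opprD -scalerDr.
apply: le_trans (ler_rnormD _ _) _; rewrite (splitr e) mulrDr.
by rewrite lerD ?dP ?d'P.
Qed.

Lemma straddle_op (f : V -> V) G g : bounded_operator f -> straddle G g ->
  straddle (f \o G) (f \o g).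
Proof.
move=> bf h c c0 e e0; have [M M0 fM] := bounded_operator_rnorm bf.
have M10 : 0 < M + 1 by rewrite ltr_wpDl.
have [d d0 dP] := h _ c0 _ (divr_gt0 e0 M10); exists d => // s t s0 sc ct td /=.
rewrite -(linZ bf.1) -!(linB bf.1); apply: le_trans (fM _) _.
have := dP s t s0 sc ct td; rewrite mulrA ler_pdivlMr// mulrC; apply: le_trans.
by rewrite ler_wpM2r ?rnorm_ge0// lerDl.
Qed.

Lemma straddleB G g G' g' : straddle G g -> straddle G' g' ->
  straddle (fun t => G t - G' t) (fun t => g t - g' t).
Proof.
move=> h h'; apply: (straddleD h); apply: (straddle_op _ h').
have oppL : linear (-%R : V -> V) by move=> a x y; rewrite opprD scalerN.
by apply: (rnorm_bounded_operator oppL (M := 1)) => x; rewrite mul1r rnormN.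
Qed.

Lemma straddle_shift G g a : 0 <= a -> straddle G g ->
  straddle (fun t => G (t + a)) (fun t => g (t + a)).
Proof.
move=> a0 h c c0 e e0; have [d d0 dP] := h _ (addr_ge0 c0 a0) _ e0.
exists d => // s t s0 sc ct td; have E : (t + a) - (s + a) = t - s by ring.
by have := dP (s + a) (t + a); rewrite E; apply; rewrite ?lerD2r ?addr_ge0.
Qed.

(** The difference has derivative zero on [[0, t]]. Agreement of [g] and [g'] on [[0, t]] alone is
    what the convolution kernels offer, as they are truncated beyond the diagonal. *)
Lemma straddle_uniq G g G' g' (t : R) : straddle G g -> straddle G' g' -> 0 <= t ->
  (forall s, 0 <= s -> s <= t -> g s = g' s) -> G t - G 0 = G' t - G' 0.
Proof.
move=> h h' t0 gg'; apply/eqP; rewrite -subr_eq0; apply/eqP/rnorm_eq0/eqP.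
rewrite eq_le rnorm_ge0 andbT.
rewrite subrACA.
apply: le_trans (straddle_bound (straddleB h h') (lexx 0) t0 (K := 0) _) _.
  by move=> c c0 ct; rewrite gg'// subrr rnorm0.
by rewrite mulr0.
Qed.

Lemma integ_uniq G g (t : R) : straddle G g -> cont0 g -> 0 <= t ->
  G t - G 0 = integ g t.
Proof.
move=> sG cg t0; rewrite -[RHS]subr0 -(integ0 g).
by apply: (straddle_uniq sG (straddle_integ cg)).
Qed.

Lemma eq_integ g g' (t : R) : cont0 g -> cont0 g' -> 0 <= t ->
  (forall s, 0 <= s -> s <= t -> g s = g' s) -> integ g t = integ g' t.
Proof.
move=> cg cg' t0 gg'; rewrite -[LHS]subr0 -[RHS]subr0 -{1}(integ0 g) -(integ0 g').
exact: (straddle_uniq (straddle_integ cg) (straddle_integ cg')).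
Qed.

Lemma integ_shift g (a t : R) : cont0 g -> cont0 (fun s => g (s + a)) -> 0 <= a -> 0 <= t ->
  integ (fun s => g (s + a)) t = integ g (t + a) - integ g a.
Proof.
move=> cg cga a0 t0.
by rewrite -(integ_uniq (straddle_shift a0 (straddle_integ cg)) cga t0) add0r.
Qed.

Definition jcont (h : R -> R -> V) := forall t s, 0 <= t -> 0 <= s ->
  forall e : R, 0 < e -> exists2 d : R, 0 < d & forall t' s', 0 <= t' -> 0 <= s' ->
    `|t' - t| < d -> `|s' - s| < d -> rnorm (h t' s' - h t s) < e.

Lemma jcont_cont0 h t : jcont h -> 0 <= t -> cont0 (h t).
Proof.
move=> jh t0 c c0 e e0; have [d d0 dP] := jh _ _ t0 c0 _ e0.
by exists d => // s s0 sc; apply: dP => //; rewrite subrr normr0.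
Qed.

(** For [u] near [t], the integral of [h u - h t] over [[0, t]] is small by interval induction, and
    the integral of [h u] between [t] and [u] is at most [|u - t|] times a local bound. *)
Lemma jcont_integ h : jcont h -> cont0 (fun t => integ (h t) t).
Proof.
move=> jh t t0 e e0.
have e30 : 0 < e / 3 by rewrite divr_gt0.
have ch u (u0 : 0 <= u) := jcont_cont0 jh u0.
have sh u (u0 : 0 <= u) := straddle_integ (ch u u0).
have [d d0 dP] : exists2 d, 0 < d & forall u, 0 <= u -> `|u - t| < d ->
    rnorm (integ (h u) t - integ (h t) t) <= e / 3.
  have t10 : 0 < t + 1 by rewrite ltr_wpDl.
  have e'0 : 0 < e / 3 / (t + 1) by rewrite divr_gt0.
  have [d d0 dP] : exists2 d, 0 < d & forall u, 0 <= u -> `|u - t| < d ->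
     rnorm ((integ (h u) t - integ (h u) 0) - (integ (h t) t - integ (h t) 0))
       <= (t - 0) * (e / 3 / (t + 1)).
    apply: (interval_induction (a := 0) (b := t) (Q := fun a b => exists2 d, 0 < d &
      forall u, 0 <= u -> `|u - t| < d ->
      rnorm ((integ (h u) b - integ (h u) a) - (integ (h t) b - integ (h t) a))
       <= (b - a) * (e / 3 / (t + 1)))) => //.
      move=> a b c a0 ab bc ct [d1 d10 h1] [d2 d20 h2].
      exists (Num.min d1 d2); first by rewrite lt_min d10.
      move=> u u0; rewrite lt_min => /andP[ud1 ud2].
      rewrite (_ : _ - _ = (integ (h u) b - integ (h u) a - (integ (h t) b - integ (h t) a))
        + (integ (h u) c - integ (h u) b - (integ (h t) c - integ (h t) b))); last first.
        rewrite addrACA -opprD; congr (_ - _).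
          by rewrite [RHS]addrC subrKA.
        by rewrite [RHS]addrC subrKA.
      apply: le_trans (ler_rnormD _ _) _.
      apply: le_trans (lerD (h1 _ u0 ud1) (h2 _ u0 ud2)) _.
      by rewrite -mulrDl [b - a + _]addrC subrKA.
    move=> c c0 ct; have e'20 : 0 < e / 3 / (t + 1) / 2 by rewrite divr_gt0.
    have [d d0 dP] := jh _ _ t0 c0 _ e'20.
    exists d => // a b a0 ac cb bt bad; exists d => // u u0 ud.
    have := straddle_bound (straddleB (sh u u0) (sh t t0)) a0 (le_trans ac cb)
      (K := e / 3 / (t + 1)).
    rewrite subrACA; apply => r ar rb; apply: le_trans (ler_rnorm_tri (h t c) _ _) _.
      have r0 : 0 <= r by rewrite (le_trans a0).
      have rc : `|r - c| < d by rewrite ltr_norml; apply/andP; split; lra.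
      rewrite [leRHS]splitr (rnormB (h t c)) lerD// ltW// dP//.
      by rewrite subrr normr0.
  exists d => // u u0 ud; have := dP u u0 ud; rewrite !integ0 !subr0 => h'.
  by apply: le_trans h' _; exact: mul_frac_le t0 (ltW e30).
have [d' d'0 d'P] := jh _ _ t0 t0 _ ltr01.
pose K := rnorm (h t t) + 1.
have K0 : 0 < K by rewrite ltr_wpDl// rnorm_ge0.
exists (Num.min (Num.min d d') (e / 3 / K)).
  by rewrite !lt_min d0 d'0 divr_gt0.
move=> u u0; rewrite !lt_min => /andP[/andP[ud ud'] uK].
have hK r : 0 <= r -> `|r - t| < d' -> rnorm (h u r) <= K.
  move=> r0 rt; rewrite -[h u r](subrK (h t t)) addrC.
  by apply: le_trans (ler_rnormD _ _) _; rewrite lerD2l ltW// d'P.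
have h2 : rnorm (integ (h u) u - integ (h u) t) <= e / 3.
  apply: (@le_trans _ _ (`|u - t| * K)); last by rewrite -ler_pdivlMr// ltW.
  have [tu|ut] := leP t u.
    rewrite ger0_norm ?subr_ge0//; apply: (straddle_bound (sh u u0)) => // r tr ru.
    have r0 : 0 <= r by rewrite (le_trans t0).
    apply: hK => //; move: ud'; rewrite !ger0_norm ?subr_ge0//.
    by apply: le_lt_trans; rewrite lerD2r.
  rewrite rnormB ltr0_norm ?subr_lt0// opprB.
  apply: (straddle_bound (sh u u0)) => //; first exact: ltW.
  move=> r ur rt; apply: hK; first exact: le_trans ur.
  move: ud'; rewrite distrC (distrC r) !ger0_norm ?subr_ge0// ?ltW//.
  by apply: le_lt_trans; rewrite lerD2l lerN2.
apply: le_lt_trans (ler_rnorm_tri (integ (h u) t) _ _) _.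
apply: (le_lt_trans (lerD h2 (dP _ u0 ud))).
by lra.
Qed.

End integral.

(** * Resolvents of generators *)

Section operator_inverse.
Context (R : realType) (V : normedModType R[i]).
Implicit Types (A : set (V * V)) (f : V -> V) (x y : V).

(** Bijectivity onto [V] and the norm bound of the inverse in one quantitative predicate, which
    applies alike to generators and to graphs of bounded operators. *)
Definition boundedly_invertible A (K : R) := forall y, exists x,
  [/\ A (x, y), forall x', A (x', y) -> x' = x & rnorm x <= K * rnorm y].

Definition linear_graph A := forall a x y x' y', A (x, y) -> A (x', y') ->
  A (a *: x + x', a *: y + y').

Section op_inv.
Variables (A : set (V * V)) (K : R).
Hypothesis iA : boundedly_invertible A K.

Lemma op_inv_graph y : A (op_inv A y, y).
Proof. by have [x [Axy _ _]] := iA y; rewrite /op_inv; case: xgetP => [z ->|/(_ x)]. Qed.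

Lemma op_inv_uniq x y : A (x, y) -> op_inv A y = x.
Proof.
by have [z [Azy zP _]] := iA y; move=> /zP ->; apply: zP; exact: op_inv_graph.
Qed.

Lemma rnorm_op_inv y : rnorm (op_inv A y) <= K * rnorm y.
Proof. by have [x [/op_inv_uniq -> _]] := iA y. Qed.

Lemma bounded_op_inv : linear_graph A -> bounded_operator (op_inv A).
Proof.
move=> lA; apply: (@rnorm_bounded_operator _ _ _ _ _ K); last exact: rnorm_op_inv.
by move=> a x y; apply: op_inv_uniq; apply: lA; exact: op_inv_graph.
Qed.

End op_inv.

Lemma op_subs_op_graph1 f x y : op_subs (op_graph f) 1 (x, y) <-> f x - x = y.
Proof.
rewrite /op_subs /op_add /op_graph /=; split=> [[z -> ->]|<-]; first by rewrite scale1r.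
by exists (f x) => //; rewrite scale1r.
Qed.

Lemma resolvent_set_graph1P f : linear f ->
  resolvent_set (op_graph f) 1 <-> exists K, boundedly_invertible (op_subs (op_graph f) 1) K.
Proof.
move=> lf; split=> [[h bi]|[K iK]].
  have [K K0 KP] := bounded_operator_rnorm bi; exists K => y.
  have [x [xy xu]] := h y.
  have xE : op_inv (op_subs (op_graph f) 1) y = x.
    rewrite /op_inv; case: xgetP => [z _ zy|/(_ x) nx]; last by [].
    by rewrite (xu z).
  exists x; split => //; first by move=> x' /xu.
  by rewrite -xE.
split; first by move=> y; have [x [xy xu _]] := iK y; exists x; split => // x' /xu.
apply: (bounded_op_inv iK) => a x y x' y'.
rewrite !op_subs_op_graph1 => <- <-.
by rewrite (linD lf) (linZ lf) scalerBr opprD addrACA.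
Qed.

End operator_inverse.

Section generator_inverse.
Context (R : realType) (V : completeNormedModType R[i]) (T : R -> V -> V).
Hypothesis sT : C0_semigroup T.

Lemma linear_generator : linear_graph (generator T).
Proof.
move=> a x y x' y' /generatorP h /generatorP h'; have [bT _ _ _] := sT.
apply/generatorP => e e0; pose K := rnorm (a : R[i]^o) + 1.
have K0 : 0 < K by rewrite ltr_wpDl// rnorm_ge0.
have e1 : 0 < e / 2 / K by rewrite !divr_gt0.
have e2 : 0 < e / 2 by rewrite divr_gt0.
have [d d0 dP] := h _ e1; have [d' d'0 d'P] := h' _ e2.
exists (Num.min d d'); first by rewrite lt_min d0.
move=> t t0; rewrite lt_min => /andP[td td'].
have lT := (bT t (ltW t0)).1.
rewrite (_ : _ - _ = a *: (T t x - x - t%:C%C *: y) + (T t x' - x' - t%:C%C *: y')).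
  apply: le_trans (ler_rnormD _ _) _; rewrite [e in leRHS]splitr mulrDl lerD ?d'P//.
  rewrite rnormZ; apply: (@le_trans _ _ (K * rnorm (T t x - x - t%:C%C *: y))).
    by rewrite ler_wpM2r ?rnorm_ge0// lerDl.
  rewrite mulrC -ler_pdivlMr//; apply: le_trans (dP _ t0 td) _.
  by rewrite mulrAC.
rewrite (linD lT) (linZ lT) !scalerBr [RHS]addrACA [in RHS](addrACA (a *: T t x)).
by rewrite -!opprD scalerDr !scalerA (mulrC a).
Qed.

Lemma cont0_orbit x : cont0 (T^~ x).
Proof.
move=> c c0 e e0; have [d d0 dP] := semigroup_continuous sT x c0 e0.
by exists d => // t t0 tc; apply: dP => //; rewrite subrr rnorm0.
Qed.

(** [T h] moves the integral over [[0, t]] to the integral over [[h, t + h]]. The change is the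
    integral over [[t, t + h]] minus the one over [[0, h]], which is [h] times [T t y - y] up to
    [o(h)]. *)
Lemma generator_orbit y t : 0 <= t -> generator T (integ (T^~ y) t, T t y - y).
Proof.
move=> t0; have [bT T0 TD _] := sT; have cy := cont0_orbit y.
have sy := straddle_integ cy.
apply/generatorP => e e0; have e20 : 0 < e / 2 by rewrite divr_gt0.
have [d d0 dP] := sy _ t0 _ e20; have [d' d'0 d'P] := sy _ (lexx 0) _ e20.
exists (Num.min d d'); first by rewrite lt_min d0.
move=> h h0; rewrite lt_min => /andP[hd hd']; have h0' := ltW h0.
have cyh : cont0 (fun s => T (s + h) y).
  move=> c c0 e' e'0; have [d1 d10 d1P] := cy (c + h) (addr_ge0 c0 h0') _ e'0.
  exists d1 => // u u0 uc; apply: d1P; first by rewrite addr_ge0.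
  by rewrite (_ : u + h - (c + h) = u - c)//; ring.
have -> : T h (integ (T^~ y) t) = integ (T^~ y) (t + h) - integ (T^~ y) h.
  rewrite -(integ_shift cy) // -(@integ_uniq _ _ (T h \o integ (T^~ y)) _ _ _ cyh)//=.
    by rewrite integ0 (lin0 (bT _ h0').1) subr0.
  move=> c c0 e' e'0; have [d1 d10 d1P] := straddle_op (bT _ h0') sy c0 e'0.
  exists d1 => // s u s0 sc cu us.
  by have := d1P s u s0 sc cu us; rewrite /= (addrC c h) TD.
have := dP t (t + h) t0 (lexx _); rewrite lerDl [_ + h - t]addrAC subrr add0r => /(_ h0' hd) H1.
have := d'P 0 h (lexx _) (lexx _) h0'; rewrite subr0 integ0 subr0 T0 => /(_ hd') H2.
rewrite (_ : _ - _ = integ (T^~ y) (t + h) - integ (T^~ y) t - h%:C%C *: T t y -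
    (integ (T^~ y) h - h%:C%C *: y)).
  apply: le_trans (ler_rnormB _ _) _.
  by apply: le_trans (lerD H1 H2) _; rewrite -mulrDr -splitr mulrC.
by rewrite [RHS]subrACA -scalerBr [X in X - _ = _]addrAC.
Qed.

(** With [z] the solution of [T tau z - z = y], the integral of [T s z] over [[0, tau]] is a
    preimage of [y]. It is used for the evolution semigroup with [tau = 2 pi], and for the
    semigroups [e^(-ikt) S t]. *)
Lemma generator_invertible (tau : R) : 0 <= tau ->
  resolvent_set (op_graph (T tau)) 1 ->
  exists2 K, 0 <= K & boundedly_invertible (generator T) K.
Proof.
move=> tau0; have [bT T0 TD _] := sT.
move=> /(resolvent_set_graph1P (bT _ tau0).1)[K iK].
have [M M0 MP] := semigroup_bound_on sT tau.
pose L := `|K| * (tau * M).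
have L0 : 0 <= L by rewrite !mulr_ge0// ltW.
(* An a priori estimate, which also gives uniqueness: [T tau x - x] is the mean of [T s y] times
   [tau], and [T tau - 1] has an inverse bounded by [K]. *)
have bd x y : generator T (x, y) -> rnorm x <= L * rnorm y.
  move=> gxy.
  have -> : x = op_inv (op_subs (op_graph (T tau)) 1) (T tau x - x).
    by rewrite (op_inv_uniq iK (x := x))//; apply/op_subs_op_graph1.
  apply: le_trans (rnorm_op_inv iK _) _.
  apply: (@le_trans _ _ (`|K| * rnorm (T tau x - x))).
    by rewrite ler_wpM2r ?rnorm_ge0// ler_norm.
  rewrite -!mulrA ler_wpM2l//.
  have := generator_mean sT (v := 0) gxy tau0 (r := M * rnorm y).
  rewrite scaler0 subr0; apply => s s0 st; rewrite subr0.
  exact: MP.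
exists L => // y.
pose z := op_inv (op_subs (op_graph (T tau)) 1) y.
have zy : T tau z - z = y by apply/op_subs_op_graph1; exact: op_inv_graph iK y.
have gx : generator T (integ (T^~ z) tau, y) by rewrite -zy; exact: generator_orbit.
exists (integ (T^~ z) tau); split => //; last exact: bd.
move=> x' gx'; apply/eqP; rewrite -subr_eq0; apply/eqP/rnorm_eq0.
apply/eqP; rewrite eq_le rnorm_ge0 andbT.
have := @linear_generator (-1) _ _ _ _ gx gx'; rewrite !scaleN1r [- y + _]addrC subrr.
by move=> /bd; rewrite rnorm0 mulr0 addrC.
Qed.

End generator_inverse.

(** * Bounded perturbation *)

Lemma geometric_small (R : realType) (K e : R) : 0 <= K -> 0 < e ->
  exists N : nat, K / 2 ^+ N <= e.
Proof.
move=> K0 e0; have [N NP] := invf_natP (divr_gt0 e0 (ltr_wpDl K0 ltr01)); exists N.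
have h2 : N.+1%:R <= 2 ^+ N :> R by rewrite -natrX ler_nat ltn_expl.
rewrite ler_pdivrMr ?exprn_gt0//; apply: (@le_trans _ _ (e * N.+1%:R)).
  have : (K + 1) < e * N.+1%:R.
    by move: NP; rewrite ltr_pdivlMr ?ltr_wpDl// mulrC ltr_pdivrMr ?ltr0n.
  by move=> h'; lra.
by rewrite ler_wpM2l// ltW.
Qed.

Section straddle_mean.
Context (R : realType) (V : completeNormedModType R[i]).

Lemma straddle_mean (G g : R -> V) v (a b K : R) : straddle G g -> 0 <= a -> a <= b ->
  (forall c, a <= c -> c <= b -> rnorm (g c - v) <= K) ->
  rnorm (G b - G a - (b - a)%:C%C *: v) <= (b - a) * K.
Proof.
move=> sG a0 ab gK.
have sv : straddle (fun t : R => t%:C%C *: v) (fun=> v).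
  move=> c c0 e e0; exists 1 => // s t s0 sc ct _.
  by rewrite -scalerBl -rmorphB subrr rnorm0 mulr_ge0 ?(ltW e0)// subr_ge0 (le_trans sc).
have := straddle_bound (straddleB sG sv) a0 ab gK.
by rewrite subrACA -scalerBl -rmorphB.
Qed.

Lemma cvg_rnorm_half (x : V) (K : R) : 0 <= K ->
  (forall n : nat, rnorm x <= K / 2 ^+ n) -> x = 0.
Proof.
move=> K0 h; apply: rnorm_lt_all => e e0.
have [N NP] := geometric_small K0 e0; exact: le_trans (h N) NP.
Qed.

End straddle_mean.

(** If [S t x - T t x] is [t P x + o(t)] for every [x], the two difference quotients converge for
    the same vectors. This serves for bounded perturbations on [X], for their lift to [Lp], and for
    multiplication by [e^(-iat)]. *)
Lemma generator_perturb (R : realType) (V : normedModType R[i]) (T S : R -> V -> V)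
    (P : V -> V) :
  (forall x e, 0 < e -> exists2 d : R, 0 < d & forall t, 0 < t -> t < d ->
     rnorm (S t x - T t x - t%:C%C *: P x) <= e * t) ->
  generator S = op_add (generator T) P.
Proof.
move=> Srate; apply/seteqP; split => -[x y].
  move=> /generatorP gS; exists (y - P x) => /=; last by rewrite subrK.
  apply/generatorP => e e0; have e20 : 0 < e / 2 by rewrite divr_gt0.
  have [d d0 dP] := gS _ e20; have [d' d'0 d'P] := Srate x _ e20.
  exists (Num.min d d'); first by rewrite lt_min d0.
  move=> t t0; rewrite lt_min => /andP[td td'].
  rewrite (_ : _ - _ = (S t x - x - t%:C%C *: y) - (S t x - T t x - t%:C%C *: P x)).
    apply: le_trans (ler_rnormB _ _) _; rewrite [e]splitr mulrDl lerD ?dP ?d'P//.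
  rewrite [RHS]subrACA -scalerBr; congr (_ - _).
  by rewrite subrACA subrr sub0r opprB.
move=> [z /= /generatorP gT ->]; apply/generatorP => e e0.
have e20 : 0 < e / 2 by rewrite divr_gt0.
have [d d0 dP] := gT _ e20; have [d' d'0 d'P] := Srate x _ e20.
exists (Num.min d d'); first by rewrite lt_min d0.
move=> t t0; rewrite lt_min => /andP[td td'].
rewrite (_ : _ - _ = (T t x - x - t%:C%C *: z) + (S t x - T t x - t%:C%C *: P x)).
  apply: le_trans (ler_rnormD _ _) _; rewrite [e]splitr mulrDl lerD ?dP ?d'P//.
rewrite [RHS]addrACA -opprD -scalerDr; congr (_ - _).
by rewrite [RHS]addrC subrKA.
Qed.

Section bounded_perturbation.
Context (R : realType) (V : completeNormedModType R[i]) (T : R -> V -> V).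
Hypothesis sT : C0_semigroup T.
Variable P : V -> V.
Hypothesis bP : bounded_operator P.

(** The integrand of Duhamel's formula. The maximum keeps the time of [T] nonnegative for [s > t],
    so that the kernel is jointly continuous on the whole quadrant. *)
Let kernel (u : R -> V) (t s : R) : V := T (Num.max 0 (t - s)) (P (u s)).

Let conv (u : R -> V) (t : R) : V := integ (kernel u t) t.

Let maxB_ge0 (t s : R) : 0 <= Num.max 0 (t - s).
Proof. by rewrite le_max lexx. Qed.

Let kernelE u (t s : R) : s <= t -> kernel u t s = T (t - s) (P (u s)).
Proof. by move=> st; rewrite /kernel (max_idPr _)// subr_ge0. Qed.

Let jcont_kernel u : cont0 u -> jcont (kernel u).
Proof.
move=> cu t s t0 s0 e e0.
have [d d0 dP] := semigroup_continuous sT (P (u s)) (maxB_ge0 t s) e0.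
have [M M0 PM] := bounded_operator_rnorm bP.
have M1 : 0 < M + 1 by rewrite ltr_wpDl.
have [d' d'0 d'P] := cu _ s0 _ (divr_gt0 d0 M1).
exists (Num.min (d / 2) d'); first by rewrite lt_min divr_gt0.
move=> t' s' t'0 s'0; rewrite !lt_min => /andP[td _] /andP[sd sd'].
apply: dP => //.
  have hm (x y : R) : `|Num.max 0 x - Num.max 0 y| <= `|x - y|.
    rewrite !maxEle; case: (leP 0 x); case: (leP 0 y) => h1 h2.
    - by [].
    - by rewrite subr0 !ger0_norm//; lra.
    - by rewrite sub0r normrN ger0_norm// ler0_norm; lra.
    - by rewrite subrr normr0.
  apply: le_lt_trans (hm _ _) _.
  rewrite (_ : _ - _ = (t' - t) - (s' - s)); last by ring.
  by apply: le_lt_trans (ler_normB _ _) _; rewrite [ltRHS]splitr ltrD.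
rewrite -(linB bP.1); apply: le_lt_trans (PM _) _.
have := d'P _ s'0 sd'; rewrite ltr_pdivlMr// mulrC; apply: le_lt_trans.
by rewrite ler_wpM2r ?rnorm_ge0// lerDl.
Qed.

Let cont0_conv u : cont0 u -> cont0 (conv u).
Proof. by move=> /jcont_kernel/jcont_integ. Qed.

Let cont0_kernel u t : cont0 u -> 0 <= t -> cont0 (kernel u t).
Proof. by move=> cu; apply: jcont_cont0; exact: jcont_kernel. Qed.

Let conv0 u : conv u 0 = 0. Proof. exact: integ0. Qed.

Let cont0D (u v : R -> V) : cont0 u -> cont0 v -> cont0 (fun t => u t + v t).
Proof.
move=> cu cv c c0 e e0; have e20 : 0 < e / 2 by rewrite divr_gt0.
have [d d0 dP] := cu _ c0 _ e20; have [d' d'0 d'P] := cv _ c0 _ e20.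
exists (Num.min d d'); first by rewrite lt_min d0.
move=> t t0; rewrite lt_min => /andP[td td'].
rewrite opprD addrACA; apply: le_lt_trans (ler_rnormD _ _) _.
by rewrite [e]splitr ltrD ?dP ?d'P.
Qed.

Let cont0Z a (u : R -> V) : cont0 u -> cont0 (fun t => a *: u t).
Proof.
move=> cu c c0 e e0; pose K := rnorm (a : R[i]^o) + 1.
have K0 : 0 < K by rewrite ltr_wpDl// rnorm_ge0.
have [d d0 dP] := cu _ c0 _ (divr_gt0 e0 K0); exists d => // t t0 tc.
rewrite -scalerBr rnormZ; have := dP t t0 tc; rewrite ltr_pdivlMr// mulrC.
by apply: le_lt_trans; rewrite ler_wpM2r ?rnorm_ge0// lerDl.
Qed.

Let bounded_scale (a : R[i]) : bounded_operator (fun x : V => a *: x).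
Proof.
apply: (@rnorm_bounded_operator _ _ _ _ _ (rnorm (a : R[i]^o))).
  by move=> b x y; rewrite scalerDr !scalerA mulrC.
by move=> x; rewrite rnormZ.
Qed.

Let conv_linear a (u v : R -> V) t : cont0 u -> cont0 v -> 0 <= t ->
  conv (fun t => a *: u t + v t) t = a *: conv u t + conv v t.
Proof.
move=> cu cv t0; have [bT _ _ _] := sT.
have ku := straddle_integ (cont0_kernel cu t0).
have kv := straddle_integ (cont0_kernel cv t0).
have E : kernel (fun t => a *: u t + v t) t = fun s => a *: kernel u t s + kernel v t s.
  by apply/funext => s; rewrite /kernel bP.1 (bT _ (maxB_ge0 t s)).1.
rewrite /conv E -(integ_uniq (straddleD (straddle_op (bounded_scale a) ku) kv)) //=.
  by rewrite !integ0 scaler0 addr0 subr0.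
by apply: cont0D; [apply: cont0Z|]; exact: cont0_kernel.
Qed.

Section constants.
Variables (M w0 b : R).
Hypotheses (M1 : 1 <= M) (w00 : 0 <= w0) (b0 : 0 <= b).
Hypothesis TM : forall t x, 0 <= t -> rnorm (T t x) <= M * expR (w0 * t) * rnorm x.
Hypothesis Pb : forall x, rnorm (P x) <= b * rnorm x.

(** Chosen such that [2 (M b) / w1 <= 1 / 2], with the factor 2 of [straddle_bound_exp]; the [+ 1]
    keeps it positive when [b = 0]. *)
Let w1 := 4 * (M * b) + 1.
Let w := w0 + w1.

Let M0 : 0 < M. Proof. exact: lt_le_trans M1. Qed.
Let Mb0 : 0 <= M * b. Proof. by rewrite mulr_ge0// ltW. Qed.
Let w10 : 0 < w1. Proof. by rewrite ltr_wpDl// mulr_ge0. Qed.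

Definition exp_bounded (u : R -> V) (K : R) :=
  forall t, 0 <= t -> rnorm (u t) <= K * expR (w * t).

(** The Volterra operator halves the norm weighted by [e^(-wt)]: the part [w0] of the rate absorbs
    the growth of [T], and the part [w1] makes the integral small. *)
Let conv_bounded u K : cont0 u -> 0 <= K -> exp_bounded u K -> exp_bounded (conv u) (K / 2).
Proof.
move=> cu K0 uK t t0; have [bT _ _ _] := sT.
have sk := straddle_integ (cont0_kernel cu t0).
have L0 : 0 <= M * b * K * expR (w0 * t) by rewrite !mulr_ge0 ?expR_ge0 ?(ltW M0).
have := straddle_bound_exp sk (lexx 0) t0 L0 w10.
rewrite integ0 subr0 mulr0 expR0 => H.
apply: (@le_trans _ _ (2 * (M * b * K * expR (w0 * t)) / w1 * (expR (w1 * t) - 1))).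
  apply: H => c c0 ct; rewrite (kernelE _ ct).
  apply: le_trans (TM _ _) _; first by rewrite subr_ge0.
  apply: (@le_trans _ _ (M * expR (w0 * (t - c)) * (b * (K * expR (w * c))))).
    rewrite ler_wpM2l ?mulr_ge0 ?expR_ge0//; first exact: ltW.
    apply: le_trans (Pb _) _; rewrite ler_wpM2l//; exact: uK.
  have -> : w * c = w0 * c + w1 * c by exact: mulrDl.
  rewrite [expR (_ + w1 * c)]expRD.
  have -> : w0 * t = w0 * (t - c) + w0 * c by rewrite -mulrDr subrK.
  by rewrite expRD le_eqVlt; apply/orP; left; apply/eqP; ring.
have -> : w * t = w0 * t + w1 * t by exact: mulrDl.
rewrite expRD.
have E0 := expR_ge0 (w0 * t); have E1 := expR_ge0 (w1 * t).
apply: (@le_trans _ _ ((2 * (M * b) / w1) * (K * expR (w0 * t) * expR (w1 * t)))).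
  rewrite (_ : 2 * _ / w1 * _ = (2 * (M * b) / w1) *
    (K * expR (w0 * t) * (expR (w1 * t) - 1))); last by ring.
  rewrite ler_wpM2l//; first by rewrite divr_ge0 ?mulr_ge0// ltW.
  by rewrite ler_wpM2l ?mulr_ge0// gerBl.
rewrite (_ : K / 2 * _ = 2^-1 * (K * expR (w0 * t) * expR (w1 * t))); last by ring.
rewrite ler_wpM2r ?(mulr_ge0 (mulr_ge0 K0 E0) E1)//.
rewrite ler_pdivrMr// /w1; move: Mb0; lra.
Qed.

Let conv_fixpoint_unique u K : cont0 u -> 0 <= K -> exp_bounded u K ->
  (forall t, 0 <= t -> u t = conv u t) -> forall t, 0 <= t -> u t = 0.
Proof.
move=> cu K0 uK uE t t0.
have H n : exp_bounded u (K / 2 ^+ n).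
  elim: n => [|n ih]; first by rewrite expr0 divr1.
  have K2 : 0 <= K / 2 ^+ n by rewrite divr_ge0// exprn_ge0.
  move=> s s0; rewrite uE// exprSr invfM mulrA.
  exact: (conv_bounded cu K2 ih s0).
apply: (@cvg_rnorm_half _ _ _ (K * expR (w * t))); first by rewrite mulr_ge0 ?expR_ge0.
by move=> n; apply: le_trans (H n _ t0) _; rewrite mulrAC.
Qed.

(** Picard iterates of the Volterra equation [u t = T t x + conv u t], that is, partial sums of the
    Dyson-Phillips series. *)
Let picard := fix picard (n : nat) (x : V) (t : R) : V :=
  if n is m.+1 then T t x + conv (picard m x) t else T t x.

Let cont0_picard n x : cont0 (picard n x).
Proof.
elim: n => [|n ih] /=; first exact: cont0_orbit.
by apply: cont0D; [exact: cont0_orbit|exact: cont0_conv].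
Qed.

Let orbit_bounded x : exp_bounded (T^~ x) (M * rnorm x).
Proof.
move=> t t0; apply: le_trans (TM _ t0) _; rewrite mulrAC ler_wpM2l ?mulr_ge0 ?(ltW M0) ?rnorm_ge0//.
by rewrite ler_expR ler_wpM2r// lerDl ltW.
Qed.

Let convB u v t : cont0 u -> cont0 v -> 0 <= t ->
  conv (fun t => u t - v t) t = conv u t - conv v t.
Proof.
move=> cu cv t0; have := conv_linear (-1) cv cu t0; rewrite !scaleN1r addrC => <-.
by congr (conv _ t); apply/funext => s; rewrite scaleN1r addrC.
Qed.

Let cont0B (u v : R -> V) : cont0 u -> cont0 v -> cont0 (fun t => u t - v t).
Proof.
move=> cu cv; have := cont0D cu (cont0Z (-1) cv).
by under [fun t => _ + _]funext => t do rewrite scaleN1r.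
Qed.

Let picard_step n x : exp_bounded (fun t => picard n.+1 x t - picard n x t)
  (M * rnorm x / 2 ^+ n.+1).
Proof.
have K0 : 0 <= M * rnorm x by rewrite mulr_ge0 ?rnorm_ge0 ?(ltW M0).
elim: n => [|n ih].
  move=> t t0 /=; rewrite addrC addKr expr1.
  exact: (conv_bounded (cont0_orbit sT x) K0 (orbit_bounded x)).
move=> t t0; rewrite /= opprD addrACA subrr add0r.
rewrite -[conv (fun _ => _ + _) t]/(conv (picard n.+1 x) t) -convB//.
rewrite exprSr invfM mulrA; apply: conv_bounded => //; last by rewrite divr_ge0// exprn_ge0.
by apply: cont0B; exact: cont0_picard.
Qed.

Let picard_dist m n x t : (n <= m)%N -> 0 <= t ->
  rnorm (picard m x t - picard n x t) <= M * rnorm x * (2 ^- n - 2 ^- m) * expR (w * t).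
Proof.
move=> nm t0; elim: m nm => [|m ih]; first by rewrite leqn0 => /eqP ->; rewrite !subrr rnorm0 mulr0 mul0r.
rewrite leq_eqVlt => /orP[/eqP ->|]; first by rewrite !subrr rnorm0 mulr0 mul0r.
rewrite ltnS => /ih {}ih; apply: le_trans (ler_rnorm_tri (picard m x t) _ _) _.
apply: le_trans (lerD (picard_step m x t0) ih) _.
rewrite le_eqVlt; apply/orP; left; apply/eqP.
by rewrite exprSr; field; rewrite !expf_neq0//.
Qed.

Definition perturbed (t : R) (x : V) : V := lim (picard n x t @[n --> \oo]).

Let perturbed_near n x t : 0 <= t ->
  rnorm (perturbed t x - picard n x t) <= M * rnorm x / 2 ^+ n * expR (w * t).
Proof.
move=> t0.
have K0 : 0 <= M * rnorm x * expR (w * t) by rewrite !mulr_ge0 ?rnorm_ge0 ?expR_ge0 ?(ltW M0).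
have bnd p q : (q <= p)%N -> rnorm (picard p x t - picard q x t) <=
    M * rnorm x * expR (w * t) / 2 ^+ q.
  move=> qp; apply: le_trans (picard_dist x qp t0) _.
  rewrite [leLHS]mulrAC ler_wpM2l// gerBl invr_ge0 exprn_ge0//.
suff [l lP] : exists l : V, picard n x t @[n --> \oo] --> l.
  have -> : perturbed t x = l by exact: cvg_lim lP.
  apply: (cvgn_rnorm_le (N := n) lP) => m nm; apply: le_trans (bnd _ _ nm) _.
  by rewrite mulrAC.
apply: rnorm_cauchy_cvg => e e0.
have [N NP] := geometric_small K0 e0.
exists N => p q.
wlog pq : p q / (q <= p)%N.
  move=> W hp hq; have [/W->//|/ltnW/W h] := leqP q p; by rewrite rnormB h.
by move=> Np Nq; apply: le_trans (bnd _ _ pq) _; apply: le_trans NP;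
  rewrite ler_wpM2l// lef_pV2 ?posrE ?exprn_gt0// ler_eXn2l ?ltr1n.
Qed.

Let cont0_perturbed x : cont0 (perturbed^~ x).
Proof.
move=> c c0 e e0; pose L := M * rnorm x * expR (w * (c + 1)).
have L0 : 0 <= L by rewrite !mulr_ge0 ?rnorm_ge0 ?expR_ge0 ?(ltW M0).
have e40 : 0 < e / 4 by rewrite divr_gt0.
have [N NP] := geometric_small L0 e40.
have near t : 0 <= t -> t <= c + 1 -> rnorm (perturbed t x - picard N x t) <= e / 4.
  move=> t0 tc; apply: le_trans (perturbed_near _ _ t0) _; apply: le_trans NP.
  rewrite mulrAC ler_wpM2r ?invr_ge0 ?exprn_ge0// ler_wpM2l ?mulr_ge0 ?rnorm_ge0 ?(ltW M0)//.
  by rewrite ler_expR ler_wpM2l// addr_ge0// ltW.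
have [d d0 dP] := cont0_picard N x c0 e40.
exists (Num.min 1 d); first by rewrite lt_min ltr01.
move=> t t0; rewrite lt_min => /andP[tc1 tcd].
have tc : t <= c + 1 by move: tc1; rewrite ltr_norml => /andP[_]; lra.
have cc : c <= c + 1 by rewrite lerDl.
have H1 := near t t0 tc; have H2 := near c c0 cc; have H3 := dP t t0 tcd.
apply: le_lt_trans (ler_rnorm_tri (picard N x t) _ _) _.
apply: (@le_lt_trans _ _ (e / 4 + (e / 4 + e / 4))); last by lra.
rewrite lerD//; apply: le_trans (ler_rnorm_tri (picard N x c) _ _) _.
by apply: lerD; [exact: ltW|rewrite rnormB].
Qed.

Let perturbed_bounded x : exp_bounded (perturbed^~ x) (2 * (M * rnorm x)).
Proof.
move=> t t0; rewrite -[perturbed t x](subrK (picard 0 x t)).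
apply: le_trans (ler_rnormD _ _) _; rewrite -mulrA mulr_natl mulr2n lerD//.
  by apply: le_trans (perturbed_near 0 x t0) _; rewrite expr0 divr1.
exact: orbit_bounded.
Qed.

Let perturbed_volterra x t : 0 <= t -> perturbed t x = T t x + conv (perturbed^~ x) t.
Proof.
move=> t0; apply/eqP; rewrite -subr_eq0; apply/eqP.
have K0 : 0 <= M * rnorm x by rewrite mulr_ge0 ?rnorm_ge0 ?(ltW M0).
apply: (@cvg_rnorm_half _ _ _ (M * rnorm x * expR (w * t))); first by rewrite mulr_ge0 ?expR_ge0.
move=> n; rewrite -mulrA [expR _ / _]mulrC mulrA.
apply: le_trans (ler_rnorm_tri (picard n.+1 x t) _ _) _.
have -> : picard n.+1 x t - (T t x + conv (perturbed^~ x) t) =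
    - conv (fun t => perturbed t x - picard n x t) t.
  by rewrite convB// opprB /= opprD addrACA subrr add0r.
rewrite rnormN [X in X / _]splitr 2!mulrDl lerD//.
  apply: le_trans (perturbed_near _ _ t0) _.
  by rewrite exprS invfM mulrA.
rewrite [_ / 2 / _]mulrAC; apply: (conv_bounded _ _ _ t0).
- exact: cont0B.
- by rewrite divr_ge0 ?exprn_ge0.
by move=> s; exact: perturbed_near.
Qed.

(** The difference of two solutions is a fixed point of [conv], and halving its bound repeatedly
    makes it zero. Linearity and the semigroup law of [perturbed] follow by checking that both sides
    solve the same equation. *)
Let perturbed_unique x u K : cont0 u -> 0 <= K -> exp_bounded u K ->
  (forall t, 0 <= t -> u t = T t x + conv u t) ->
  forall t, 0 <= t -> u t = perturbed t x.
Proof.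
move=> cu K0 uK uE t t0; apply/eqP; rewrite -subr_eq0; apply/eqP.
have cB : cont0 (fun t => u t - perturbed t x) by exact: cont0B.
apply: (conv_fixpoint_unique (u := fun t => u t - perturbed t x)
  (K := K + 2 * (M * rnorm x)) cB) => //.
- by rewrite addr_ge0 ?mulr_ge0 ?rnorm_ge0 ?(ltW M0).
- move=> s s0; apply: le_trans (ler_rnormB _ _) _; rewrite mulrDl.
  by rewrite lerD ?uK//; exact: perturbed_bounded.
by move=> s s0; rewrite convB// uE// perturbed_volterra// opprD addrACA subrr add0r.
Qed.

Let linear_perturbed t : 0 <= t -> linear (perturbed t).
Proof.
move=> t0 a x y; apply/esym; have [bT _ _ _] := sT.
apply: (@perturbed_unique _ (fun t => a *: perturbed t x + perturbed t y)
  (rnorm (a : R[i]^o) * (2 * (M * rnorm x)) + 2 * (M * rnorm y))) => //.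
- by apply: cont0D => //; apply: cont0Z.
- by rewrite addr_ge0 ?mulr_ge0 ?rnorm_ge0 ?(ltW M0).
- move=> s s0; apply: le_trans (ler_rnormD _ _) _; rewrite mulrDl rnormZ.
  rewrite lerD//; last exact: perturbed_bounded.
  by rewrite -mulrA ler_wpM2l ?rnorm_ge0//; exact: perturbed_bounded.
move=> s s0; rewrite conv_linear// perturbed_volterra// (perturbed_volterra y s0).
by rewrite (bT _ s0).1 scalerDr addrACA.
Qed.

Let perturbed0 : perturbed 0 = id.
Proof.
have [_ T0 _ _] := sT; apply/funext => x.
by rewrite perturbed_volterra// conv0 addr0 T0.
Qed.

Let cont0_shift (u : R -> V) a : 0 <= a -> cont0 u -> cont0 (fun t => u (t + a)).
Proof.
move=> a0 cu c c0 e e0; have [d d0 dP] := cu (c + a) (addr_ge0 c0 a0) _ e0.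
exists d => // t t0 tc; apply: dP; first by rewrite addr_ge0.
by rewrite (_ : t + a - (c + a) = t - c)//; ring.
Qed.

(** The integral over [[0, t + s]] is cut at [s]; on the first piece [T t] factors out of the
    kernel, the second is translated to [[0, t]]. *)
Let conv_shift u s t : cont0 u -> 0 <= s -> 0 <= t ->
  conv u (t + s) = T t (conv u s) + conv (fun r => u (r + s)) t.
Proof.
move=> cu s0 t0; have ts0 := addr_ge0 t0 s0; have [bT T0 TD _] := sT.
have ck := cont0_kernel cu ts0; have cus := cont0_shift s0 cu.
have sks := straddle_integ (cont0_kernel cu s0).
have -> : conv u (t + s) = integ (kernel u (t + s)) s +
    (integ (kernel u (t + s)) (t + s) - integ (kernel u (t + s)) s).
  by rewrite [RHS]addrC subrK.
rewrite -integ_shift//; last exact: cont0_shift.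
have cTk : cont0 (T t \o kernel u s).
  move=> c c0 e e0; have [K K0 KP] := bounded_operator_rnorm (bT _ t0).
  have K1 : 0 < K + 1 by rewrite ltr_wpDl.
  have [d d0 dP] := cont0_kernel cu s0 c0 (divr_gt0 e0 K1); exists d => // r r0 rc.
  rewrite /= -(linB (bT _ t0).1); apply: le_lt_trans (KP _) _.
  have := dP r r0 rc; rewrite ltr_pdivlMr// mulrC; apply: le_lt_trans.
  by rewrite ler_wpM2r ?rnorm_ge0// lerDl.
congr (_ + _).
  rewrite (@eq_integ _ _ _ (T t \o kernel u s))//.
    rewrite -(integ_uniq (straddle_op (bT _ t0) sks) cTk s0)/=.
    by rewrite integ0 (lin0 (bT _ t0).1) subr0.
  move=> r r0 rs; rewrite /= !kernelE//; last by rewrite (le_trans rs)// lerDr.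
  by rewrite -addrA TD// subr_ge0.
apply: eq_integ => //; [exact: cont0_shift|exact: cont0_kernel|].
by move=> r r0 rt; rewrite /kernel (_ : t + s - (r + s) = t - r)//; ring.
Qed.

Let perturbedD s t : 0 <= s -> 0 <= t -> perturbed (s + t) = perturbed s \o perturbed t.
Proof.
move=> s0 t0; apply/funext => x /=; have [bT T0 TD _] := sT.
apply: (@perturbed_unique _ (fun r => perturbed (r + t) x)
  (2 * (M * rnorm x) * expR (w * t))) => //.
- exact: (cont0_shift t0 (cont0_perturbed x)).
- by rewrite !mulr_ge0 ?rnorm_ge0 ?expR_ge0 ?(ltW M0).
- move=> r r0; rewrite -mulrA -expRD -mulrDr (addrC t).
  exact: (perturbed_bounded x (addr_ge0 r0 t0)).
move=> r r0; rewrite perturbed_volterra ?addr_ge0// conv_shift// TD//= addrA.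
by rewrite -(linD (bT _ r0).1) -perturbed_volterra.
Qed.

Let perturbed_rate x e : 0 < e -> exists2 d : R, 0 < d & forall t, 0 < t -> t < d ->
  rnorm (perturbed t x - T t x - t%:C%C *: P x) <= e * t.
Proof.
move=> e0; have [_ T0 _ _] := sT.
have [d d0 dP] := jcont_kernel (cont0_perturbed x) (lexx 0) (lexx 0) e0.
exists d => // t t0 td; rewrite perturbed_volterra ?(ltW t0)// [T t x + _]addrC addrK.
have := straddle_mean (straddle_integ (cont0_kernel (cont0_perturbed x) (ltW t0)))
  (lexx 0) (ltW t0) (v := P x) (K := e).
rewrite integ0 !subr0 => H; rewrite mulrC; apply: H => c c0 ct.
have := dP t c (ltW t0) c0; rewrite !subr0 !ger0_norm ?(ltW t0)// => /(_ td (le_lt_trans ct td)).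
rewrite {2}/kernel subrr (max_idPr _)// T0 perturbed0 /=.
exact: ltW.
Qed.

Let perturbed_lip : exists2 K, 0 <= K & forall t x, 0 <= t -> t <= 1 ->
  rnorm (perturbed t x - T t x) <= K * t * rnorm x.
Proof.
exists (M * expR w0 * (b * (2 * M * expR w))).
  by rewrite !mulr_ge0 ?expR_ge0// ltW.
move=> t x t0 t1; rewrite perturbed_volterra// [T t x + _]addrC addrK.
have := straddle_bound (straddle_integ (cont0_kernel (cont0_perturbed x) t0))
  (lexx 0) t0 (K := M * expR w0 * (b * (2 * M * expR w)) * rnorm x).
rewrite integ0 !subr0 => H; rewrite mulrAC mulrC; apply: H => c c0 ct.
rewrite kernelE//; have tc0 : 0 <= t - c by rewrite subr_ge0.
apply: le_trans (TM _ tc0) _; rewrite -mulrA -mulrA -mulrA ler_wpM2l ?(ltW M0)//.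
rewrite ler_pM ?expR_ge0 ?rnorm_ge0//.
  by rewrite ler_expR ler_piMr//; lra.
apply: le_trans (Pb _) _; rewrite -mulrA ler_wpM2l//.
apply: le_trans (perturbed_bounded x c0) _.
rewrite mulrA mulrAC ler_wpM2r ?rnorm_ge0// ler_wpM2l ?mulr_ge0 ?(ltW M0)//.
by rewrite ler_expR ler_piMr ?(addr_ge0 w00 (ltW w10))//; exact: le_trans ct t1.
Qed.

Lemma perturbation_constants : exists S : R -> V -> V,
  [/\ C0_semigroup S,
      forall x e, 0 < e -> exists2 d : R, 0 < d & forall t, 0 < t -> t < d ->
        rnorm (S t x - T t x - t%:C%C *: P x) <= e * t &
      exists2 K, 0 <= K & forall t x, 0 <= t -> t <= 1 ->
        rnorm (S t x - T t x) <= K * t * rnorm x].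
Proof.
exists perturbed; split=> //; split=> //.
- move=> t t0; apply: (rnorm_bounded_operator (linear_perturbed t0)
    (M := 2 * M * expR (w * t))) => x.
  by rewrite mulrAC -(mulrA 2); exact: perturbed_bounded.
move=> x; apply/cvg0right_rnormP => e e0.
have [d d0 dP] := cont0_perturbed x (lexx 0) e0; exists d => // t t0 td.
have := dP t (ltW t0); rewrite perturbed0 subr0 gtr0_norm// rnormB; exact.
Qed.

End constants.

(** The pointwise rate and the uniform Lipschitz bound at [0] are exported with the generator
    because [evolution_perturb] lifts them to [Lp]. *)
Lemma bounded_perturbation : exists S : R -> V -> V,
  [/\ C0_semigroup S, generator S = op_add (generator T) P,
      forall x e, 0 < e -> exists2 d : R, 0 < d & forall t, 0 < t -> t < d ->
        rnorm (S t x - T t x - t%:C%C *: P x) <= e * t &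
      exists2 K, 0 <= K & forall t x, 0 <= t -> t <= 1 ->
        rnorm (S t x - T t x) <= K * t * rnorm x].
Proof.
have [M [w0 [M1 w00 TM]]] := semigroup_growth sT.
have [b b0 Pb] := bounded_operator_rnorm bP.
have [S [sS Srate Slip]] := perturbation_constants M1 w00 b0 TM Pb.
by exists S; split => //; exact: generator_perturb.
Qed.

End bounded_perturbation.

(** * Norming functionals *)

Section hahn_banach.
Context (R : realType) (V : normedModType R[i]).
Implicit Types (p q : V -> R) (x y : V).

Definition sublinear p := [/\ p 0 = 0, forall x y, p (x + y) <= p x + p y &
  forall (a : R) x, 0 < a -> p (a%:C%C *: x) <= a * p x].

Lemma sublinearZ p (a : R) x : sublinear p -> 0 <= a -> p (a%:C%C *: x) = a * p x.
Proof.
move=> [p0 pD pZ]; rewrite le_eqVlt => /orP[/eqP<-|a0].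
  by rewrite scale0r p0 mul0r.
apply/eqP; rewrite eq_le pZ//= -ler_pdivlMl//.
by rewrite -{1}(@rscaleVK _ _ a^-1 x) ?invr_eq0 ?gt_eqF// invrK pZ// invr_gt0.
Qed.

Lemma sublinearN p x : sublinear p -> - p (- x) <= p x.
Proof. by move=> [p0 pD _]; rewrite lerNl -subr_ge0 opprK -p0 -(addNr x) pD. Qed.

(* Replaces [p] by the largest sublinear minorant that is additive in the direction [y];
   it bounds [p] from both sides: minimal sublinear functionals are thus linear. *)
Let dir_set p y x : set R := [set p (x + t%:C%C *: y) - t * p y | t in [set t : R | 0 <= t]].
Let dir p y x : R := inf (dir_set p y x).

Let dir_lb p y x : sublinear p -> lbound (dir_set p y x) (- p (- x)).
Proof.
move=> sp _ [t /= t0 <-]; have [_ pD _] := sp.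
rewrite -(sublinearZ y sp t0) lerBrDr addrC lerBlDr.
by have := pD (x + t%:C%C *: y) (- x); rewrite addrAC subrr add0r.
Qed.

Let dir_has_inf p y x : sublinear p -> has_inf (dir_set p y x).
Proof.
move=> sp; split; last by exists (- p (- x)); exact: dir_lb.
by exists (p (x + 0%:C%C *: y) - 0 * p y), 0 => /=.
Qed.

Let dir_le p y x (t : R) : sublinear p -> 0 <= t ->
  dir p y x <= p (x + t%:C%C *: y) - t * p y.
Proof.
move=> sp t0; apply: ge_inf; last by exists t.
by exists (- p (- x)); exact: dir_lb.
Qed.

Let dir_ge p y x (r : R) : sublinear p ->
  (forall t : R, 0 <= t -> r <= p (x + t%:C%C *: y) - t * p y) -> r <= dir p y x.
Proof.
move=> sp h; apply: lb_le_inf; first by have [] := dir_has_inf y x sp.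
by move=> _ [t t0 <-]; exact: h.
Qed.

Let dir_le_self p y x : sublinear p -> dir p y x <= p x.
Proof.
by move=> sp; have := dir_le y x sp (lexx 0); rewrite scale0r addr0 mul0r subr0.
Qed.

Let sublinear_dir p y : sublinear p -> sublinear (dir p y).
Proof.
move=> sp; have [p0 pD pZ] := sp; split.
- apply/eqP; rewrite eq_le; apply/andP; split.
    by rewrite -[leRHS]p0; exact: dir_le_self.
  by apply: dir_ge => // t t0; rewrite add0r (sublinearZ _ sp)// subrr.
- move=> x1 x2; rewrite -lerBlDr; apply: dir_ge => // t t0.
  rewrite lerBlDr [leRHS]addrC -lerBlDr; apply: dir_ge => // s s0.
  rewrite lerBlDr [leRHS]addrC; apply: le_trans (dir_le y _ sp (addr_ge0 t0 s0)) _.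
  rewrite rmorphD/= scalerDl addrACA mulrDl opprD [leRHS]addrACA lerD2r.
  exact: pD.
move=> a x a0; rewrite -ler_pdivrMl//; apply: dir_ge => // t t0.
rewrite ler_pdivrMl//; apply: le_trans (dir_le y _ sp (mulr_ge0 (ltW a0) t0)) _.
rewrite -rscalerA -scalerDr mulrBr mulrA lerD2r; exact: pZ.
Qed.

(** Zorn's lemma is applied to sublinear minorants defined on the whole space, so that no partially
    defined functional occurs. Starting below [dir p0 y0] instead of [p0] forces the value [p0 y0]
    at [y0]. *)
Lemma hahn_banach_real p0 y0 : sublinear p0 -> exists f : V -> R,
  [/\ forall x y, f (x + y) = f x + f y, forall (a : R) x, f (a%:C%C *: x) = a * f x,
      forall x, f x <= p0 x & f y0 = p0 y0].
Proof.
move=> sp0; pose p1 := dir p0 y0; have sp1 : sublinear p1 by exact: sublinear_dir.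
pose PS (p : V -> R) := sublinear p /\ forall x, p x <= p1 x.
pose S := {p : V -> R | PS p}.
(* The order is reversed: a maximal element is a minimal sublinear functional. *)
pose ge_rel (s t : S) := `[< forall x, sval t x <= sval s x >].
have sS (s : S) : sublinear (sval s) by have [] := svalP s.
have lS (s : S) x : sval s x <= p1 x by have [_] := svalP s; exact.
have [|||C totC|q qmin] := @Zorn S ge_rel.
- by move=> s; apply/asboolP.
- move=> r s t /asboolP rs /asboolP st; apply/asboolP => x.
  exact: le_trans (st x) (rs x).
- move=> [s Ps] [t Pt] /asboolP /= st /asboolP /= ts; apply: eq_exist; apply/funext => x.
  by apply/eqP; rewrite eq_le st ts.
- have [[s0 Cs0]|C0] := pselect (C !=set0); last first.
    have P1 : PS p1 by [].
    by exists (exist PS p1 P1) => s Cs; exfalso; apply: C0; exists s.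
  (* The pointwise infimum of a chain is finite, since every member is at least [- p1 (- x)] at [x];
     totality of the chain gives its subadditivity. *)
  pose Cx x := [set sval s x | s in C].
  have lbC x : lbound (Cx x) (- p1 (- x)).
    move=> _ [s Cs <-]; apply: le_trans (sublinearN x (sS s)).
    by rewrite lerN2.
  have leC s x : C s -> inf (Cx x) <= sval s x.
    by move=> Cs; apply: ge_inf; [exists (- p1 (- x)) | exists s].
  have geC x r : (forall s, C s -> r <= sval s x) -> r <= inf (Cx x).
    by move=> h; apply: lb_le_inf; [exists (sval s0 x), s0|move=> _ [s Cs <-]; exact: h].
  have sI : sublinear (fun x => inf (Cx x)) /\ forall x, inf (Cx x) <= p1 x.
    split; last by move=> x; apply: le_trans (leC _ x Cs0) _.
    split.
    - apply/eqP; rewrite eq_le; apply/andP; split.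
        by apply: le_trans (leC _ 0 Cs0) _; have [-> _ _] := sS s0.
      by apply: (geC) => s Cs; have [-> _ _] := sS s.
    - move=> x y; rewrite -lerBlDr; apply: (geC) => s Cs.
      rewrite lerBlDr [leRHS]addrC -lerBlDr; apply: (geC) => t Ct; rewrite lerBlDr.
      have [st|ts] := totC s t Cs Ct.
        apply: le_trans (leC _ _ Ct) _; have [_ tD _] := sS t.
        apply: le_trans (tD x y) _; rewrite [leRHS]addrC lerD2r.
        by move/asboolP : st; exact.
      apply: le_trans (leC _ _ Cs) _; have [_ sD _] := sS s.
      apply: le_trans (sD x y) _; rewrite [leRHS]addrC lerD2l.
      by move/asboolP : ts; exact.
    move=> a x a0; rewrite -ler_pdivrMl//; apply: (geC) => s Cs.
    rewrite ler_pdivrMl//; apply: le_trans (leC _ _ Cs) _.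
    by have [_ _ sZ] := sS s; exact: sZ.
  exists (exist PS _ sI) => s Cs; apply/asboolP => x /=; exact: leC.
pose f := sval q; have sf : sublinear f := sS q.
have fmin y : dir f y = f.
  have P : PS (dir f y).
    split; first exact: sublinear_dir.
    by move=> x; apply: le_trans (dir_le_self y x sf) _; exact: lS.
  have := qmin (exist PS _ P); rewrite /ge_rel => /(_ _)/(congr1 sval) /= ->//.
  by apply/asboolP => x /=; exact: dir_le_self.
(* Minimality gives [f x = dir f y x], and the choice [t = 1] in the infimum is superadditivity. *)
have fD x y : f (x + y) = f x + f y.
  apply/eqP; rewrite eq_le; have [_ -> _ /=] := sf.
  rewrite -{1}(fmin y); have := dir_le y x sf ler01.
  by rewrite scale1r mul1r -lerBrDr.
have f0 : f 0 = 0 by have [] := sf.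
have fN x : f (- x) = - f x.
  by apply/eqP; rewrite -subr_eq0 opprK -fD addNr f0.
exists f; split => //.
- move=> a x; have [a0|a0] := leP 0 a; first exact: sublinearZ.
  have aN : 0 <= - a by rewrite oppr_ge0 ltW.
  by rewrite -{1}[a]opprK rmorphN scaleNr fN sublinearZ// mulNr opprK.
- by move=> x; apply: le_trans (lS q x) _; exact: dir_le_self.
(* With [t = 1] in the infimum, [dir p0 y0 (- y0) <= - p0 y0]; hence [- f y0 <= - p0 y0]. *)
apply/eqP; rewrite eq_le (le_trans (lS q y0) (dir_le_self _ _ sp0))/=.
rewrite -[f y0]opprK -fN lerNr; apply: le_trans (lS q _) _.
have := dir_le y0 (- y0) sp0 ler01; rewrite scale1r addNr mul1r.
by have [-> _ _] := sp0; rewrite sub0r.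
Qed.

(** The real functional [f] is complexified as [f x - i f (i x)]. For [z = phi x], the value of
    [phi] at the conjugate of [z] times [x] is [|z|^2], which [f] bounds by [|z| |x|]. At [y0] the
    real part already has the full norm, so the imaginary part vanishes. *)
Lemma norming_functional (y0 : V) : exists phi : V -> R[i]^o,
  [/\ linear phi, forall x, rnorm (phi x) <= rnorm x & phi y0 = (rnorm y0)%:C%C].
Proof.
have sn : sublinear (@rnorm R V).
  split; [exact: rnorm0|exact: ler_rnormD|].
  by move=> a x a0; rewrite rnormZp// ltW.
have [f [fD fZ fn fy]] := hahn_banach_real y0 sn.
have fN x : f (- x) = - f x.
  by have := fZ (-1) x; rewrite rmorphN scaleN1r mulN1r.
pose phi (x : V) : R[i] := (f x +i* - f ('i%C *: x))%C.
have iC (a : R[i]) x : a *: x = (complex.Re a)%:C%C *: x + (complex.Im a)%:C%C *: ('i%C *: x).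
  by rewrite scalerA -scalerDl {1}[a]complexE [in RHS]mulrC.
have phiZ a x : phi (a *: x) = a * phi x.
  rewrite /phi scalerA [_ * a]mulrC -scalerA (iC a x) (iC a ('i%C *: x)) !fD !fZ.
  have -> : 'i%C *: ('i%C *: x) = - x by rewrite scalerA -expr2 sqr_i scaleN1r.
  rewrite fN; case: a => a b /=; apply/eqP; rewrite eq_complex /=.
  by apply/andP; split; apply/eqP; ring.
have phiD x y : phi (x + y) = phi x + phi y.
  by rewrite /phi scalerDr !fD; apply/eqP; rewrite eq_complex /= opprD !eqxx.
have rn2 (z : R[i]^o) : rnorm z ^+ 2 = complex.Re z ^+ 2 + complex.Im z ^+ 2.
  rewrite /rnorm normc_def /= sqr_sqrtr//.
  by rewrite addr_ge0// sqr_ge0.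
have phin x : rnorm (phi x : R[i]^o) <= rnorm x.
  set z : R[i]^o := phi x; have [z0|z0] := eqVneq (rnorm z) 0.
    by rewrite z0 rnorm_ge0.
  have zp : 0 < rnorm z by rewrite lt_def z0 rnorm_ge0.
  rewrite -(ler_pM2l zp) -expr2.
  have nz : rnorm ((z^*)%C : R[i]^o) = rnorm z.
    apply/eqP; rewrite -(@eqrXn2 _ 2) ?rnorm_ge0// !rn2.
    by case: (z) => a b /=; rewrite sqrrN.
  rewrite -{2}nz -rnormZ rn2.
  apply: le_trans (fn _).
  have := phiZ (z^*)%C x; rewrite -/z => /(congr1 (@complex.Re R)) /= ->.
  by case: (z) => a b /=; rewrite mulNr opprK !expr2.
exists phi; split => //.
  by move=> a x y; rewrite phiD phiZ.
have := phin y0; rewrite -ler_sqr ?nnegrE ?rnorm_ge0// rn2 /= fy gerDl => h.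
have {h} : f ('i%C *: y0) ^+ 2 = 0.
  by apply/eqP; rewrite eq_le sqr_ge0 andbT -sqrrN.
move=> /eqP; rewrite sqrf_eq0 => /eqP h.
by apply/eqP; rewrite eq_complex /= fy h oppr0 !eqxx.
Qed.

End hahn_banach.

(** * Lp spaces of vector-valued functions *)

Section simple_approximation.
Context d (T : measurableType d) (R : realType) (V : normedModType R[i]).
Implicit Types f g : T -> V.

Lemma simple_function_if (b : T -> bool) (s r : T -> V) :
  measurable [set x | b x] -> simple_function s -> simple_function r ->
  simple_function (fun x => if b x then s x else r x).
Proof.
move=> mb ss sr; have sb : simple_function b.
  split; first by apply: (@sub_finite_set _ _ [set: bool]).
  case; first by rewrite (_ : _ @^-1` _ = [set x | b x])//; apply/seteqP; split.
  rewrite (_ : _ @^-1` _ = ~` [set x | b x]); first exact: measurableC.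
  by apply/seteqP; split=> x /=; case: (b x).
exact: (simple_function2 (fun (b : bool) vw => if b then vw.1 else vw.2) sb
  (simple_function2 pair ss sr)).
Qed.

Lemma simple_strongly_measurable (s : T -> V) : simple_function s -> strongly_measurable s.
Proof. by move=> ss; exists (fun=> s); split => // x; exact: cvg_cst. Qed.

Lemma strongly_measurableB f g :
  strongly_measurable f -> strongly_measurable g -> strongly_measurable (fun x => f x - g x).
Proof.
move=> mf /(strongly_measurableZ (-1)) mg; have := strongly_measurableD mf mg.
by congr strongly_measurable; apply/funext => x /=; rewrite scaleN1r.
Qed.

(** Values larger than [2 |f x|] are replaced by [0]. Where [f x] is nonzero this stops happening
    from some index on, and where it is zero the new values are zero, so convergence survives and a
    dominating function is gained. *)
Lemma simple_approximation f : strongly_measurable f -> exists s : nat -> T -> V,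
  [/\ forall n, simple_function (s n), forall x, s n x @[n --> \oo] --> f x &
      forall n x, rnorm (s n x) <= 2 * rnorm (f x)].
Proof.
move=> mf; have [s [ss sf]] := mf.
exists (fun n x => if rnorm (s n x) <= 2 * rnorm (f x) then s n x else 0).
split=> [n|x|n x].
- apply: simple_function_if => //; last exact: simple_function_cst.
  rewrite (_ : [set x | _] = setT `&` (fun x => 2 * rnorm (f x) - rnorm (s n x)) @^-1` `[0, +oo[).
    apply: measurable_funB => //.
      by apply: measurable_funM => //; exact: measurable_rnorm.
    by apply: measurable_rnorm; exact: simple_strongly_measurable.
  rewrite setTI; apply/seteqP; split=> x /=; rewrite in_itv/= andbT subr_ge0//.
- have [fx0|fx0] := eqVneq (rnorm (f x)) 0.
    rewrite (rnorm_eq0 fx0) rnorm0 mulr0.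
    rewrite [X in X @ \oo --> _](_ : _ = cst 0); first exact: cvg_cst.
    apply/funext => n; case: ifPn => // h; apply: rnorm_eq0.
    by apply/eqP; rewrite eq_le h rnorm_ge0.
  have fp : 0 < rnorm (f x) by rewrite lt_def fx0 rnorm_ge0.
  apply/cvgn_rnormP => e e0.
  have /cvgn_rnormP h := sf x.
  have [N NP] := h _ e0; have [M MP] := h _ fp.
  exists (maxn N M) => n; rewrite geq_max => /andP[Nn Mn].
  rewrite ifT; first exact: NP.
  rewrite -[s n x](subrK (f x)); apply: le_trans (ler_rnormD _ _) _.
  by rewrite mulr_natl mulr2n lerD2r ltW// rnormB MP.
case: ifPn => //; rewrite rnorm0 mulr_ge0// rnorm_ge0//.
Qed.

End simple_approximation.

Section Lp_facts.
Context d (T : measurableType d) (R : realType).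
Variables (mu : {measure set T -> \bar R}) (p : R) (p1 : 1 <= p).
Variable V : normedModType R[i].
Implicit Types f g : T -> V.

Let p0 : 0 < p. Proof. exact: lt_le_trans p1. Qed.

Local Notation N := (Lp_norm mu p).

Lemma Lp_norm_leP f (e : R) : 0 <= e ->
  (N f <= e%:E)%E = (\int[mu]_x ((rnorm (f x)) `^ p)%:E <= (e `^ p)%:E)%E.
Proof.
move=> e0.
have -> : (\int[mu]_x ((rnorm (f x)) `^ p)%:E)%E = (N f `^ p)%E.
  have pn0 : p != 0 by rewrite gt_eqF.
  rewrite [RHS](@poweR_Lnorm _ _ _ mu (EFin \o (fun x => rnorm (f x))) p pn0).
  apply: eq_integral => x _ /=.
  by rewrite ger0_norm ?rnorm_ge0.
rewrite -poweR_EFin; apply/idP/idP => h.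
  by apply: gt0_ler_poweR; rewrite ?(ltW p0)// in_itv/= leey andbT ?Lp_norm_ge0 ?lee_fin.
have := @gt0_ler_poweR R p^-1 _ (N f `^ p)%E (e%:E `^ p)%E _ _ h.
rewrite -!poweRrM mulfV ?gt_eqF// !poweRe1 ?Lp_norm_ge0 ?lee_fin//; apply.
- by rewrite invr_ge0 ltW.
- by rewrite in_itv/= leey andbT poweR_ge0.
- by rewrite in_itv/= leey andbT lee_fin powR_ge0.
Qed.

Lemma measurable_rnorm_powR f : strongly_measurable f ->
  measurable_fun setT (fun x => ((rnorm (f x)) `^ p)%:E).
Proof.
move=> mf; apply/measurable_EFinP; apply: (measurableT_comp (measurable_powR p)).
exact: measurable_rnorm.
Qed.

Lemma in_LpD f g : in_Lp mu p f -> in_Lp mu p g -> in_Lp mu p (f \+ g).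
Proof.
move=> [mf lf] [mg lg]; split; first exact: strongly_measurableD.
by apply: le_lt_trans (Lp_normD mu p1 mf mg) _; rewrite lte_add_pinfty.
Qed.

Lemma in_LpZ a f : in_Lp mu p f -> in_Lp mu p (fun x => a *: f x).
Proof.
move=> [mf lf]; split; first exact: strongly_measurableZ.
by rewrite Lp_normZ// lte_mul_pinfty// lee_fin rnorm_ge0.
Qed.

Lemma in_LpB f g : in_Lp mu p f -> in_Lp mu p g -> in_Lp mu p (fun x => f x - g x).
Proof.
move=> lf /(in_LpZ (-1)) lg; have := in_LpD lf lg.
by congr in_Lp; apply/funext => x /=; rewrite scaleN1r.
Qed.

Lemma in_Lp_val (F : Lp mu p1 V) : in_Lp mu p (Lp_val F).
Proof. exact: Lp_funP. Qed.

Lemma Lp_class_val (F : Lp mu p1 V) : Lp_class mu p1 (Lp_val F) = F.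
Proof.
rewrite /Lp_class -[RHS]reprK; apply/Lp_eqP; apply: aeW => x.
rewrite insubdK//; exact/(Lp_predP mu p1)/in_Lp_val.
Qed.

Lemma Lp_class_eqP f g : in_Lp mu p f -> in_Lp mu p g ->
  Lp_class mu p1 f = Lp_class mu p1 g <-> {ae mu, forall x, f x = g x}.
Proof.
move=> lf lg; rewrite /Lp_class Lp_eqP.
by split; apply: filterS => x; rewrite !insubdK//; exact/(Lp_predP mu p1).
Qed.

Lemma Lp_val_eqP (F G : Lp mu p1 V) :
  F = G <-> {ae mu, forall x, Lp_val F x = Lp_val G x}.
Proof.
rewrite -[F in F = _]Lp_class_val -[G in _ = G]Lp_class_val.
exact: (Lp_class_eqP (in_Lp_val F) (in_Lp_val G)).
Qed.

Lemma Lp_valD (F G : Lp mu p1 V) :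
  {ae mu, forall x, Lp_val (F + G) x = Lp_val F x + Lp_val G x}.
Proof.
have : (F + G = \pi_(Lp mu p1 V) (repr F + repr G))%qT by rewrite Lp_piD !reprK.
rewrite -{1}[F + G]reprK => /Lp_eqP; exact.
Qed.

Lemma Lp_valZ a (F : Lp mu p1 V) :
  {ae mu, forall x, Lp_val (a *: F) x = a *: Lp_val F x}.
Proof.
have : (a *: F = \pi_(Lp mu p1 V) (a *: repr F))%qT by [].
rewrite -{1}[a *: F]reprK => /Lp_eqP; exact.
Qed.

Lemma Lp_classD f g : in_Lp mu p f -> in_Lp mu p g ->
  Lp_class mu p1 (fun x => f x + g x) = Lp_class mu p1 f + Lp_class mu p1 g.
Proof.
move=> lf lg; apply/Lp_val_eqP; have lfg := in_LpD lf lg.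
apply: filterS2 (filterI (Lp_classK p1 lf) (Lp_classK p1 lg))
  (filterI (Lp_classK p1 lfg) (Lp_valD (Lp_class mu p1 f) (Lp_class mu p1 g))).
by move=> x [/= ff gg] [/= -> ->]; rewrite ff gg.
Qed.

Lemma Lp_classZ a f : in_Lp mu p f ->
  Lp_class mu p1 (fun x => a *: f x) = a *: Lp_class mu p1 f.
Proof.
move=> lf; apply/Lp_val_eqP; have laf := in_LpZ a lf.
move: (Lp_classK p1 lf) (Lp_classK p1 laf) (Lp_valZ a (Lp_class mu p1 f)).
by apply: filterS3 => x -> -> ->.
Qed.

Lemma Lp_classB f g : in_Lp mu p f -> in_Lp mu p g ->
  Lp_class mu p1 (fun x => f x - g x) = Lp_class mu p1 f - Lp_class mu p1 g.
Proof.
move=> lf lg; rewrite -scaleN1r -Lp_classZ// -Lp_classD//; last exact: in_LpZ.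
by congr Lp_class; apply/funext => x; rewrite scaleN1r.
Qed.

Lemma rnorm_Lp_class f : in_Lp mu p f -> (rnorm (Lp_class mu p1 f))%:E = N f.
Proof.
move=> lf; have -> : rnorm (Lp_class mu p1 f) = fine (N (insubd 0 f : Lp_fun mu p1 V)).
  by rewrite /rnorm -[`|_|]/(Lp_normr _) Lp_normr_pi.
rewrite fineK ?Lp_norm_fin//; congr (Lp_norm mu p _).
by rewrite insubdK//; exact/(Lp_predP mu p1).
Qed.

Lemma rnorm_LpE (F : Lp mu p1 V) : (rnorm F)%:E = N (Lp_val F).
Proof. by rewrite -{1}(Lp_class_val F) rnorm_Lp_class//; exact: in_Lp_val. Qed.

Lemma in_Lp_dominated f (g : T -> V) : strongly_measurable f -> in_Lp mu p g ->
  (forall x, rnorm (f x) <= rnorm (g x)) -> in_Lp mu p f.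
Proof.
move=> mf [mg lg] fg; split => //; apply: le_lt_trans lg.
by apply: Lp_norm_le => //; exact: measurable_rnorm.
Qed.

Lemma Lp_dominated_cvg (f_ : nat -> T -> V) f (g : T -> R) :
  (forall n, strongly_measurable (f_ n)) -> strongly_measurable f ->
  {ae mu, forall x, f_ n x @[n --> \oo] --> f x} ->
  (forall n x, rnorm (f x - f_ n x) <= g x) -> measurable_fun setT g ->
  (\int[mu]_x ((g x) `^ p)%:E < +oo)%E ->
  forall e : R, 0 < e -> exists N0, forall n, (N0 <= n)%N ->
    (N (fun x => f x - f_ n x)%R <= e%:E)%E.
Proof.
move=> mf_ mf f_f fg mg ig e e0.
have g0 x : 0 <= g x by apply: le_trans (fg 0%N x); exact: rnorm_ge0.
have mh n : measurable_fun setT (fun x => ((rnorm (f x - f_ n x)) `^ p)%:E).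
  by apply: measurable_rnorm_powR; exact: strongly_measurableB.
have mgp : measurable_fun setT (fun x => ((g x) `^ p)%:E).
  by apply/measurable_EFinP; exact: (measurableT_comp (measurable_powR p)).
have [||||_ _ +] := @dominated_convergence _ _ _ mu setT measurableT
  (fun n x => ((rnorm (f x - f_ n x)) `^ p)%:E) (cst 0%E) (fun x => ((g x) `^ p)%:E) mh.
- exact: measurable_cst.
- apply: filterS f_f => x /cvgn_rnormP h _; apply/fine_cvgP; split; first exact: nearW.
  apply/cvgrPdist_le => e' e'0.
  have [N0 N0P] := h _ (powR_gt0 p^-1 e'0); exists N0 => // n /= /N0P /ltW hn.
  rewrite sub0r normrN ger0_norm ?powR_ge0//.
  have := ge0_ler_powR (ltW p0) _ _ hn; rewrite -powRrM mulVf ?gt_eqF// powRr1 ?(ltW e'0)//.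
  by apply; rewrite nnegrE ?rnorm_ge0 ?powR_ge0.
- apply/integrableP; split => //; under eq_integral => x _ do
    rewrite gee0_abs ?lee_fin ?powR_ge0//.
  exact: ig.
- apply: aeW => x n _; rewrite gee0_abs ?lee_fin ?powR_ge0//.
  by rewrite ge0_ler_powR ?nnegrE ?rnorm_ge0 ?(ltW p0).
rewrite integral0 => h.
have ep0 : 0 < e `^ p by rewrite powR_gt0.
move/fine_cvgP : h => [[N1 _ h1] /cvgrPdist_le/(_ _ ep0)[N2 _ h2]].
exists (maxn N1 N2) => n; rewrite geq_max => /andP[/h1 n1 /h2 n2].
rewrite Lp_norm_leP ?(ltW e0)//.
rewrite -[leLHS]fineK// lee_fin; move: n2; rewrite sub0r normrN; apply: le_trans.
exact: ler_norm.
Qed.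

End Lp_facts.

Section complete_from_sequences.
Context (R : realType) (V : normedModType R[i]).

(** From a Cauchy filter one picks centres of balls of radius [1 / (n + 1)] belonging to it. Two
    such balls meet, so the centres form a Cauchy sequence, whose limit is the limit of the
    filter. *)
Lemma complete_from_sequences :
  (forall u : nat -> V, (forall e : R, 0 < e -> exists N, forall m n,
     (N <= m)%N -> (N <= n)%N -> rnorm (u m - u n) <= e) ->
     exists x : V, u n @[n --> \oo] --> x) ->
  forall F : set_system V, ProperFilter F -> cauchy F -> cvg F.
Proof.
move=> H F PF /cauchyP cF.
have e0 n : 0 < (n.+1%:R^-1 : R)%:C%C by rewrite ltcR invr_gt0 ltr0n.
have Fx n : exists x : V, F [set y | rnorm (x - y) < n.+1%:R^-1].
  have [x Fx] := cF _ (e0 n); exists x; apply: filterS Fx => y.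
  by rewrite -ball_normE /ball_/= -rnormC ltcR.
have [x xP] := choice Fx.
have dist m n : rnorm (x m - x n) <= m.+1%:R^-1 + n.+1%:R^-1.
  have [y [/= my ny]] := filter_ex (filterI (xP m) (xP n)).
  apply: le_trans (ler_rnorm_tri y _ _) _; rewrite (rnormB y).
  by rewrite lerD ?ltW.
have inv_le (m n : nat) : (m <= n)%N -> n.+1%:R^-1 <= m.+1%:R^-1 :> R.
  by move=> mn; rewrite lef_pV2 ?posrE ?ltr0n// ler_nat ltnS.
have [|l xl] := H x.
  move=> e e_gt0; have [N NP] := invf_natP (divr_gt0 e_gt0 (ltr0Sn R 1)).
  exists N => m n Nm Nn; apply: le_trans (dist _ _) _; rewrite [leRHS]splitr.
  by rewrite lerD// (le_trans (inv_le _ _ _) (ltW NP)).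
apply/cvg_ex; exists l; apply/cvg_rnormP => e e_gt0.
have e20 : 0 < e / 2 by rewrite divr_gt0.
have [N NP] := invf_natP e20.
move/cvgn_rnormP : xl => /(_ _ e20)[M MP].
pose k := maxn N M; apply: filterS (xP k) => y /= ky.
apply: le_lt_trans (ler_rnorm_tri (x k) _ _) _.
rewrite [ltRHS]splitr ltrD ?MP ?leq_maxr//; apply: lt_trans ky _.
by apply: le_lt_trans NP; rewrite inv_le// leq_maxl.
Qed.

End complete_from_sequences.

Section Lp_complete.
Context d (T : measurableType d) (R : realType).
Variables (mu : {measure set T -> \bar R}) (p : R) (p1 : 1 <= p).
Implicit Type V : normedModType R[i].

Let p0 : 0 < p. Proof. exact: lt_le_trans p1. Qed.

Local Notation N := (Lp_norm mu p).

Lemma Lp_powR_lty V (f : T -> V) : in_Lp mu p f ->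
  (\int[mu]_x ((rnorm (f x)) `^ p)%:E < +oo)%E.
Proof.
move=> [mf lf]; have fN : (N f \is a fin_num) by rewrite ge0_fin_numE// Lp_norm_ge0.
have := @Lp_norm_leP _ _ _ mu p p1 V f _ (fine_ge0 (Lp_norm_ge0 mu p f)).
rewrite fineK// lexx => /esym h; apply: le_lt_trans h _; exact: ltry.
Qed.

Lemma simple_dense V (f : T -> V) (e : R) : in_Lp mu p f -> 0 < e -> exists s : T -> V,
  [/\ simple_function s, in_Lp mu p s & (N (fun x => f x - s x)%R <= e%:E)%E].
Proof.
move=> lf e0; have [s [ss sf s2]] := simple_approximation lf.1.
have ls n : in_Lp mu p (s n).
  apply: (@in_Lp_dominated _ _ _ mu p p1 V (s n) (fun x => 2%:C%C *: f x)).
  - exact: simple_strongly_measurable.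
  - exact: in_LpZ.
  by move=> x; rewrite rnormZp// s2.
pose g x := rnorm (3%:C%C *: f x).
have [||||||n nP] := @Lp_dominated_cvg _ _ _ mu p p1 _ s f g _ _ _ _ _ _ e e0.
- by move=> n; exact: simple_strongly_measurable.
- exact: lf.1.
- exact: aeW.
- move=> n x; apply: le_trans (ler_rnormB _ _) _.
  by rewrite /g rnormZp//; have := s2 n x; lra.
- by apply: measurable_rnorm; apply: strongly_measurableZ; exact: lf.1.
- by apply: Lp_powR_lty; exact: in_LpZ.
by exists (s n); split => //; exact: nP.
Qed.

(** The Riesz-Fischer argument for simple functions: strong measurability asks for an everywhere
    limit of simple functions, and the limit function then has it by construction. *)
Lemma riesz_fischer_simple (V : completeNormedModType R[i]) (s : nat -> T -> V) :
  (forall k, simple_function (s k)) -> (forall k, in_Lp mu p (s k)) ->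
  (forall k, (N (fun x => s k.+1 x - s k x)%R <= (4 / 2 ^+ k)%:E)%E) ->
  exists2 f, in_Lp mu p f & forall e : R, 0 < e -> exists M, forall k, (M <= k)%N ->
    (N (fun x => f x - s k x)%R <= e%:E)%E.
Proof.
move=> ss ls h.
pose G n x := \sum_(0 <= k < n) rnorm (s k.+1 x - s k x).
have G0 n x : 0 <= G n x by rewrite sumr_ge0// => k _; exact: rnorm_ge0.
have mG n : measurable_fun setT (G n).
  apply: measurable_sum => k; apply: measurable_rnorm.
  by apply: strongly_measurableB; exact: simple_strongly_measurable.
have ndG x : nondecreasing_seq (G^~ x).
  by apply/nondecreasing_seqP => n; rewrite /G big_nat_recr//= lerDl rnorm_ge0.
(* [8] is the sum of the series [4 / 2 ^ k], and [8 / 2 ^ n] its tail. *)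
have NG n : ('N[mu]_p%:E[EFin \o G n] <= (8 - 8 / 2 ^+ n)%:E)%E.
  elim: n => [|n ih].
    rewrite (_ : EFin \o _ = cst 0%E); first by rewrite Lnorm0 ?gt_eqF//= lee_fin expr0 divr1 subrr.
    by apply/funext => x; rewrite /= /G big_nil.
  rewrite (_ : EFin \o G n.+1 = EFin \o (G n \+ (fun x => rnorm (s n.+1 x - s n x)))); last first.
    by apply/funext => x; rewrite /= /G big_nat_recr.
  apply: le_trans (minkowski_EFin _ (mG n) _ p1) _.
    apply: measurable_rnorm.
    by apply: strongly_measurableB; exact: simple_strongly_measurable.
  apply: le_trans (leeD ih (h n)) _; rewrite -EFinD lee_fin exprS.
  rewrite le_eqVlt; apply/orP; left; apply/eqP; field; exact: expf_neq0.
have mGp n : measurable_fun setT (fun x => ((G n x) `^ p)%:E).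
  by apply/measurable_EFinP; apply: (measurableT_comp (measurable_powR p)).
have Gp0 n x : (0 <= ((G n x) `^ p)%:E)%E by rewrite lee_fin powR_ge0.
have ndGp x : nondecreasing_seq (fun n => ((G n x) `^ p)%:E).
  by move=> m n mn; rewrite lee_fin ge0_ler_powR ?nnegrE ?(ltW p0)//; exact: ndG.
have IG n : (\int[mu]_x ((G n x) `^ p)%:E <= (8 `^ p)%:E)%E.
  have pn0 : p != 0 by rewrite gt_eqF.
  have -> : (\int[mu]_x ((G n x) `^ p)%:E = 'N[mu]_p%:E[EFin \o G n] `^ p)%E.
    rewrite [RHS](@poweR_Lnorm _ _ _ mu (EFin \o G n) p pn0).
    by apply: eq_integral => x _ /=; rewrite ger0_norm.
  rewrite -poweR_EFin; apply: gt0_ler_poweR; rewrite ?(ltW p0)//.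
  - by rewrite in_itv/= leey andbT Lnorm_ge0.
  - by rewrite in_itv/= leey andbT lee_fin.
  apply: le_trans (NG n) _; rewrite lee_fin gerBl divr_ge0// exprn_ge0//.
(* By monotone convergence [H] is integrable, hence finite outside a null set [B]; its [p]-th root
   bounds there the total variation of the sequence [s k x]. *)
pose H x := limn (fun n => ((G n x) `^ p)%:E).
have IH : (\int[mu]_x H x <= (8 `^ p)%:E)%E.
  have := @cvg_monotone_convergence _ _ _ mu setT measurableT _ mGp
    (fun n x _ => Gp0 n x) (fun x _ => ndGp x).
  move=> cvgI; apply: (cvge_le _ cvgI); exact: nearW.
have mH : measurable_fun setT H.
  apply: (emeasurable_fun_cvg (fun n x => ((G n x) `^ p)%:E)) => // x _.
  by apply: ereal_nondecreasing_is_cvgn; exact: ndGp.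
have GH n x : (((G n x) `^ p)%:E <= H x)%E.
  rewrite /H (cvg_lim _ (ereal_nondecreasing_cvgn (ndGp x)))//.
  by apply: ereal_sup_ubound; exists n.
have H0 x : (0 <= H x)%E by apply: le_trans (GH 0%N x).
have iH : mu.-integrable setT H.
  apply/integrableP; split => //; under eq_integral => x _ do rewrite gee0_abs//.
  by apply: le_lt_trans IH _; exact: ltry.
have [B [mB B0 HB]] := integrable_ae measurableT iH.
have Hfin x : ~ B x -> H x \is a fin_num.
  by move=> Bx; apply: contrapT => nf; apply: Bx; apply: HB => /(_ I).
pose g x := fine (H x) `^ p^-1.
have g0 x : 0 <= g x by exact: powR_ge0.
have Gg x n : ~ B x -> G n x <= g x.
  move=> /Hfin Hx; have := GH n x; rewrite -[H x]fineK// lee_fin => Gh.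
  have := @ge0_ler_powR R p^-1 _ _ _ _ _ Gh.
  rewrite -powRrM mulfV ?gt_eqF// powRr1//; apply.
  - by rewrite invr_ge0 ltW.
  - by rewrite nnegrE powR_ge0.
  - by rewrite nnegrE fine_ge0.
have sG m n x : (n <= m)%N -> rnorm (s m x - s n x) <= G m x - G n x.
  move=> nm; elim: m nm => [|m ih]; first by rewrite leqn0 => /eqP ->; rewrite !subrr rnorm0.
  rewrite leq_eqVlt => /orP[/eqP ->|]; first by rewrite !subrr rnorm0.
  rewrite ltnS => /ih {}ih; apply: le_trans (ler_rnorm_tri (s m x) _ _) _.
  rewrite {1}/G big_nat_recr//= -/(G m x) addrAC [leRHS]addrC; exact: lerD.
(* Setting the functions to zero on [B] makes them converge at every point and stay simple. *)
pose s' k x := if x \in B then 0 else s k x.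
have ss' k : simple_function (s' k).
  apply: simple_function_if => //; last exact: simple_function_cst.
  by rewrite (_ : [set x | _] = B)//; apply/seteqP; split=> x /=; rewrite inE.
have s'cvg x : exists l : V, s' k x @[k --> \oo] --> l.
  rewrite /s'; have [Bx|Bx] := boolP (x \in B); first by exists 0; exact: cvg_cst.
  move: Bx; rewrite notin_setE => Bx.
  have cG : cvgn (G^~ x).
    by apply: nondecreasing_is_cvgn => //; exists (g x) => _ [n _ <-]; exact: Gg.
  apply: rnorm_cauchy_cvg => e e0.
  have e20 : 0 < e / 2 by rewrite divr_gt0.
  move/cvgrPdist_le : cG => /(_ _ e20)[M _ MP]; exists M => m n.
  wlog mn : m n / (n <= m)%N.
    by move=> W hm hn; have [/W->//|/ltnW/W W'] := leqP n m; rewrite rnormB W'.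
  move=> Mm Mn; apply: le_trans (sG _ _ _ mn) _.
  have := MP _ Mm; have := MP _ Mn; rewrite /= !ler_norml => /andP[+ +] /andP[+ +].
  by move: (limn _) => l; lra.
have [f fP] := choice s'cvg.
have mf : strongly_measurable f by exists s'.
have mg : measurable_fun setT g.
  by apply: (measurableT_comp (measurable_powR p^-1)); apply: measurableT_comp mH; exact: fine_measurable.
have ig : (\int[mu]_x ((g x) `^ p)%:E < +oo)%E.
  apply: (@le_lt_trans _ _ (\int[mu]_x H x)%E); last by apply: le_lt_trans IH _; exact: ltry.
  apply: ge0_le_integral => //.
  - by move=> x _; rewrite lee_fin powR_ge0.
  - by apply/measurable_EFinP; apply: (measurableT_comp (measurable_powR p)).
  move=> x _; rewrite /g -powRrM mulVf ?gt_eqF// powRr1 ?fine_ge0//.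
  by have := H0 x; case: (H x) => [r| |]//=; rewrite leey.
have fs' k x : rnorm (f x - s' k x) <= g x.
  have [Bx|Bx] := boolP (x \in B).
    suff -> : f x = 0 by rewrite /s' Bx subrr rnorm0.
    have := fP x; rewrite /s' Bx => /cvg_lim <-//.
    by apply: lim_cst.
  have Bx' : ~ B x by move: Bx; rewrite notin_setE.
  apply: (cvgn_rnorm_le (N := k) (fP x)) => m km.
  rewrite /s' (negbTE Bx); apply: le_trans (sG _ _ _ km) _.
  by apply: le_trans (Gg x m Bx'); rewrite gerBl.
have s's k : {ae mu, forall x, s' k x = s k x}.
  exists B; split => // x /= nx; apply: contrapT => Bx; apply: nx.
  by rewrite /s' memNset.
have dom := @Lp_dominated_cvg _ _ _ mu p p1 _ s' f g (fun n => simple_strongly_measurable (ss' n))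
  mf (aeW _ fP) fs' mg ig.
have Nfs k : N (fun x => f x - s' k x) = N (fun x => f x - s k x).
  apply: ae_Lp_norm; [|apply: strongly_measurableB => //; exact: simple_strongly_measurable..|].
    by apply: strongly_measurableB => //; exact: simple_strongly_measurable.
  by apply: filterS (s's k) => x ->.
exists f.
  have [M MP] := dom 1 ltr01.
  rewrite (_ : f = (fun x => (f x - s M x) + s M x)); last by apply/funext => x; rewrite subrK.
  apply: in_LpD => //; split.
    by apply: strongly_measurableB => //; exact: simple_strongly_measurable.
  by rewrite -Nfs; apply: le_lt_trans (MP _ (leqnn _)) _; exact: ltry.
by move=> e e0; have [M MP] := dom e e0; exists M => k Mk; rewrite -Nfs MP.
Qed.

(** Along a subsequence with gaps [2 ^- k], each term is replaced by a simple function at distance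
    at most [2 ^- k]; consecutive simple functions then differ by at most [4 / 2 ^ k]. *)
Lemma Lp_cauchy_cvg (V : completeNormedModType R[i]) (u : nat -> Lp mu p1 V) :
  (forall e : R, 0 < e -> exists N, forall m n, (N <= m)%N -> (N <= n)%N ->
     rnorm (u m - u n) <= e) ->
  exists x : Lp mu p1 V, u n @[n --> \oo] --> x.
Proof.
move=> cu.
have e0 (k : nat) : 0 < (2 ^+ k)^-1 :> R by rewrite invr_gt0 exprn_gt0.
have [n nP] := choice (fun k => cu _ (e0 k)).
have [s sP] := choice (fun k => simple_dense (in_Lp_val (u (n k))) (e0 k)).
have ss k : simple_function (s k) by have [] := sP k.
have ls k : in_Lp mu p (s k) by have [] := sP k.
pose S k : Lp mu p1 V := Lp_class mu p1 (s k).
have uS k : rnorm (u (n k) - S k) <= (2 ^+ k)^-1.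
  rewrite -[u (n k)]Lp_class_val -Lp_classB//; last exact: in_Lp_val.
  rewrite -lee_fin rnorm_Lp_class; first by have [] := sP k.
  by apply: in_LpB => //; exact: in_Lp_val.
have [|f lf fP] := riesz_fischer_simple ss ls.
  move=> k; rewrite -rnorm_Lp_class; last exact: in_LpB.
  rewrite lee_fin Lp_classB// -/(S _) -/(S _).
  have h1 := uS k; have h2 := uS k.+1.
  have h3 := nP k (n k) (maxn (n k) (n k.+1)) (leqnn _) (leq_maxl _ _).
  have h4 := nP k.+1 (n k.+1) (maxn (n k) (n k.+1)) (leqnn _) (leq_maxr _ _).
  rewrite rnormB in h3; rewrite rnormB in h2.
  apply: le_trans (ler_rnorm_tri (u (n k.+1)) _ _) _.
  apply: le_trans (lerD h2 (ler_rnorm_tri (u (maxn (n k) (n k.+1))) _ _)) _.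
  apply: le_trans (lerD (lexx _) (lerD h4 (ler_rnorm_tri (u (n k)) _ _))) _.
  have h5 : (2 ^+ k.+1)^-1 <= (2 ^+ k)^-1 :> R.
    by rewrite lef_pV2 ?posrE ?exprn_gt0// ler_eXn2l ?ltr1n.
  by move: h1 h3 h5; lra.
exists (Lp_class mu p1 f); apply/cvgn_rnormP => e e_gt0.
have e40 : 0 < e / 4 by rewrite divr_gt0.
have [M MP] := fP _ e40; have [M' M'P] := geometric_small ler01 e40.
pose k := maxn M M'.
have k4 : (2 ^+ k)^-1 <= e / 4.
  apply: le_trans M'P; rewrite div1r lef_pV2 ?posrE ?exprn_gt0//.
  by rewrite ler_eXn2l ?ltr1n// leq_maxr.
exists (n k) => m nm.
have h1 : rnorm (Lp_class mu p1 f - S k) <= e / 4.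
  rewrite -Lp_classB// -lee_fin rnorm_Lp_class; last exact: in_LpB.
  by apply: MP; rewrite leq_maxl.
have h2 := uS k; rewrite rnormB in h2.
have h3 := nP k (n k) m (leqnn _) nm.
apply: le_lt_trans (ler_rnorm_tri (S k) _ _) _.
apply: le_lt_trans (lerD h1 (ler_rnorm_tri (u (n k)) _ _)) _.
by move: h2 h3 k4; lra.
Qed.

End Lp_complete.

(** The results on semigroups and their generators are stated for complete spaces, and the evolution
    semigroup acts on [Lp]. *)
HB.instance Definition _ d (T : measurableType d) (R : realType)
    (mu : {measure set T -> \bar R}) (p : R) (p1 : 1 <= p) (V : completeNormedModType R[i]) :=
  Uniform_isComplete.Build (Lp mu p1 V)
    (complete_from_sequences (@Lp_cauchy_cvg _ _ _ mu p p1 V)).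

(** * Rotations and trigonometric polynomials *)

Section mod2pi.
Context (R : realType).
Implicit Types x y s t b : R.

Lemma twopi_gt0 : 0 < 2 * pi :> R.
Proof. by rewrite mulr_gt0// pi_gt0. Qed.

Let p0 := twopi_gt0.

Lemma mod2pi_ge0 x : 0 <= mod2pi x.
Proof. by rewrite subr_ge0 mulrC -ler_pdivlMr// floor_le. Qed.

Lemma mod2pi_lt x : mod2pi x < 2 * pi.
Proof.
have h := floorD1_gt (x / (2 * pi)).
by move: h; rewrite ltr_pdivrMr// intrD mulrDl mul1r /mod2pi => h; lra.
Qed.

Lemma mod2pi_uniq x y (k : int) : 0 <= y -> y < 2 * pi -> x = y + 2 * pi * k%:~R ->
  mod2pi x = y.
Proof.
move=> y0 y2 ->; suff -> : mod2pi (y + 2 * pi * k%:~R) = y + 2 * pi * k%:~R - 2 * pi * k%:~R.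
  by rewrite addrK.
congr (_ - _ * _%:~R); apply: floor_def; move: (2 * pi) (p0) y2 => c c0 y2.
rewrite ler_pdivlMr// ltr_pdivrMr// intrD mulrDl mul1r [_ * c]mulrC.
by apply/andP; split; lra.
Qed.

Lemma mod2piE x : x = mod2pi x + 2 * pi * (Num.floor (x / (2 * pi)))%:~R.
Proof. by rewrite subrK. Qed.

Lemma mod2pi_id x : 0 <= x -> x < 2 * pi -> mod2pi x = x.
Proof. by move=> x0 x2; apply: (@mod2pi_uniq _ _ 0); rewrite ?mulr0 ?addr0. Qed.

Lemma mod2piBl x y : mod2pi (mod2pi x - y) = mod2pi (x - y).
Proof.
apply: (@mod2pi_uniq _ _ (Num.floor ((x - y) / (2 * pi)) - Num.floor (x / (2 * pi)))).
- exact: mod2pi_ge0.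
- exact: mod2pi_lt.
rewrite intrB mulrBr; have := mod2piE x; have := mod2piE (x - y).
move: (_ * _%:~R) (_ * _%:~R) (mod2pi _) (mod2pi _) => u v w z h1 h2; lra.
Qed.

Lemma mod2piBr x y : mod2pi (x - mod2pi y) = mod2pi (x - y).
Proof.
apply: (@mod2pi_uniq _ _ (Num.floor ((x - y) / (2 * pi)) + Num.floor (y / (2 * pi)))).
- exact: mod2pi_ge0.
- exact: mod2pi_lt.
rewrite intrD mulrDr; have := mod2piE y; have := mod2piE (x - y).
move: (_ * _%:~R) (_ * _%:~R) (mod2pi _) (mod2pi _) => u v w z h1 h2; lra.
Qed.

Lemma mod2pi_rot s a : 0 <= s -> s < 2 * pi -> 0 <= a -> a < 2 * pi ->
  mod2pi (s - a) = if a <= s then s - a else s - a + 2 * pi.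
Proof.
move=> s0 s2 a0 a2; have [as_|sa] := leP a s.
  by rewrite mod2pi_id ?subr_ge0//; lra.
by apply: (@mod2pi_uniq _ _ (-1)); rewrite ?mulrN1; lra.
Qed.

Lemma measurable_mod2pi : measurable_fun setT (@mod2pi R).
Proof.
apply: measurable_funB => //; apply: measurable_funM => //.
apply: nondecreasing_measurable => // x y xy.
by rewrite ler_int; apply: le_floor; rewrite ler_pM2r// invr_gt0.
Qed.

End mod2pi.

Section leb2pi_facts.
Context (R : realType).
Local Notation mu := (leb2pi R).
Local Notation T := (measurableTypeR R).

Lemma leb2piE (A : set T) : leb2pi R A = lebesgue_measure (A `&` `[0, 2 * pi]).
Proof. by []. Qed.

(** The two endpoints form a null set, so the conventions of [mod2pi] at [0] and [2 pi] do not
    matter. *)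
Lemma leb2pi_eq (A B : set T) : measurable A -> measurable B ->
  (forall s, 0 < s -> s < 2 * pi -> A s <-> B s) -> leb2pi R A = leb2pi R B.
Proof.
have p0 := @twopi_gt0 R.
have H (C : set T) : measurable C -> leb2pi R C = lebesgue_measure (C `&` `]0, 2 * pi[).
  move=> mC; rewrite leb2piE.
  rewrite (_ : C `&` `[0, 2 * pi] = (C `&` `]0, 2 * pi[) `|` (C `&` [set 0; 2 * pi])).
    have m2 : measurable ([set 0; 2 * pi] : set T).
      by apply: measurableU; exact: measurable_set1.
    have mC2 : measurable (C `&` [set 0; 2 * pi]) by exact: measurableI.
    have mCo : measurable (C `&` `]0, 2 * pi[) by exact: measurableI.
    apply: measureU0 => //.
    have z2 : lebesgue_measure ([set 0; 2 * pi] : set T) = 0%E.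
      transitivity (lebesgue_measure ([set 0%R] : set R)); last exact: lebesgue_measure_set1.
      apply: measureU0; [exact: measurable_set1|exact: measurable_set1|].
      exact: lebesgue_measure_set1.
    exact: (subset_measure0 mC2 m2 (@subIsetr _ _ _) z2).
  rewrite -setIUr; congr (_ `&` _); apply/seteqP; split=> x /=; rewrite !in_itv/=.
    move=> /andP[]; rewrite le_eqVlt => /orP[/eqP<-|x0]; first by right; left.
    by rewrite le_eqVlt => /orP[/eqP->|x2]; [right; right|left; rewrite x0].
  by move=> [/andP[/ltW-> /ltW->]//|[->|->]]; rewrite ?lexx ltW.
move=> mA mB AB; rewrite !H//; congr lebesgue_measure; apply/seteqP.
by split=> s /= [As]; rewrite in_itv/= => /andP[s0 s2]; rewrite s0 s2; split => //; apply/(AB s s0 s2).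
Qed.

Lemma leb2pi_itv (a b : R) : 0 <= a -> a <= b -> b <= 2 * pi ->
  leb2pi R `[a, b[%classic = (b - a)%:E.
Proof.
move=> a0 ab b2; rewrite leb2piE (_ : _ `&` _ = `[a, b[%classic); last first.
  apply/setIidl => x /=; rewrite !in_itv/= => /andP[ax xb].
  by rewrite (le_trans a0 ax) (le_trans (ltW xb) b2).
rewrite lebesgue_measure_itv/= lte_fin; move: ab; rewrite le_eqVlt => /orP[/eqP->|->].
  by rewrite ltxx subrr.
by rewrite -EFinB.
Qed.

Lemma leb2pi_setT : leb2pi R setT = (2 * pi)%:E.
Proof.
rewrite leb2piE setTI lebesgue_measure_itv/= lte_fin twopi_gt0.
by rewrite -EFinB subr0.
Qed.

Lemma ae_leb2pi (P : R -> Prop) : (forall s, 0 < s -> s < 2 * pi -> P s) ->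
  {ae mu, forall s, P s}.
Proof.
move=> h; exists (~` `]0, 2 * pi[%classic); split.
- exact: measurableC.
- transitivity (leb2pi R (set0 : set T)); last exact: measure0.
  apply: leb2pi_eq => //; first exact: measurableC.
  by move=> s s0 s2; split => //= /(_ _); apply; rewrite in_itv/= s0.
- by move=> s /= nP; rewrite in_itv/= => /andP[s0 s2]; apply: nP; exact: h.
Qed.

Definition rot2pi (t s : R) : R := mod2pi (s - t).

Lemma measurable_rot t : measurable_fun [set: T] (rot2pi t : T -> T).
Proof.
apply: (measurableT_comp (@measurable_mod2pi R)).
exact: measurable_funB.
Qed.

(** The preimage of a half-line under rotation is an arc of length [b] starting at [a]; the part
    that runs over [2 pi] reappears at [0]. *)
Lemma rot_ltb (t b s : R) : 0 < s -> s < 2 * pi -> 0 < b -> b <= 2 * pi ->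
  let a := mod2pi t in
  rot2pi t s < b <-> (`[0, Num.max 0 (a + b - 2 * pi)[%classic `|`
                  `[a, Num.min (2 * pi) (a + b)[%classic) s.
Proof.
move=> s0 s2 b0 b2 a; have a0 := mod2pi_ge0 t; have a2 := mod2pi_lt t.
rewrite /rot2pi -mod2piBr -/a mod2pi_rot// ?(ltW s0)//=; rewrite !in_itv/= lt_max lt_min.
rewrite -/a in a0 a2; rewrite (ltW s0) s2 /= [s < 0]ltNge (ltW s0)/=.
case: (leP a s) => as_ /=; split.
- by move=> h; right; lra.
- by move=> [h|]; lra.
- by move=> h; left; lra.
by move=> [h|//]; lra.
Qed.

(** The pushforward and the original measure are finite and agree on the half-lines, which are
    closed under intersection and generate the sigma-algebra. *)
Lemma leb2pi_rot (t : R) (A : set T) : measurable A ->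
  leb2pi R (rot2pi t @^-1` A) = leb2pi R A.
Proof.
move=> mA; have mrot := measurable_rot t.
pose m1 := pushforward mu (rot2pi t : T -> T).
have : m1 A = mu A; last by [].
apply: (@measure_unique _ R T (@RGenInftyO.G R) (fun k => `]-oo, k%:R[%classic) _ _ _ _
  [the measure _ _ of m1] mu) => //.
- exact: RGenInftyO.measurableE.
- move=> _ _ [x ->] [y ->]; exists (Num.min x y).
  apply/seteqP; split=> z /=; rewrite !in_itv/= lt_min; first by move=> [-> ->].
  by move=> /andP[].
- by move=> k; exists k%:R.
- apply/seteqP; split=> // x _; exists (Num.truncn x).+1 => //=.
  by rewrite in_itv/= truncnS_gt.
- move=> _ [b ->]; rewrite /m1/= /pushforward.
  have mI : measurable (rot2pi t @^-1` `]-oo, b[%classic).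
    by rewrite -[X in measurable X]setTI; exact: mrot.
  have [b0|b0] := leP b 0.
    transitivity (leb2pi R (set0 : set T)); [|apply/esym]; apply: leb2pi_eq => // s s0 s2 /=.
      by rewrite in_itv/= ltNge (le_trans b0 (mod2pi_ge0 _)).
    by rewrite in_itv/= ltNge (le_trans b0 (ltW s0)).
  have [b2|b2] := leP (2 * pi) b.
    transitivity (leb2pi R (setT : set T)); [|apply/esym]; apply: leb2pi_eq => // s s0 s2 /=.
      by rewrite in_itv/= (lt_le_trans (mod2pi_lt _) b2).
    by rewrite in_itv/= (lt_le_trans s2 b2).
  have a0 := mod2pi_ge0 t; have a2 := mod2pi_lt t.
  transitivity (leb2pi R (`[0, b[%classic : set T)).
    transitivity (leb2pi R (`[0, Num.max 0 (mod2pi t + b - 2 * pi)[%classic `|`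
                  `[mod2pi t, Num.min (2 * pi) (mod2pi t + b)[%classic : set T)).
      apply: leb2pi_eq => //; first exact: measurableU.
      by move=> s s0 s2; apply: rot_ltb => //; exact: ltW.
    rewrite measureU//.
      set a := mod2pi t in a0 a2 *; pose M := Num.max 0 (a + b - 2 * pi).
      pose m := Num.min (2 * pi) (a + b).
      have M0 : 0 <= M by rewrite le_max lexx.
      have M2 : M <= 2 * pi by rewrite ge_max; apply/andP; split; lra.
      have am : a <= m by rewrite le_min; apply/andP; split; lra.
      have m2 : m <= 2 * pi by rewrite ge_min lexx.
      have b0' := ltW b0; have b2' := ltW b2.
      rewrite (leb2pi_itv (lexx 0) b0' b2').
      transitivity ((M - 0)%:E + (m - a)%:E)%E.
        by congr (_ + _)%E; apply: leb2pi_itv.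
      rewrite -EFinD; congr (_%:E); rewrite /M /m maxEle minEle.
      by case: leP => h1; case: leP => h2; lra.
    apply/seteqP; split=> // x /= []; rewrite !in_itv/= lt_max => /andP[x0 h] /andP[ax _].
    by move: h => /orP[] h; exfalso; lra.
  apply: leb2pi_eq => // s s0 s2 /=; rewrite !in_itv/= (ltW s0)//.
move=> k; rewrite /m1/= /pushforward; apply: (@le_lt_trans _ _ (leb2pi R setT)).
  by apply: le_measure => //; rewrite inE//= -[X in measurable X]setTI; exact: mrot.
by rewrite leb2pi_setT ltry.
Qed.

End leb2pi_facts.

Section continuous_strongly_measurable.
Context (R : realType) (V : normedModType R[i]).

Definition contR (u : R -> V) := forall c e : R, 0 < e ->
  exists2 d : R, 0 < d & forall t, `|t - c| < d -> rnorm (u t - u c) < e.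

(** The cell of [s] in the grid of mesh [1 / (n + 1)] on [[-(n + 1), n + 1]], with points outside
    sent to the end cells. It is monotone in [s], which gives measurability. *)
Let grid_index (n : nat) (s : R) : nat :=
  minn (Num.truncn ((s + n.+1%:R) * n.+1%:R)) (2 * n.+1 * n.+1).

Let simple_grid_index n : simple_function (T := measurableTypeR R) (grid_index n).
Proof.
split.
  apply: (@sub_finite_set _ _ `I_(2 * n.+1 * n.+1).+1); last exact: finite_II.
  by move=> _ [s _ <-] /=; rewrite ltnS geq_minr.
move=> v; pose g (s : R) : R := (grid_index n s)%:R.
have mg : measurable_fun [set: R] g.
  apply: nondecreasing_measurable => // x y xy; rewrite ler_nat.
  rewrite leq_min geq_minr andbT; apply: leq_trans (geq_minl _ _) _.
  by apply: le_truncn; rewrite ler_pM2r ?ltr0n// lerD2r.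
have := mg measurableT [set v%:R] (measurable_set1 _); rewrite setTI.
congr (measurable _); apply/seteqP; split=> s /=; rewrite /g; last by move=> ->.
by move/eqP; rewrite eqr_nat => /eqP.
Qed.

Lemma contR_strongly_measurable (u : R -> V) : contR u ->
  strongly_measurable (T := measurableTypeR R) u.
Proof.
move=> cu.
pose node n (j : nat) : R := j%:R / n.+1%:R - n.+1%:R.
exists (fun n s => u (node n (grid_index n s))); split=> [n|s].
  exact: (simple_function2 (fun (j : nat) (_ : nat) => u (node n j)) (simple_grid_index n)
    (simple_grid_index n)).
apply/cvgn_rnormP => e e0; have [d d0 dP] := cu s _ e0.
have [N NP] := invf_natP d0.
exists (maxn N (Num.truncn `|s|)) => n; rewrite geq_max => /andP[Nn sn].
rewrite rnormB; apply: dP.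
have n0 : 0 < n.+1%:R :> R by rewrite ltr0n.
have : `|s| <= n.+1%:R.
  by apply: le_trans (ltW (truncnS_gt _)) _; rewrite ler_nat ltnS.
rewrite ler_norml => /andP[sn1 sn2].
have s0 : 0 <= (s + n.+1%:R) * n.+1%:R by rewrite mulr_ge0// -lerBlDr sub0r.
have h3 : n.+1%:R^-1 < d.
  by apply: le_lt_trans NP; rewrite lef_pV2 ?posrE ?ltr0n// ler_nat ltnS.
have /andP[h1 h2] := truncn_itv s0.
have -> : grid_index n s = Num.truncn ((s + n.+1%:R) * n.+1%:R).
  apply/minn_idPl; rewrite -(ler_nat R); apply: le_trans h1 _.
  by rewrite natrM ler_pM2r// mulnC natrM mulr_natr mulr2n lerD2r.
rewrite /node; move: (Num.truncn _) h1 h2 => j h1 h2.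
rewrite -ler_pdivrMr// in h1; rewrite -ltr_pdivlMr// -[j.+1%:R]natr1 mulrDl mul1r in h2.
set x := j%:R / _ in h1 h2 *; move: x (n.+1%:R^-1) h1 h2 h3 => x y h1 h2 h3.
by rewrite ltr_norml; apply/andP; split; lra.
Qed.

End continuous_strongly_measurable.

Section bounded_Lp.
Context (R : realType) (p : R) (p1 : 1 <= p) (V : normedModType R[i]).
Local Notation mu := (leb2pi R).

Let p0 : 0 < p. Proof. exact: lt_le_trans p1. Qed.

Lemma Lp_norm_bounded (f : measurableTypeR R -> V) (K : R) : strongly_measurable f ->
  0 <= K -> {ae mu, forall s, rnorm (f s) <= K} ->
  (Lp_norm mu p f <= (K * (2 * pi) `^ p^-1)%:E)%E.
Proof.
move=> mf K0 fK; rewrite Lp_norm_leP// ?mulr_ge0 ?powR_ge0//.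
rewrite powRM ?powR_ge0// -powRrM mulVf ?gt_eqF// powRr1 ?(ltW (twopi_gt0 R))//.
apply: (@le_trans _ _ (\int[mu]_x (cst (K `^ p)%:E x))%E); last first.
  by rewrite integral_cst// EFinM leb2pi_setT.
apply: ae_ge0_le_integral => //.
- by move=> x _; rewrite lee_fin powR_ge0.
- exact: measurable_rnorm_powR.
- by move=> x _; rewrite lee_fin powR_ge0.
apply: filterS fK => x fx _; rewrite lee_fin ge0_ler_powR ?nnegrE ?rnorm_ge0//.
exact: ltW.
Qed.

Lemma in_Lp_bounded (f : measurableTypeR R -> V) (K : R) : strongly_measurable f ->
  {ae mu, forall s, rnorm (f s) <= K} -> in_Lp mu p f.
Proof.
move=> mf fK; split => //; apply: le_lt_trans (ltry (`|K| * (2 * pi) `^ p^-1)).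
apply: Lp_norm_bounded => //; apply: filterS fK => x /le_trans; apply; exact: ler_norm.
Qed.

End bounded_Lp.

Section expi.
Context (R : realType).
Implicit Types a b : R.

Definition expi a : R[i] := (cos a +i* sin a)%C.

Lemma expiD a b : expi (a + b) = expi a * expi b.
Proof. by rewrite /expi cosD sinD; apply/eqP; rewrite eq_complex/= eqxx/= addrC; apply/eqP; ring. Qed.

Lemma expi0 : expi 0 = 1.
Proof. by rewrite /expi cos0 sin0. Qed.

Lemma expiNK a : expi (- a) * expi a = 1.
Proof. by rewrite -expiD addNr expi0. Qed.

Lemma rnorm_complex (z : R[i]) : rnorm (z : R[i]^o) = Num.sqrt (complex.Re z ^+ 2 + complex.Im z ^+ 2).
Proof. by rewrite /rnorm normc_def. Qed.

Lemma rnorm_expi a : rnorm (expi a : R[i]^o) = 1.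
Proof. by rewrite rnorm_complex /= cos2Dsin2 sqrtr1. Qed.

Lemma expi_2pi (k : int) : expi (2 * pi * k%:~R) = 1.
Proof.
have H (n : nat) : expi (2 * pi * n%:R) = 1.
  elim: n => [|n ih]; first by rewrite mulr0 expi0.
  rewrite -[n.+1%:R]natr1 mulrDr mulr1 expiD ih mul1r /expi.
  by rewrite (mulr_natl pi 2) cos2pi sin2pi.
case: k => n; first exact: H.
have := expiNK (2 * pi * n.+1%:R); rewrite H mulr1 => h.
by rewrite NegzE mulrNz mulrN.
Qed.

Lemma expi_mod2pi (k : int) a : expi (k%:~R * mod2pi a) = expi (k%:~R * a).
Proof.
have := mod2piE a; move: (mod2pi a) (Num.floor _) => m f ->.
by rewrite mulrDr expiD [_%:~R * (2 * pi * _)]mulrCA -intrM expi_2pi mulr1.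
Qed.

Lemma expi_cont a (e : R) : 0 < e -> exists2 d : R, 0 < d &
  forall b, `|b - a| < d -> rnorm (expi b - expi a : R[i]^o) < e.
Proof.
move=> e0; have e20 : 0 < e / 2 by rewrite divr_gt0.
have /cvgrPdist_lt/(_ _ e20)/nbhs_ballP[d /= d0 dP] := @continuous_cos R a.
have /cvgrPdist_lt/(_ _ e20)/nbhs_ballP[d' /= d'0 d'P] := @continuous_sin R a.
exists (Num.min d d'); first by rewrite lt_min d0.
move=> b; rewrite lt_min => /andP[bd bd'].
have hc : `|cos a - cos b| < e / 2 by apply: dP; rewrite /ball/= distrC.
have hs : `|sin a - sin b| < e / 2 by apply: d'P; rewrite /ball/= distrC.
rewrite rnorm_complex /= -[e]ger0_norm ?(ltW e0)// -sqrtr_sqr ltr_sqrt ?exprn_gt0//.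
rewrite distrC in hc; rewrite distrC in hs.
have hc2 : (cos b - cos a) ^+ 2 <= (e / 2) ^+ 2.
  by rewrite -real_normK ?num_real// lerXn2r ?nnegrE ?(ltW e20)// ltW.
have hs2 : (sin b - sin a) ^+ 2 <= (e / 2) ^+ 2.
  by rewrite -real_normK ?num_real// lerXn2r ?nnegrE ?(ltW e20)// ltW.
apply: le_lt_trans (lerD hc2 hs2) _; nra.
Qed.

End expi.

Section trig_step.
Context (R : realType).
Implicit Types b c s : R.

(* [arc c] is an affine function of [cos (s - c)] with values in [0, 1], and [arc c s < 1/2]
   exactly for [s] in ]0, 2c[; the powers below push it to 0 and 1 on both sides of 1/2. *)
Let arc c s : R := 2^-1 + (cos c - cos (s - c)) / 4.
Let sharp c n s : R := (1 - arc c s ^+ n) ^+ (2 ^ n).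

Let arc01 c s : 0 <= arc c s <= 1.
Proof.
rewrite /arc; have := cos_geN1 c; have := cos_le1 c.
by have := cos_geN1 (s - c); have := cos_le1 (s - c); move=> *; apply/andP; split; lra.
Qed.

Let sharp01 c n s : 0 <= sharp c n s <= 1.
Proof.
have /andP[a0 a1] := arc01 c s; have h0 : 0 <= arc c s ^+ n <= 1.
  by rewrite exprn_ge0// exprn_ile1.
move/andP : h0 => [h0 h1].
by rewrite /sharp exprn_ge0 ?subr_ge0// exprn_ile1 ?subr_ge0// gerBl.
Qed.

Let cos_lt c t : 0 < c -> c < t -> t < 2 * pi - c -> cos t < cos c.
Proof.
move=> c0 ct tc; have pi0 := pi_gt0 R.
have [tp|pt] := leP t pi.
  by rewrite ltr_cos// in_itv/=; apply/andP; split; lra.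
have -> : cos t = cos (2 * pi - t).
  by rewrite -[RHS]cosN opprB -[RHS]cosD2pi -(mulr_natl pi 2) subrK.
rewrite ltr_cos; [lra| |]; by rewrite in_itv/=; apply/andP; split; lra.
Qed.

Let arc_lt b s : 0 < s -> s < b -> b < 2 * pi -> arc (b / 2) s < 2^-1.
Proof.
move=> s0 sb b2; have pi0 := pi_gt0 R; rewrite /arc.
suff : cos (b / 2) < cos (s - b / 2) by lra.
rewrite -[X in _ < X]cos_norm; have h : `|s - b / 2| < b / 2.
  by rewrite ltr_norml; apply/andP; split; lra.
have i1 : `|s - b / 2| \in `[0, pi].
  by rewrite in_itv/= normr_ge0/=; apply: le_trans (ltW h) _; lra.
have i2 : b / 2 \in `[0, pi] by rewrite in_itv/=; apply/andP; split; lra.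
by rewrite ltr_cos.
Qed.

Let arc_gt b s : 0 < b -> b < s -> s < 2 * pi -> 2^-1 < arc (b / 2) s.
Proof.
move=> b0 bs s2; rewrite /arc.
suff : cos (s - b / 2) < cos (b / 2) by lra.
by apply: cos_lt; lra.
Qed.

Let bernoulli_lower (x : R) (n : nat) : 0 <= x -> x <= 1 -> 1 - n%:R * x <= (1 - x) ^+ n.
Proof.
move=> x0 x1; elim: n => [|n ih]; first by rewrite mul0r subr0 expr0.
rewrite exprS -natr1 mulrDl mul1r.
apply: (@le_trans _ _ ((1 - x) * (1 - n%:R * x))).
  have h : 0 <= n%:R * x * x by rewrite !mulr_ge0.
  by move: (n%:R * x) h => y h; lra.
by rewrite ler_wpM2l// subr_ge0.
Qed.

(** Below [1/2], Bernoulli's inequality gives [1 - sharp <= (2 arc) ^ n]; above [1/2], [sharp] is at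
    most [(2 arc) ^ (- n)]. Both are geometric sequences tending to zero. *)
Let sharp_cvg b s : 0 < s -> s < 2 * pi -> 0 < b -> b < 2 * pi -> s != b ->
  forall e : R, 0 < e -> exists N, forall n, (N <= n)%N ->
    `|(s < b)%R%:R - sharp (b / 2) n s| <= e.
Proof.
move=> s0 s2 b0 b2 sb e e0.
have geo (r : R) : 0 <= r -> r < 1 -> exists N, forall n, (N <= n)%N -> r ^+ n <= e.
  move=> r0 r1; have : r ^+ n @[n --> \oo] --> (0 : R) by apply: cvg_expr; rewrite ger0_norm.
  move=> /cvgrPdist_le/(_ _ e0)[N _ NP]; exists N => n /NP /=.
  by rewrite sub0r normrN ger0_norm// exprn_ge0.
have /andP[a0 a1] := arc01 (b / 2) s.
have x01 n : 0 <= arc (b / 2) s ^+ n <= 1 by rewrite exprn_ge0// exprn_ile1.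
have /(_ _)/andP sh01 := fun n => sharp01 (b / 2) n s.
have [lt_sb|] := boolP (s < b).
  have h := arc_lt s0 lt_sb b2; have [||N NP] := geo (2 * arc (b / 2) s); [lra|lra|].
  exists N => n /NP hn; have [_ s1] := sh01 n; rewrite ger0_norm ?subr_ge0//.
  have /andP[y0 y1] := x01 n.
  have := bernoulli_lower (2 ^ n) y0 y1; rewrite natrX -exprMn -/(sharp _ _ _) => h'.
  by move: hn h'; rewrite /= ; lra.
rewrite -leNgt le_eqVlt eq_sym (negbTE sb)/= => bs.
have h := arc_gt b0 bs s2; have p0 : 0 < 2 * arc (b / 2) s by lra.
have [||N NP] := geo (2 * arc (b / 2) s)^-1; [by rewrite invr_ge0 ltW|by rewrite invf_lt1//; lra|].
exists N => n /NP hn; have [s0' _] := sh01 n; rewrite sub0r normrN ger0_norm//.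
apply: le_trans hn; rewrite exprVn.
have /andP[y0 y1] := x01 n.
rewrite -[leRHS]div1r ler_pdivlMr ?exprn_gt0//.
rewrite exprMn; move: y0 y1; rewrite /sharp; move: (arc _ _ ^+ n) => y y0 y1.
(* (1 - y)^m m y <= (1 - y)^m (1 + y)^m <= 1 *)
have my : 2 ^+ n * y <= (1 + y) ^+ (2 ^ n).
  rewrite -natrX; move: (2 ^ n)%N => m; elim: m => [|m ih]; first by rewrite mul0r expr0 ler01.
  rewrite exprS -natr1 mulrDl mul1r [(1 + y) * _]mulrDl mul1r lerD//.
  by rewrite ler_peMr// exprn_ege1// lerDl.
apply: (@le_trans _ _ ((1 - y) ^+ (2 ^ n) * (1 + y) ^+ (2 ^ n))).
  by rewrite ler_wpM2l// exprn_ge0// subr_ge0.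
rewrite -exprMn exprn_ile1//; first by rewrite mulr_ge0// ?subr_ge0// addr_ge0.
by have := sqr_ge0 y; rewrite expr2; lra.
Qed.

Inductive trig : (R -> R[i]) -> Prop :=
| trig_expi (k : int) : trig (fun s => expi (k%:~R * s))
| trigD f g : trig f -> trig g -> trig (fun s => f s + g s)
| trigZ a f : trig f -> trig (fun s => a * f s).

Let trig_cst a : trig (fun=> a).
Proof.
have := trigZ a (trig_expi 0); congr trig; apply/funext => s.
by rewrite mul0r expi0 mulr1.
Qed.

Let trigM f g : trig f -> trig g -> trig (fun s => f s * g s).
Proof.
move=> tf tg; elim: tf => [k|f1 f2 _ h1 _ h2|a f1 _ h1].
- elim: tg => [m|g1 g2 _ h1 _ h2|a g1 _ h1].
  + have := trig_expi (k + m); congr trig; apply/funext => s.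
    by rewrite intrD mulrDl expiD.
  + by have := trigD h1 h2; congr trig; apply/funext => s; rewrite mulrDr.
  + by have := trigZ a h1; congr trig; apply/funext => s; rewrite mulrCA.
- by have := trigD h1 h2; congr trig; apply/funext => s; rewrite mulrDl.
by have := trigZ a h1; congr trig; apply/funext => s; rewrite mulrA.
Qed.

Let trigX f n : trig f -> trig (fun s => f s ^+ n).
Proof.
move=> tf; elim: n => [|n ih].
  by have := trig_cst 1; congr trig; apply/funext => s; rewrite expr0.
by have := trigM tf ih; congr trig; apply/funext => s; rewrite exprS.
Qed.

Let trig_cos c : trig (fun s => (cos (s - c))%:C%C).
Proof.
have := trigD (trigZ (2^-1 * expi (- c)) (trig_expi 1)) (trigZ (2^-1 * expi c) (trig_expi (-1))).
congr trig; apply/funext => s; rewrite mulrN1z mulNr mul1r -!mulrA -!expiD -mulrDr.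
rewrite -[c - s]opprB [- c + s]addrC /expi cosN sinN.
apply: (mulfI (x := 2)); first by rewrite pnatr_eq0.
rewrite mulrA mulfV ?pnatr_eq0// mul1r mulr_natl mulr2n.
by apply/eqP; rewrite eq_complex/= subrr addr0 !eqxx.
Qed.

Let trig_sharp c n : trig (fun s => (sharp c n s)%:C%C).
Proof.
have tA : trig (fun s => (arc c s)%:C%C).
  have := trigD (trig_cst (2^-1 + cos c / 4)%:C%C) (trigZ (- 4^-1)%:C%C (trig_cos c)).
  congr trig; apply/funext => s; rewrite -rmorphM -rmorphD/=; congr (_%:C%C).
  by rewrite /arc; field.
have := trigX (2 ^ n) (trigD (trig_cst 1) (trigZ (-1) (trigX n tA))).
congr trig; apply/funext => s; rewrite /sharp rmorphXn rmorphB rmorphXn rmorph1.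
by rewrite mulN1r.
Qed.

(** Uniform convergence to a jump is impossible; convergence at every point but one, together with
    values in [[0, 1]], suffices for dominated convergence in [Lp]. *)
Lemma trig_approximates_step b : 0 < b -> b < 2 * pi -> exists q : nat -> R -> R,
  [/\ forall n, trig (fun s => (q n s)%:C%C), forall n s, 0 <= q n s <= 1 &
   forall s, 0 < s -> s < 2 * pi -> s != b -> forall e : R, 0 < e -> exists N, forall n,
     (N <= n)%N -> `|(s < b)%R%:R - q n s| <= e].
Proof.
move=> b0 b2; exists (fun n s => sharp (b / 2) n s); split.
- by move=> n; exact: trig_sharp.
- by move=> n s; exact: sharp01.
by move=> s s0 s2 sb; exact: sharp_cvg.
Qed.

End trig_step.

Section trig_dense.
Context (R : realType) (p : R) (p1 : 1 <= p) (V : normedModType R[i]).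
Local Notation mu := (leb2pi R).
Local Notation T := (measurableTypeR R).
Implicit Types (f g : T -> V) (x : V).

Definition tfun (k : int) x : T -> V := fun s => expi (k%:~R * s) *: x.

Lemma contR_tfun (k : int) x : contR (tfun k x : R -> V).
Proof.
move=> c e e0; pose K := rnorm x + 1; have K0 : 0 < K by rewrite ltr_wpDl ?rnorm_ge0.
have [d d0 dP] := expi_cont (k%:~R * c) (divr_gt0 e0 K0).
pose L : R := `|k%:~R| + 1; have L0 : 0 < L by rewrite ltr_wpDl.
exists (d / L); first by rewrite divr_gt0.
move=> t tc; rewrite /tfun -scalerBl rnormZ.
have h : `|k%:~R * t - k%:~R * c| < d.
  rewrite -mulrBr normrM; apply: le_lt_trans (_ : L * `|t - c| < d).
    by rewrite ler_wpM2r// lerDl.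
  by rewrite mulrC -ltr_pdivlMr.
have := dP _ h; rewrite ltr_pdivlMr//; apply: le_lt_trans.
by rewrite ler_wpM2l ?rnorm_ge0// lerDl.
Qed.

Lemma rnorm_tfun (k : int) x s : rnorm (tfun k x s) = rnorm x.
Proof. by rewrite rnormZ rnorm_expi mul1r. Qed.

Lemma in_Lp_tfun (k : int) x : in_Lp mu p (tfun k x).
Proof.
apply: (@in_Lp_bounded _ _ p1 _ _ (rnorm x)).
  by apply: contR_strongly_measurable; exact: contR_tfun.
by apply: aeW => s; rewrite rnorm_tfun.
Qed.

Variable M : set (Lp mu p1 V).
Hypothesis Mlin : forall a F G, M F -> M G -> M (a *: F + G).
Hypothesis Mcl : forall F, (forall e : R, 0 < e -> exists2 G, M G & rnorm (F - G) <= e) -> M F.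
Hypothesis Mtrig : forall (k : int) x, M (Lp_class mu p1 (tfun k x)).

(** Membership in [M] is handled on representatives, where pointwise formulas and dominated
    convergence are available. *)
Let inM f := in_Lp mu p f /\ M (Lp_class mu p1 f).

Let inM_ae f g : in_Lp mu p g -> {ae mu, forall s, f s = g s} -> inM f -> inM g.
Proof.
move=> lg fg [lf Mf]; split => //.
by have /(Lp_class_eqP p1 lf lg) <- := fg.
Qed.

Let inM_lin a f g : inM f -> inM g -> inM (fun s => a *: f s + g s).
Proof.
move=> [lf Mf] [lg Mg]; have laf := in_LpZ p1 a lf; split; first exact: in_LpD.
by rewrite Lp_classD// Lp_classZ//; exact: Mlin.
Qed.

Let inM_cl f : in_Lp mu p f -> (forall e : R, 0 < e -> exists2 g, inM g &
  (Lp_norm mu p (fun s => f s - g s)%R <= e%:E)%E) -> inM f.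
Proof.
move=> lf h; split => //; apply: Mcl => e e0; have [g [lg Mg] fg] := h e e0.
exists (Lp_class mu p1 g) => //; rewrite -Lp_classB// -lee_fin rnorm_Lp_class//.
exact: in_LpB.
Qed.

Let inM0 : inM (fun=> 0).
Proof.
have := inM_lin 0 (conj (in_Lp_tfun 0 0) (Mtrig 0 0)) (conj (in_Lp_tfun 0 0) (Mtrig 0 0)).
by congr inM; apply/funext => s; rewrite scale0r add0r /tfun scaler0.
Qed.

Let inM_trig phi x : trig phi -> inM (fun s => phi s *: x).
Proof.
elim=> [k|f g _ hf _ hg|a f _ hf].
- by split; [exact: in_Lp_tfun|exact: Mtrig].
- by have := inM_lin 1 hf hg; congr inM; apply/funext => s; rewrite scale1r scalerDl.
have := inM_lin a hf inM0; congr inM; apply/funext => s.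
by rewrite addr0 scalerA.
Qed.

Let int_cst_lty (K : R) : (\int[mu]_s ((cst K s) `^ p)%:E < +oo)%E.
Proof.
change (\int[mu]_s (cst (K `^ p)%:E s) < +oo)%E.
by rewrite integral_cst// leb2pi_setT -EFinM ltry.
Qed.

Let ind (A : set T) x : T -> V := fun s => if s \in A then x else 0.

Let simple_ind A x : measurable A -> simple_function (ind A x).
Proof.
move=> mA; apply: simple_function_if; [|exact: simple_function_cst..].
by rewrite (_ : [set s | _] = A)//; apply/seteqP; split=> s /=; rewrite inE.
Qed.

Let in_Lp_ind A x : measurable A -> in_Lp mu p (ind A x).
Proof.
move=> mA; apply: (@in_Lp_bounded _ _ p1 _ _ (rnorm x)).
  exact/simple_strongly_measurable/simple_ind.
by apply: aeW => s; rewrite /ind; case: ifP => //; rewrite rnorm0 rnorm_ge0.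
Qed.

Let inM_dominated (f_ : nat -> T -> V) f (K : R) : (forall n, inM (f_ n)) ->
  strongly_measurable f ->
  {ae mu, forall s, f_ n s @[n --> \oo] --> f s} ->
  (forall n s, rnorm (f s - f_ n s) <= K) -> in_Lp mu p f -> inM f.
Proof.
move=> Mf_ mf f_f fK lf; apply: inM_cl => // e e0.
have [||N NP] := @Lp_dominated_cvg _ _ _ mu p p1 _ f_ f (cst K) _ mf f_f fK _ (int_cst_lty K) e e0.
- by move=> n; have [[]] := Mf_ n.
- exact: measurable_cst.
by exists (f_ N) => //; exact: NP.
Qed.

Let P (A : set T) := forall x, inM (ind A x).

Let P_half_line b : P `]-oo, b[%classic.
Proof.
move=> x; have mI : measurable (`]-oo, b[%classic : set T) by exact: measurable_itv.
have lI := in_Lp_ind x mI.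
have [b0|b0] := leP b 0.
  apply: inM_ae inM0 => //; apply: ae_leb2pi => s s0 s2.
  by rewrite /ind ifF//; apply/negbTE; rewrite notin_setE/= in_itv/= ltNge (le_trans b0 (ltW s0)).
have [b2|b2] := leP (2 * pi) b.
  apply: (inM_ae lI _ (inM_trig x (trig_expi R 0))); apply: ae_leb2pi => s s0 s2.
  rewrite mul0r expi0 scale1r /ind ifT//; apply/mem_set => /=.
  by rewrite in_itv/= (lt_le_trans s2 b2).
have [q [tq q01 qb]] := trig_approximates_step b0 b2.
apply: (@inM_dominated (fun n s => (q n s)%:C%C *: x) _ (2 * rnorm x)) => //.
- by move=> n; exact: inM_trig.
- exact: lI.1.
- have : {ae mu, forall s : T, (s : R) != b}.
    exists [set b]; split; [exact: measurable_set1| |].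
      have mb : measurable ([set b] : set T) by exact: measurable_set1.
      have mbI : measurable (([set b] : set T) `&` `[0, 2 * pi]) by exact: measurableI.
      exact: (subset_measure0 mbI mb (@subIsetl _ _ _) (lebesgue_measure_set1 b)).
    by move=> s /= /negP/negPn/eqP.
  move=> hb.
  have hin : {ae mu, forall s : T, 0 < (s : R) /\ (s : R) < 2 * pi} by apply: ae_leb2pi.
  apply: filterS2 hb hin => s sb [s0 s2]; apply/cvgn_rnormP => e e0.
  pose K := rnorm x + 1; have K0 : 0 < K by rewrite ltr_wpDl ?rnorm_ge0.
  have [N NP] := qb s s0 s2 sb _ (divr_gt0 e0 (mulr_gt0 (ltr0Sn R 1) K0)).
  exists N => n /NP h; rewrite /ind (_ : (s \in _) = (s < b)); last first.
    by apply/idP/idP; rewrite inE/= in_itv.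
  rewrite (_ : (if s < b then x else 0) = ((s < b)%R%:R)%:C%C *: x); last first.
    by rewrite rmorph_nat scaler_nat; case: (s < b).
  rewrite -scalerBl -rmorphB rnormZr.
  apply: (@le_lt_trans _ _ (e / (2 * K) * K)).
    by rewrite ler_pM ?rnorm_ge0//= lerDl.
  by rewrite invfM mulrA divfK ?gt_eqF// ltr_pdivrMr// ltr_pMr// ltr1n.
- move=> n s; apply: le_trans (ler_rnormB _ _) _; rewrite mulr_natl mulr2n lerD//.
    by rewrite /ind; case: ifP => //; rewrite rnorm0 rnorm_ge0.
  have /andP[h0 h1] := q01 n s.
  by rewrite rnormZp// ler_piMl ?rnorm_ge0.
Qed.

(** Dynkin's theorem, starting from half-lines. The complement is a constant function minus the
    indicator, and a disjoint union is the dominated limit of its finite parts. *)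
Let P_measurable A : measurable A -> P A.
Proof.
have mE : @measurable _ T = <<s @RGenInftyO.G R >> by exact: RGenInftyO.measurableE.
rewrite mE; move: A; apply: (@dynkin_induction _ T (@RGenInftyO.G R) P mE).
- move=> _ _ [x ->] [y ->]; exists (Num.min x y).
  apply/seteqP; split=> z /=; rewrite !in_itv/= lt_min; first by move=> [-> ->].
  by move=> /andP[].
- move=> x; have := inM_trig x (trig_expi R 0); congr inM; apply/funext => s.
  by rewrite mul0r expi0 scale1r /ind in_setT.
- by move=> _ [b ->]; exact: P_half_line.
- move=> S mS PS x; have := inM_lin (-1) (PS x) (inM_trig x (trig_expi R 0)).
  congr inM; apply/funext => s; rewrite mul0r expi0 scale1r /ind in_setC.
  by case: ifP => _ /=; [rewrite scaleN1r addNr|rewrite scaler0 add0r].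
move=> F mF tF PF x.
have mU : measurable (\bigcup_k F k) by exact: bigcup_measurable.
have lU := in_Lp_ind x mU.
pose f n : T -> V := fun s => \sum_(k < n) ind (F k) x s.
have indF n k s : s \in F k -> f n s = if (k < n)%N then x else 0.
  move=> sk; rewrite /f; case: ifP => kn.
    rewrite (bigD1 (Ordinal kn))//= {1}/ind sk big1 ?addr0// => j jk.
    rewrite /ind ifF//; apply/negbTE/negP => sj; move: jk => /eqP; apply; apply: val_inj => /=.
    by apply: (tF _ _ I I); exists s; split; exact: set_mem.
  rewrite big1// => j _; rewrite /ind ifF//; apply/negbTE/negP => sj.
  have jk : val j = k by apply: (tF _ _ I I); exists s; split; exact: set_mem.
  by have := ltn_ord j; rewrite -[nat_of_ord j]/(val j) jk kn.
have fnU n s : s \notin \bigcup_k F k -> f n s = 0.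
  move=> sU; rewrite /f big1// => j _; rewrite /ind ifF//; apply/negbTE/negP => sj.
  by move: sU => /negP; apply; apply/mem_set; exists j => //; exact: set_mem.
apply: (@inM_dominated f _ (rnorm x)) => //.
- elim=> [|n ih]; first by move: inM0; congr inM; apply/funext => s; rewrite /f big_ord0.
  have := inM_lin 1 ih (PF n x); congr inM; apply/funext => s.
  by rewrite scale1r /f big_ord_recr.
- exact: lU.1.
- apply: aeW => s; rewrite /ind; case: ifPn => sU.
    have [k _ sk] := set_mem sU.
    apply/cvgn_rnormP => e e0; exists k.+1 => n kn.
    by rewrite (indF n k)// ?kn ?subrr ?rnorm0//; exact/mem_set.
  apply/cvgn_rnormP => e e0; exists 0%N => n _.
  by rewrite fnU// subrr rnorm0.
move=> n s; rewrite /ind; case: ifPn => sU; last by rewrite fnU// subrr rnorm0 rnorm_ge0.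
have [k _ sk] := set_mem sU; rewrite (indF n k); last exact/mem_set.
by case: ifP; rewrite ?subrr ?rnorm0 ?subr0 ?rnorm_ge0.
Qed.

Let inM_simple s : simple_function s -> inM s.
Proof.
move=> [fs ms]; have /finite_seqP[r rE] := fs.
have : inM (fun t => \sum_(v <- undup r) ind (s @^-1` [set v]) v t).
  elim: (undup r) => [|v l ih].
    by move: inM0; congr inM; apply/funext => t; rewrite big_nil.
  have := inM_lin 1 (P_measurable (ms v) v) ih; congr inM; apply/funext => t.
  by rewrite scale1r big_cons.
congr inM; apply/funext => t; have st : s t \in undup r.
  by rewrite mem_undup; have := imageT s t; rewrite rE.
rewrite (bigD1_seq (s t))//= ?undup_uniq// {1}/ind ifT; last exact/mem_set.
rewrite big1 ?addr0// => v vs; rewrite /ind ifF//; apply/negbTE/negP => /set_mem /= h.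
by move: vs; rewrite h eqxx.
Qed.

(** Density in the form of an induction principle: a property of elements of [Lp] that is stable
    under linear combinations and norm limits need only be checked on the functions [e^(iks) x]. *)
Lemma trig_dense F : M F.
Proof.
rewrite -(Lp_class_val F); suff : inM (Lp_val F) by case.
have lF := in_Lp_val F; apply: inM_cl => // e e0.
have [s [ss ls Fs]] := simple_dense p1 lF e0; exists s => //.
exact: inM_simple.
Qed.

End trig_dense.

(** * Evolution semigroups *)

Section twist.
Context (R : realType) (p : R) (p1 : 1 <= p) (V W : normedModType R[i]).
Local Notation mu := (leb2pi R).
Local Notation T := (measurableTypeR R).

Let p0 : 0 < p. Proof. exact: lt_le_trans p1. Qed.

Lemma strongly_measurable_rot (X : normedModType R[i]) (f : T -> X) t :
  strongly_measurable f -> strongly_measurable (fun s => f (rot2pi t s)).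
Proof.
move=> [s [ss sf]]; exists (fun n x => s n (rot2pi t x)); split=> [n|x]; last exact: sf.
split; first by apply: (@sub_finite_set _ _ (range (s n))); [move=> _ [x _ <-]; exists (rot2pi t x)|exact: (ss n).1].
move=> v; have := measurable_rot t measurableT ((ss n).2 v).
by rewrite setTI.
Qed.

Lemma ge0_integral_rot (f : T -> \bar R) t : measurable_fun setT f -> (forall x, 0 <= f x)%E ->
  (\int[mu]_s f (rot2pi t s) = \int[mu]_s f s)%E.
Proof.
move=> mf f0; have mr := @measurable_rot R t.
transitivity (\int[pushforward mu (rot2pi t : T -> T)]_s f s)%E.
  by rewrite ge0_integral_pushforward.
apply: eq_measure_integral => A mA _.
exact: leb2pi_rot.
Qed.

Lemma Lp_norm_rot (X : normedModType R[i]) (f : T -> X) t : strongly_measurable f ->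
  Lp_norm mu p (fun s => f (rot2pi t s)) = Lp_norm mu p f.
Proof.
move=> mf; rewrite /Lp_norm unlock; congr (_ `^ _)%E.
apply: (ge0_integral_rot t (f := fun s => (`|(EFin \o (fun s => rnorm (f s))) s| `^ p)%E)).
  apply: (measurableT_comp (measurable_poweR p)); apply: measurableT_comp => //.
  by apply/measurable_EFinP; exact: measurable_rnorm.
by move=> x; exact: poweR_ge0.
Qed.

Lemma in_Lp_rot (X : normedModType R[i]) (f : T -> X) t : in_Lp mu p f ->
  in_Lp mu p (fun s => f (rot2pi t s)).
Proof.
by move=> [mf lf]; split; [exact: strongly_measurable_rot|rewrite Lp_norm_rot].
Qed.

Lemma ae_rot (P : T -> Prop) t : {ae mu, forall s : T, P s} -> {ae mu, forall s : T, P (rot2pi t s)}.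
Proof.
move=> [B [mB B0 PB]]; exists (rot2pi t @^-1` B); split.
- by rewrite -[X in measurable X]setTI; exact: measurable_rot.
- by rewrite [LHS](leb2pi_rot t mB).
by move=> s /= nP; exact: PB.
Qed.

Variable Q : V -> W.
Hypothesis bQ : bounded_operator Q.

(** With [Q := T t] this is the evolution semigroup, with [t := 0] the pointwise action of an
    operator; the same estimates serve for both. *)
Definition twist (t : R) (F : Lp mu p1 V) : Lp mu p1 W :=
  Lp_class mu p1 (fun s => Q (Lp_val F (rot2pi t s))).

Lemma in_Lp_twist (f : T -> V) t : in_Lp mu p f -> in_Lp mu p (fun s => Q (f (rot2pi t s))).
Proof. by move=> lf; apply: (in_Lp_comp bQ p1); exact: in_Lp_rot. Qed.

Lemma twist_class (f : T -> V) t : in_Lp mu p f ->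
  twist t (Lp_class mu p1 f) = Lp_class mu p1 (fun s => Q (f (rot2pi t s))).
Proof.
move=> lf; apply/Lp_class_eqP; [exact/in_Lp_twist/in_Lp_val|exact: in_Lp_twist|].
by apply: filterS (ae_rot t (Lp_classK p1 lf)) => s ->.
Qed.

Lemma linear_twist t : linear (twist t).
Proof.
move=> a F G; rewrite -[F]Lp_class_val -[G]Lp_class_val.
have lF := in_Lp_val F; have lG := in_Lp_val G; have laF := in_LpZ p1 a lF.
rewrite -Lp_classZ// -Lp_classD// !twist_class//; last exact: in_LpD.
rewrite -Lp_classZ; [|exact: in_Lp_twist].
rewrite -Lp_classD; [|by apply: in_LpZ => //; exact: in_Lp_twist|exact: in_Lp_twist].
by congr Lp_class; apply/funext => s; rewrite bQ.1.
Qed.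

Lemma rnorm_twist K t F : (forall x, rnorm (Q x) <= K * rnorm x) -> 0 <= K ->
  rnorm (twist t F) <= K * rnorm F.
Proof.
move=> QK K0; rewrite -lee_fin rnorm_Lp_class; last exact/in_Lp_twist/in_Lp_val.
have lr : in_Lp mu p (fun s => Lp_val F (rot2pi t s)) by apply: in_Lp_rot; exact: in_Lp_val.
apply: (@le_trans _ _ (Lp_norm mu p (fun s => K%:C%C *: Lp_val F (rot2pi t s)))).
  apply: Lp_norm_le => //; first by apply: (in_Lp_twist _ (in_Lp_val F)).1.
    by apply: measurable_rnorm; apply: strongly_measurableZ; exact: lr.1.
  by move=> s; rewrite rnormZp.
rewrite Lp_normZ//; last exact: lr.1.
rewrite Lp_norm_rot; last exact: (in_Lp_val F).1.
rewrite -rnorm_LpE -EFinM lee_fin ler_wpM2r ?rnorm_ge0//.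
by rewrite rnorm_complex /= expr0n addr0 sqrtr_sqr ger0_norm.
Qed.

Lemma bounded_twist t : bounded_operator (twist t).
Proof.
have [K K0 QK] := bounded_operator_rnorm bQ.
by apply: (rnorm_bounded_operator (linear_twist t) (M := K)) => F; exact: rnorm_twist.
Qed.

Lemma Lp_map_twist F : Lp_map Q F = twist 0 F.
Proof.
have lF := in_Lp_val F.
apply/Lp_class_eqP; [exact: (in_Lp_comp bQ p1)|exact: in_Lp_twist|].
by apply: ae_leb2pi => s s0 s2 /=; rewrite /rot2pi subr0 mod2pi_id// ltW.
Qed.

Lemma Lp_map_class (f : T -> V) : in_Lp mu p f ->
  Lp_map Q (Lp_class mu p1 f) = Lp_class mu p1 (Q \o f).
Proof.
move=> lf; rewrite Lp_map_twist twist_class//.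
apply/Lp_class_eqP; [exact: in_Lp_twist|exact: (in_Lp_comp bQ p1)|].
by apply: ae_leb2pi => s s0 s2 /=; rewrite /rot2pi subr0 mod2pi_id// ltW.
Qed.

End twist.

Section twist_semigroup.
Context (R : realType) (p : R) (p1 : 1 <= p).
Local Notation mu := (leb2pi R).

Lemma twist_twist (U V W : normedModType R[i]) (Q : V -> W) (Q' : U -> V) t t' (F : Lp mu p1 U) :
  bounded_operator Q -> bounded_operator Q' ->
  twist Q t (twist Q' t' F) = twist (Q \o Q') (t + t') F.
Proof.
move=> bQ bQ'; have lF := in_Lp_val F.
rewrite {2}/twist twist_class//; last exact: in_Lp_twist.
by congr Lp_class; apply/funext => s; rewrite /rot2pi mod2piBl -addrA -opprD.
Qed.

Lemma linear_Lp_class_tfun (V : normedModType R[i]) (k : int) :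
  linear (fun x : V => Lp_class mu p1 (tfun k x)).
Proof.
move=> a x y; have lx := in_Lp_tfun p1 k x; have ly := in_Lp_tfun p1 k y.
rewrite -Lp_classZ// -Lp_classD//; last exact: in_LpZ.
by congr Lp_class; apply/funext => s; rewrite /tfun scalerDr !scalerA mulrC.
Qed.

Lemma rnorm_Lp_class_tfun (V : normedModType R[i]) (k : int) (x : V) :
  rnorm (Lp_class mu p1 (tfun k x)) <= (2 * pi) `^ p^-1 * rnorm x.
Proof.
have lx := in_Lp_tfun p1 k x; rewrite -lee_fin rnorm_Lp_class// mulrC.
apply: Lp_norm_bounded; [exact: p1|exact: lx.1|exact: rnorm_ge0|].
by apply: aeW => s; rewrite rnorm_tfun.
Qed.

Lemma twist_tfun (V W : normedModType R[i]) (Q : V -> W) t (k : int) x :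
  bounded_operator Q -> twist Q t (Lp_class mu p1 (tfun k x)) =
  Lp_class mu p1 (tfun k (expi (- (k%:~R * t)) *: Q x)).
Proof.
move=> bQ; rewrite twist_class//; last exact: in_Lp_tfun.
congr Lp_class; apply/funext => s; rewrite /tfun (linZ bQ.1) /rot2pi expi_mod2pi.
by rewrite scalerA -expiD mulrBr.
Qed.

(** By the uniform bound [K] the claim is stable under limits in [F], so it is checked on
    [e^(iks) x], where rotation by [t] is multiplication by [e^(-ikt)]. It is applied with [Q := T]
    for strong continuity and with difference quotients of two semigroups for perturbation. *)
Lemma twist_cvg (V W : normedModType R[i]) (Q : R -> V -> W) (P : V -> W) (K : R) :
  0 <= K -> bounded_operator P -> (forall x, rnorm (P x) <= K * rnorm x) ->
  (forall t, 0 < t -> t <= 1 -> bounded_operator (Q t)) ->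
  (forall t x, 0 < t -> t <= 1 -> rnorm (Q t x) <= K * rnorm x) ->
  (forall x e, 0 < e -> exists2 d : R, 0 < d & forall t, 0 < t -> t < d ->
    rnorm (Q t x - P x) <= e) ->
  forall (F : Lp mu p1 V) e, 0 < e -> exists2 d : R, 0 < d & forall t, 0 < t -> t < d ->
    rnorm (twist (Q t) t F - Lp_map P F) <= e.
Proof.
move=> K0 bP PK bQ QK QP F.
have small1 d : 0 < d -> exists2 d' : R, 0 < d' & d' <= d /\ d' <= 1.
  by move=> d0; exists (Num.min d 1); rewrite ?lt_min ?d0 ?ltr01 ?ge_min ?lexx ?orbT.
pose M := [set F : Lp mu p1 V | forall e, 0 < e -> exists2 d : R, 0 < d &
  forall t, 0 < t -> t < d -> rnorm (twist (Q t) t F - Lp_map P F) <= e].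
have lP : linear (twist P 0 : Lp mu p1 V -> Lp mu p1 W) := linear_twist bP 0.
suff : M F by [].
apply: trig_dense.
- move=> a F1 F2 M1 M2 e e0.
  pose L := rnorm (a : R[i]^o) + 1; have L0 : 0 < L by rewrite ltr_wpDl// rnorm_ge0.
  have e2 : 0 < e / 2 by rewrite divr_gt0.
  have [d1 d10 d1P] := M1 _ (divr_gt0 e2 L0); have [d2 d20 d2P] := M2 _ e2.
  have [d d0 [dm d1']] := small1 (Num.min d1 d2) ltac:(by rewrite lt_min d10).
  exists d => // t t0 td; have tle1 : t <= 1 by rewrite (le_trans (ltW td)).
  move: dm; rewrite le_min => /andP[dd1 dd2].
  rewrite !(Lp_map_twist bP) lP (linear_twist (bQ t t0 tle1) t) -!(Lp_map_twist bP).
  rewrite opprD addrACA -scalerBr; apply: le_trans (ler_rnormD _ _) _; rewrite [leRHS]splitr lerD//.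
    rewrite rnormZ; have := d1P t t0 (lt_le_trans td dd1); rewrite ler_pdivlMr// mulrC.
    by apply: le_trans; rewrite ler_wpM2r ?rnorm_ge0// lerDl.
  exact: d2P t0 (lt_le_trans td dd2).
- move=> F1 H e e0; pose L := K + 1; have L0 : 0 < L by rewrite ltr_wpDl.
  have e30 : 0 < e / 3 by rewrite divr_gt0.
  have [G MG FG] := H _ (divr_gt0 e30 L0); have [d d0 dP] := MG _ e30.
  have [d' d'0 [dd' d1]] := small1 d d0; exists d' => // t t0 td.
  have tle1 : t <= 1 by rewrite (le_trans (ltW td)).
  have h1 : rnorm (twist (Q t) t F1 - twist (Q t) t G) <= e / 3.
    rewrite -(linB (linear_twist (bQ t t0 tle1) t)).
    apply: le_trans (rnorm_twist (bQ t t0 tle1) t _ (fun x => QK t x t0 tle1) K0) _.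
    move: FG; rewrite ler_pdivlMr// mulrC; apply: le_trans.
    by rewrite ler_wpM2r ?rnorm_ge0// lerDl.
  have h2 : rnorm (Lp_map P G - Lp_map P F1) <= e / 3.
    rewrite !(Lp_map_twist bP) -(linB lP).
    apply: le_trans (rnorm_twist bP 0 _ PK K0) _.
    move: FG; rewrite ler_pdivlMr// mulrC rnormB; apply: le_trans.
    by rewrite ler_wpM2r ?rnorm_ge0// lerDl.
  have h3 := dP t t0 (lt_le_trans td dd').
  apply: le_trans (ler_rnorm_tri (twist (Q t) t G) _ _) _.
  apply: le_trans (lerD h1 (le_trans (ler_rnorm_tri (Lp_map P G) _ _) (lerD h3 h2))) _.
  lra.
(* The error consists of [Q t x - P x] and [(e^(-ikt) - 1) P x]; [L] collects their weights and the
   norm factor [(2 pi)^(1/p)]. *)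
move=> k x e e0; pose L := (2 * pi) `^ p^-1 * (1 + rnorm (P x)) + 1.
have c0 : 0 <= (2 * pi) `^ p^-1 :> R by exact: powR_ge0.
have Px0 := rnorm_ge0 (P x).
have L0 : 0 < L by rewrite ltr_wpDl// mulr_ge0// addr_ge0.
have eL : 0 < e / L by rewrite divr_gt0.
have [d1 d10 d1P] := QP x _ eL; have [d2 d20 d2P] := expi_cont 0 eL.
have k10 : 0 < `|k%:~R| + 1 :> R by rewrite ltr_wpDl.
have [d d0 [dm d1']] := small1 (Num.min d1 (d2 / (`|k%:~R| + 1)))
  ltac:(by rewrite lt_min d10 divr_gt0).
exists d => // t t0 td; have tle1 : t <= 1 by rewrite (le_trans (ltW td)).
move: dm; rewrite le_min => /andP[dd1 dd2].
have lT := @linear_Lp_class_tfun W k.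
rewrite (twist_tfun _ _ _ (bQ t t0 tle1)) Lp_map_class//; last exact: in_Lp_tfun.
have -> : P \o tfun k x = tfun k (P x) by apply/funext => s; rewrite /= /tfun (linZ bP.1).
rewrite -(linB lT); apply: le_trans (rnorm_Lp_class_tfun _ _) _.
set th := - (k%:~R * t).
have -> : expi th *: Q t x - P x = expi th *: (Q t x - P x) + (expi th - 1) *: P x.
  by rewrite scalerBr scalerBl scale1r addrA subrK.
have h1 : rnorm (expi th *: (Q t x - P x)) <= e / L.
  by rewrite rnormZ rnorm_expi mul1r d1P// (lt_le_trans td).
have h2 : rnorm ((expi th - 1) *: P x) <= e / L * rnorm (P x).
  rewrite rnormZ ler_wpM2r// ltW// -(@expi0 R) d2P// subr0 normrN normrM (gtr0_norm t0).
  apply: le_lt_trans (_ : (`|k%:~R| + 1) * t < d2); first by rewrite ler_wpM2r ?(ltW t0)// lerDl.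
  by rewrite mulrC -ltr_pdivlMr// (lt_le_trans td).
apply: (@le_trans _ _ ((2 * pi) `^ p^-1 * (e / L + e / L * rnorm (P x)))).
  by rewrite ler_wpM2l// (le_trans (ler_rnormD _ _))// lerD.
have -> : e / L + e / L * rnorm (P x) = e / L * (1 + rnorm (P x)).
  by rewrite [RHS]mulrDr mulr1.
have -> : (2 * pi) `^ p^-1 * (e / L * (1 + rnorm (P x))) =
    e * (((2 * pi) `^ p^-1 * (1 + rnorm (P x))) / L).
  by rewrite [LHS]mulrCA [LHS]mulrAC -[LHS]mulrA.
by rewrite ler_piMr ?(ltW e0)// ler_pdivrMr// mul1r lerDl.
Qed.

End twist_semigroup.

Section bounded_operator_algebra.
Context (R : realType) (U V W : normedModType R[i]).

Lemma bounded_operatorB (f g : V -> W) : bounded_operator f -> bounded_operator g ->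
  bounded_operator (fun x => f x - g x).
Proof.
move=> bf bg; have [M M0 fM] := bounded_operator_rnorm bf.
have [N N0 gN] := bounded_operator_rnorm bg.
apply: (@rnorm_bounded_operator _ _ _ _ _ (M + N)).
  by move=> a x y; rewrite bf.1 bg.1 scalerBr opprD addrACA.
by move=> x; rewrite mulrDl (le_trans (ler_rnormB _ _))// lerD.
Qed.

Lemma bounded_operatorZ a (f : V -> W) : bounded_operator f ->
  bounded_operator (fun x => a *: f x).
Proof.
move=> bf; have [M M0 fM] := bounded_operator_rnorm bf.
apply: (@rnorm_bounded_operator _ _ _ _ _ (rnorm (a : R[i]^o) * M)).
  by move=> b x y; rewrite bf.1 scalerDr !scalerA mulrC.
by move=> x; rewrite rnormZ -mulrA ler_wpM2l ?rnorm_ge0.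
Qed.

Lemma bounded_operator_comp (f : V -> W) (g : U -> V) : bounded_operator f ->
  bounded_operator g -> bounded_operator (f \o g).
Proof.
move=> bf bg; have [M M0 fM] := bounded_operator_rnorm bf.
have [N N0 gN] := bounded_operator_rnorm bg.
apply: (@rnorm_bounded_operator _ _ _ _ _ (M * N)).
  by move=> a x y /=; rewrite bg.1 bf.1.
by move=> x; rewrite -mulrA (le_trans (fM _))// ler_wpM2l.
Qed.

Lemma bounded_operator_id : bounded_operator (@idfun V).
Proof. by split=> // x; exact: cvg_id. Qed.

End bounded_operator_algebra.

Lemma linear_op_subs_graph1 (R : realType) (V : normedModType R[i]) (f : V -> V) :
  linear f -> linear_graph (op_subs (op_graph f) 1).
Proof.
move=> lf a x y x' y' /op_subs_op_graph1 <- /op_subs_op_graph1 <-.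
by apply/op_subs_op_graph1; rewrite lf scalerBr opprD addrACA.
Qed.

Section evolution.
Context (R : realType) (p : R) (p1 : 1 <= p) (X : completeNormedModType R[i]).
Local Notation mu := (leb2pi R).
Local Notation E T := (evolution_semigroup (p1 := p1) (X := X) T).

Lemma Lp_map_id (F : Lp mu p1 X) : Lp_map id F = F.
Proof. exact: Lp_class_val. Qed.

Lemma evolution_C0 (T : R -> X -> X) : C0_semigroup T -> C0_semigroup (E T).
Proof.
move=> sT; have [bT T0 TD T0P] := sT; split.
- by move=> t t0; exact: (bounded_twist p1 (bT t t0) t).
- apply/funext => F; rewrite [LHS](_ : _ = twist (T 0) 0 F)// T0.
  by rewrite -(Lp_map_twist (@bounded_operator_id R X)) Lp_map_id.
- move=> s t s0 t0; apply/funext => F; rewrite [LHS](_ : _ = twist (T (s + t)) (s + t) F)//.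
  by rewrite TD// -twist_twist//; exact: bT.
move=> F; have [K K0 TK] := semigroup_bound_on sT 1.
apply/cvg0right_rnormP => e e0; have e2 : 0 < e / 2 by rewrite divr_gt0.
have [] := @twist_cvg R p p1 X X T id (Num.max K 1) _ _ _ _ _ _ F _ e2.
- by rewrite le_max (ltW K0).
- exact: bounded_operator_id.
- by move=> x; rewrite ler_peMl ?rnorm_ge0// le_max lexx orbT.
- by move=> t t0 _; exact/bT/ltW.
- move=> t x t0 t1; apply: le_trans (TK _ _ (ltW t0) t1) _.
  by rewrite ler_wpM2r ?rnorm_ge0// le_max lexx.
- move=> x r r0; have /cvg0right_rnormP/(_ _ r0)[d d0 dP] := T0P x.
  by exists d => // t t0 td; rewrite rnormB ltW// dP.
move=> d d0 dP; exists d => // t t0 td; have := dP t t0 td.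
rewrite Lp_map_id rnormB => /le_lt_trans; apply.
by rewrite ltr_pdivrMr// ltr_pMr// ltr1n.
Qed.

(** The quotients [(S t - T t) / t] converge strongly to [P] on [X] by the rate and are uniformly
    bounded by the Lipschitz constant, so their rotated versions converge strongly on [Lp]. *)
Lemma evolution_perturb (T S : R -> X -> X) (P : X -> X) (K : R) :
  C0_semigroup T -> C0_semigroup S -> bounded_operator P -> 0 <= K ->
  (forall x e, 0 < e -> exists2 d : R, 0 < d & forall t, 0 < t -> t < d ->
     rnorm (S t x - T t x - t%:C%C *: P x) <= e * t) ->
  (forall t x, 0 <= t -> t <= 1 -> rnorm (S t x - T t x) <= K * t * rnorm x) ->
  generator (E S) = op_add (generator (E T)) (Lp_map P).
Proof.
move=> [bT _ _ _] [bS _ _ _] bP K0 rate lip; apply: generator_perturb => F e e0.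
have [L L0 PL] := bounded_operator_rnorm bP.
pose Q t x := t^-1%:C%C *: (S t x - T t x).
have bQ t : 0 < t -> t <= 1 -> bounded_operator (Q t).
  by move=> t0 _; apply/bounded_operatorZ/bounded_operatorB; [exact/bS/ltW|exact/bT/ltW].
have := @twist_cvg R p p1 X X Q P (Num.max K L) _ bP _ bQ _ _ F e e0.
case.
- by rewrite le_max K0.
- by move=> x; apply: le_trans (PL x) _; rewrite ler_wpM2r ?rnorm_ge0// le_max lexx orbT.
- move=> t x t0 t1; rewrite /Q rnormZp ?invr_ge0 ?(ltW t0)// ler_pdivrMl//.
  apply: le_trans (lip _ _ (ltW t0) t1) _.
  by rewrite (mulrC K) -mulrA ler_wpM2l ?(ltW t0)// ler_wpM2r ?rnorm_ge0// le_max lexx.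
- move=> x r r0; have [d d0 dP] := rate x r r0; exists d => // t t0 td.
  have -> : Q t x - P x = t^-1%:C%C *: (S t x - T t x - t%:C%C *: P x).
    by rewrite [RHS]scalerBr rscalerA mulVf ?gt_eqF// scale1r.
  by rewrite rnormZp ?invr_ge0 ?(ltW t0)// ler_pdivrMl// mulrC dP.
move=> d d0 dP; exists d => // t t0 td.
have lF := in_Lp_val F; have t00 := ltW t0.
have -> : E S t F - E T t F - t%:C%C *: Lp_map P F =
    t%:C%C *: (twist (Q t) t F - Lp_map P F).
  rewrite scalerBr; congr (_ - _).
  rewrite -[LHS]Lp_classB; [|exact/(in_Lp_twist p1 (bS t t00))|exact/(in_Lp_twist p1 (bT t t00))].
  rewrite -Lp_classZ; last first.
    have lr : in_Lp mu p (fun s => Lp_val F (rot2pi t s)) by exact: in_Lp_rot.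
    apply: (in_LpZ p1); apply: (in_LpB p1).
      exact: (in_Lp_comp (bS t t00) p1 lr).
    exact: (in_Lp_comp (bT t t00) p1 lr).
  by congr Lp_class; apply/funext => s; rewrite /Q rscaleVK ?gt_eqF.
by rewrite rnormZp// mulrC ler_wpM2r// dP.
Qed.

(** Rotation by a full period is the identity almost everywhere, so the evolution semigroup at
    [2 pi] is the pointwise action of [T (2 pi)], with pointwise inverse. *)
Lemma evolution_resolvent (T : R -> X -> X) : C0_semigroup T ->
  resolvent_set (op_graph (T (2 * pi))) 1 ->
  resolvent_set (op_graph (E T (2 * pi))) 1.
Proof.
move=> [bT _ _ _]; have pi0 : 0 <= 2 * pi :> R by exact/ltW/twopi_gt0.
have bW := bT _ pi0; set W := T (2 * pi) in bW *.
move=> /(resolvent_set_graph1P bW.1)[K iW].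
have lW := linear_op_subs_graph1 bW.1.
have bJ := bounded_op_inv iW lW; set J := op_inv _ in bJ.
have WJ x : W (J x) - J x = x by apply/op_subs_op_graph1; exact: op_inv_graph iW x.
have JW x : J (W x - x) = x by apply: (op_inv_uniq iW); exact/op_subs_op_graph1.
have bE := bounded_twist p1 bW (2 * pi).
have EW (F : Lp mu p1 X) : twist W (2 * pi) F = Lp_map W F.
  have lF := in_Lp_val F; rewrite Lp_map_twist//.
  apply/Lp_class_eqP; [exact: (in_Lp_twist p1 bW)|exact: (in_Lp_twist p1 bW)|].
  apply: ae_leb2pi => s s0 s2; rewrite /rot2pi subr0 (mod2pi_id (ltW s0) s2).
  congr (W (Lp_val F _)); apply: (@mod2pi_uniq _ _ _ (-1)) => //; first exact: ltW.
  by rewrite mulrN1.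
apply/(resolvent_set_graph1P bE.1).
have [L L0 JL] := bounded_operator_rnorm bJ.
exists L => G; exists (Lp_map J G); have lG := in_Lp_val G; split.
- apply/op_subs_op_graph1; rewrite EW -{3}[G]Lp_class_val -{1 2}[G]Lp_class_val.
  have lJ := in_Lp_comp bJ p1 lG.
  rewrite !(Lp_map_class p1 bJ)// (Lp_map_class p1 bW)// -Lp_classB//; last exact: (in_Lp_comp bW).
  by congr Lp_class; apply/funext => s /=; exact: WJ.
- move=> F /op_subs_op_graph1; rewrite EW => <-; have lF := in_Lp_val F.
  have lWF := in_Lp_comp bW p1 lF.
  rewrite -{2 3}[F]Lp_class_val (Lp_map_class p1 bW)// -Lp_classB//.
  rewrite (Lp_map_class p1 bJ)//; last exact: in_LpB.
  rewrite -{1}[F]Lp_class_val.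
  by congr Lp_class; apply/funext => s /=; rewrite JW.
by rewrite (Lp_map_twist bJ); exact: rnorm_twist.
Qed.

End evolution.

(** * From the generator of the evolution semigroup back to the operator at time [2 pi] *)

Section Lp_points.
Context (R : realType) (p : R) (p1 : 1 <= p) (V : normedModType R[i]).
Local Notation mu := (leb2pi R).
Local Notation T := (measurableTypeR R).

Let p0 : 0 < p. Proof. exact: lt_le_trans p1. Qed.

(** If [|F s| >= c] held almost everywhere, the norm would be at least [c (2 pi)^(1/p)]. The
    argument [P] lets an identity valid almost everywhere hold at the same point. *)
Lemma Lp_bounded_point (F : Lp mu p1 V) (P : T -> Prop) (c : R) : 0 <= c ->
  {ae mu, forall s : T, P s} -> rnorm F < c * (2 * pi) `^ p^-1 ->
  exists s : R, [/\ 0 < s, s < 2 * pi, P s & rnorm (Lp_val F s) <= c].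
Proof.
move=> c0 aeP Fc; apply: contrapT => H.
have pi0 := ltW (twopi_gt0 R).
have big : {ae mu, forall s : T, c <= rnorm (Lp_val F s)}.
  have ae0 : {ae mu, forall s : T, 0 < s /\ s < 2 * pi :> R} by exact: ae_leb2pi.
  apply: filterS2 aeP ae0 => s Ps [s0 s2].
  by rewrite leNgt; apply/negP => h; apply: H; exists s; split => //; exact: ltW.
have := lexx (rnorm F)%:E; rewrite {1}rnorm_LpE Lp_norm_leP ?rnorm_ge0// => hF.
have : (\int[mu]_x (cst (c `^ p)%:E x) <= \int[mu]_x ((rnorm (Lp_val F x)) `^ p)%:E)%E.
  apply: ae_ge0_le_integral => //.
  - by move=> x _; rewrite lee_fin powR_ge0.
  - by move=> x _; rewrite lee_fin powR_ge0.
  - by apply: measurable_rnorm_powR; exact: (in_Lp_val F).1.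
  apply: filterS big => x fx _; rewrite lee_fin ge0_ler_powR ?nnegrE ?rnorm_ge0//.
  exact: ltW.
move=> /le_trans/(_ hF); rewrite integral_cst// leb2pi_setT -EFinM lee_fin.
apply/negP; rewrite -ltNge.
have -> : c `^ p * (2 * pi) = (c * (2 * pi) `^ p^-1) `^ p.
  by rewrite powRM ?powR_ge0// -powRrM mulVf ?gt_eqF// powRr1.
by apply: gt0_ltr_powR => //; rewrite nnegrE ?rnorm_ge0// mulr_ge0 ?powR_ge0.
Qed.

Lemma in_Lp_cst0 : in_Lp mu p (fun=> 0 : V).
Proof. by split; [exact: strongly_measurable_cst|rewrite (Lp_norm_cst0 _ p1) ltry]. Qed.

Lemma Lp_class_cst0 : Lp_class mu p1 (fun=> 0 : V) = 0.
Proof.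
have := Lp_classB p1 in_Lp_cst0 in_Lp_cst0; rewrite !subrr => <-.
by congr Lp_class; apply/funext => s; rewrite subrr.
Qed.

Lemma Lp_val_sum (F : nat -> Lp mu p1 V) n :
  {ae mu, forall s : T, Lp_val (\sum_(k < n) F k) s = \sum_(k < n) Lp_val (F k) s}.
Proof.
elim: n => [|n ih].
  have := Lp_classK p1 in_Lp_cst0; rewrite Lp_class_cst0.
  by apply: filterS => s; rewrite !big_ord0.
have := Lp_valD (\sum_(k < n) F k) (F n).
by apply: filterS2 ih => s ih; rewrite !big_ord_recr /= ih.
Qed.

Lemma rnorm_Lp_bounded (F : Lp mu p1 V) (c : R) : 0 <= c ->
  {ae mu, forall s : T, rnorm (Lp_val F s) <= c} -> rnorm F <= c * (2 * pi) `^ p^-1.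
Proof.
move=> c0 Fc; rewrite -lee_fin rnorm_LpE; apply: Lp_norm_bounded => //.
exact: (in_Lp_val F).1.
Qed.

End Lp_points.

Section evolution_inverse.
Context (R : realType) (p : R) (p1 : 1 <= p) (X : completeNormedModType R[i]).
Variable S : R -> X -> X.
Hypothesis sS : C0_semigroup S.
Local Notation mu := (leb2pi R).
Local Notation T := (measurableTypeR R).
Local Notation E := (evolution_semigroup (p1 := p1) (X := X) S).
Local Notation W := (S (2 * pi)).

Let pi20 := ltW (twopi_gt0 R).
Let bS t : 0 <= t -> bounded_operator (S t). Proof. by case: sS => + _ _ _; exact. Qed.
Let SD s t x : 0 <= s -> 0 <= t -> S (s + t) x = S s (S t x).
Proof. by move=> s0 t0; case: sS => _ _ h _; rewrite h. Qed.

(** The maximum extends the orbit continuously to negative times, on which the values of [S] are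
    arbitrary; continuity on the whole line gives strong measurability. *)
Definition orbit x (s : T) : X := S (Num.max 0 s) x.

Let max0_dist (c t : R) : `|Num.max 0 t - Num.max 0 c| <= `|t - c|.
Proof.
have h1 := ler_norm (t - c); have h2 := ler_norm (- (t - c)); rewrite normrN in h2.
rewrite !maxEle; case: (leP 0 t) => t0; case: (leP 0 c) => c0; rewrite ?subrr ?normr0//;
  rewrite ler_norml; apply/andP; split; lra.
Qed.

(* With [x = 0] these are the orbits; the affine case is the integral of the rotated orbits
   over a period. *)
Let in_Lp_affine_orbit x y : in_Lp mu p (fun s : T => S (Num.max 0 s) (s%:C%C *: x + y)).
Proof.
have [M M0 SM] := semigroup_bound_on sS (2 * pi).
apply: (@in_Lp_bounded _ _ p1 _ _ (M * (2 * pi * rnorm x + rnorm y))); last first.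
  apply: ae_leb2pi => s s0 s2; rewrite max_r ?(ltW s0)//.
  apply: le_trans (SM _ _ (ltW s0) (ltW s2)) _; rewrite ler_wpM2l ?(ltW M0)//.
  apply: le_trans (ler_rnormD _ _) _; rewrite lerD2r rnormZp ?(ltW s0)//.
  by rewrite ler_wpM2r ?rnorm_ge0// ltW.
apply: contR_strongly_measurable => c e e0.
have c0 : 0 <= Num.max 0 c by rewrite le_max lexx.
have [d d0 dP] := semigroup_continuous sS (c%:C%C *: x + y) c0 e0.
have x0 := rnorm_ge0 x; have x1 : 0 < rnorm x + 1 by rewrite ltr_wpDl.
exists (Num.min d (d / (rnorm x + 1))); first by rewrite lt_min d0 divr_gt0.
move=> t; rewrite lt_min => /andP[t1 t2]; apply: dP; rewrite ?le_max ?lexx//.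
  exact: le_lt_trans (max0_dist _ _) t1.
rewrite opprD addrACA subrr addr0 -scalerBl -rmorphB rnormZr.
apply: le_lt_trans (_ : `|t - c| * (rnorm x + 1) < d); last by rewrite -ltr_pdivlMr.
by rewrite ler_wpM2l// lerDl.
Qed.

Lemma in_Lp_orbit x : in_Lp mu p (orbit x).
Proof.
rewrite (_ : orbit x = fun s : T => S (Num.max 0 s) (s%:C%C *: 0 + x)); first exact: in_Lp_affine_orbit.
by apply/funext => s; rewrite scaler0 add0r.
Qed.

Local Notation orbit_class x := (Lp_class mu p1 (orbit x)).

(** For [r <= s], applying [S r] to the value at [s - r] restores [S s x]. For [s < r] the value
    comes from [s - r + 2 pi], one period further, which inserts a factor [W]. *)
Lemma evolution_orbit x r : 0 <= r -> r < 2 * pi ->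
  {ae mu, forall s : T, Lp_val (E r (orbit_class x)) s = if r <= s then S s x else S s (W x)}.
Proof.
move=> r0 r2; have lx := in_Lp_orbit x.
have -> : E r (orbit_class x) = Lp_class mu p1 (fun s => S r (orbit x (rot2pi r s))).
  exact: (twist_class p1 (bS r0) r lx).
have h1 := Lp_classK p1 (in_Lp_twist p1 (bS r0) r lx).
have h2 : {ae mu, forall s : T, S r (orbit x (rot2pi r s)) = if r <= s then S s x else S s (W x)}.
  apply: ae_leb2pi => s s0 s2; have s00 := ltW s0.
  rewrite /rot2pi mod2pi_rot//; case: ifPn => rs.
    by rewrite /orbit max_r ?subr_ge0// -SD ?subr_ge0// addrC subrK.
  have sr : 0 <= s - r + 2 * pi by lra.
  by rewrite /orbit max_r// -!SD//; congr (S _ x); lra.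
by apply: filterS2 h1 h2 => s -> ->.
Qed.

Lemma evolution_period (F : Lp mu p1 X) :
  {ae mu, forall s : T, Lp_val (E (2 * pi) F) s = W (Lp_val F s)}.
Proof.
have h1 := Lp_classK p1 (in_Lp_twist p1 (bS pi20) (2 * pi) (in_Lp_val F)).
have h2 : {ae mu, forall s : T, W (Lp_val F (rot2pi (2 * pi) s)) = W (Lp_val F s)}.
  apply: ae_leb2pi => s s0 s2; congr (W (Lp_val F _)).
  by apply: (@mod2pi_uniq _ _ _ (-1)); rewrite ?(ltW s0)// mulrN1.
by apply: filterS2 h1 h2 => s -> ->.
Qed.

(* The Riemann sums of step [h] for [r |-> (E r f) s] count the nodes [k h <= s]. *)
Let a (h s : R) (k : nat) : R := if k%:R * h <= s then h else 0.

Let sum_a (h s : R) n : 0 < h -> 0 <= s ->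
  (n%:R * h <= s -> \sum_(k < n) a h s k = n%:R * h) /\
  (s < n%:R * h -> s <= \sum_(k < n) a h s k <= s + h).
Proof.
move=> h0 s0; elim: n => [|n [ih1 ih2]].
  rewrite big_ord0 mul0r; split=> // sl; lra.
rewrite big_ord_recr /= -natr1; have -> : (n%:R + 1) * h = n%:R * h + h by rewrite mulrDl mul1r.
case: (leP (n%:R * h) s) => ns.
  have -> : a h s n = h by rewrite /a ns.
  rewrite (ih1 ns); split=> // ls; apply/andP; split; lra.
have -> : a h s n = 0 by rewrite /a leNgt ns.
have /andP[i1 i2] := ih2 ns; rewrite addr0; split=> ls; first by lra.
by rewrite i1.
Qed.

(** The integral of [evolution_orbit] over [r] in [[0, 2 pi]]: the rotations [r <= s] have total
    length [s], the others [2 pi - s]. *)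
Let Z x (s : T) : X := S (Num.max 0 s) (s%:C%C *: x + (2 * pi - s)%:C%C *: W x).

Let in_Lp_Z x : in_Lp mu p (Z x).
Proof.
rewrite (_ : Z x = fun s : T => S (Num.max 0 s)
  (s%:C%C *: (x - W x) + (2 * pi)%:C%C *: W x)); first exact: in_Lp_affine_orbit.
apply/funext => s; congr (S _ _); rewrite scalerBr (rmorphB (real_complex R)) scalerBl.
by rewrite -addrA [- _ + _]addrC.
Qed.

Let orbit_sum x (h s : R) n : 0 <= s ->
  h%:C%C *: (\sum_(k < n) (if k%:R * h <= s then S s x else S s (W x))) =
  S s ((\sum_(k < n) a h s k)%:C%C *: x + (n%:R * h - \sum_(k < n) a h s k)%:C%C *: W x).
Proof.
move=> s0; have lS := (bS s0).1; elim: n => [|n ih].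
  by rewrite !big_ord0 mul0r subr0 !scale0r addr0 scaler0 (lin0 lS).
rewrite !big_ord_recr scalerDr ih /=.
set A := \sum_(i < n) _; rewrite -[n.+1%:R]natr1.
have -> : (n%:R + 1) * h - (A + a h s n) = (n%:R * h - A) + (h - a h s n).
  by rewrite mulrDl mul1r opprD addrACA.
rewrite (rmorphD (real_complex R) A) (rmorphD (real_complex R) (n%:R * h - A)) !scalerDl addrACA.
rewrite [RHS](linD lS); congr (_ + _); rewrite /a; case: ifPn => _.
  by rewrite subrr scale0r addr0 (linZ lS).
by rewrite subr0 scale0r add0r (linZ lS).
Qed.

(** [E (2 pi) u - u] is the integral of [E r] applied to the orbit class over a period, and
    [E (2 pi)] acts pointwise as [W]. The integral appears only as a limit of Riemann sums in [Lp],
    which for almost every [s] are computed by counting nodes, with an error proportional to the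
    step. *)
Lemma evolution_inverse_orbit x (u : Lp mu p1 X) : generator E (u, orbit_class x) ->
  {ae mu, forall s : T, W (Lp_val u s) - Lp_val u s =
    S s (s%:C%C *: x + (2 * pi - s)%:C%C *: W x)}.
Proof.
move=> Gu; have [M M0 SM] := semigroup_bound_on sS (2 * pi).
have sE := evolution_C0 p1 sS; have lZ := in_Lp_Z x; have lu := in_Lp_val u.
have lEu := in_Lp_val (E (2 * pi) u).
set L := orbit_class x in Gu.
pose C := M * (rnorm x + rnorm (W x)).
have C0 : 0 <= C by rewrite mulr_ge0 ?addr_ge0 ?rnorm_ge0 ?(ltW M0).
have c0 : 0 <= (2 * pi) `^ p^-1 :> R by exact: powR_ge0.
have near n : let h := 2 * pi / n.+1%:R in
    rnorm (h%:C%C *: (\sum_(k < n.+1) E (k%:R * h) L) - Lp_class mu p1 (Z x)) <=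
    C * h * (2 * pi) `^ p^-1.
  move=> h; have h0 : 0 < h by rewrite divr_gt0 ?twopi_gt0 ?ltr0n.
  have nh : n.+1%:R * h = 2 * pi by rewrite mulrC divfK ?pnatr_eq0.
  rewrite -[_ *: _]Lp_class_val -Lp_classB//; last exact: in_Lp_val.
  apply: rnorm_Lp_bounded; first by rewrite mulr_ge0// ltW.
  have h1 : {ae mu, forall s : T, forall k : nat, (k < n.+1)%N ->
      Lp_val (E (k%:R * h) L) s = if k%:R * h <= s then S s x else S s (W x)}.
    apply/ae_foralln => k; have [kn|nk] := ltnP k n.+1; last first.
      by apply: aeW.
    have kh : k%:R * h < 2 * pi by rewrite -nh ltr_pM2r// ltr_nat.
    have kh0 : 0 <= k%:R * h by rewrite mulr_ge0 ?ler0n// ltW.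
    by apply: filterS (evolution_orbit x kh0 kh) => s ->.
  have h2 := Lp_valZ h%:C%C (\sum_(k < n.+1) E (k%:R * h) L).
  have h3 := Lp_val_sum (fun k => E (k%:R * h) L) n.+1.
  have h4 := Lp_classK p1 (in_LpB p1 (in_Lp_val (h%:C%C *: \sum_(k < n.+1) E (k%:R * h) L)) lZ).
  have ae0 : {ae mu, forall s : T, 0 < s /\ s < 2 * pi :> R} by exact: ae_leb2pi.
  apply: filterS3 (filterI h1 h2) (filterI h3 h4) ae0 => s [e1 e2] [e3 ->] [s0 s2].
  rewrite e2 e3; under eq_bigr => k _ do rewrite e1//.
  rewrite (orbit_sum _ _ _ (ltW s0)) nh /Z max_r ?(ltW s0)// -(linB (bS (ltW s0)).1).
  have [m1 m2] := sum_a n.+1 h0 (ltW s0); rewrite nh in m2; have {m2}/andP[m2 m3] := m2 s2.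
  set A := \sum_(k < n.+1) _ in m2 m3 *.
  apply: le_trans (SM _ _ (ltW s0) (ltW s2)) _.
  have -> : C * h = M * (h * rnorm x + h * rnorm (W x)).
    by rewrite /C -mulrDr mulrAC mulrA.
  rewrite ler_wpM2l ?(ltW M0)//.
  rewrite opprD addrACA -!scalerBl -!(rmorphB (real_complex R)).
  apply: le_trans (ler_rnormD _ _) _; rewrite !rnormZr.
  by rewrite lerD// ler_wpM2r ?rnorm_ge0// ler_norml; apply/andP; split; lra.
have key : E (2 * pi) u - u = Lp_class mu p1 (Z x).
  apply/eqP; rewrite -subr_eq0; apply/eqP/rnorm_lt_all => e e0.
  have e2 : 0 < e / 2 by rewrite divr_gt0.
  have [N NP] := generator_Riemann_sum sE Gu pi20 e2.
  pose B := C * (2 * pi) * (2 * pi) `^ p^-1 + 1.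
  have B0 : 0 < B by rewrite ltr_wpDl// mulr_ge0// mulr_ge0.
  have [N' N'P] := invf_natP (divr_gt0 e2 B0).
  pose n := maxn N N'.
  apply: le_trans (ler_rnorm_tri ((2 * pi / n.+1%:R)%:C%C *:
    (\sum_(k < n.+1) E (k%:R * (2 * pi / n.+1%:R)) L)) _ _) _.
  rewrite [leRHS]splitr lerD//; first by apply: NP; exact: leq_maxl.
  apply: le_trans (near n) _.
  apply: le_trans (_ : B * n.+1%:R^-1 <= _).
    rewrite [C * _]mulrA mulrAC ler_wpM2r ?invr_ge0 ?ler0n// lerDl//.
  rewrite mulrC -ler_pdivlMr//; apply: le_trans (ltW N'P).
  by rewrite lef_pV2 ?posrE ?ltr0n// ler_nat ltnS leq_maxr.
have : Lp_class mu p1 (fun s => Lp_val (E (2 * pi) u) s - Lp_val u s) = Lp_class mu p1 (Z x).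
  by rewrite Lp_classB// !Lp_class_val.
move=> /(Lp_class_eqP p1 (in_LpB p1 lEu lu) lZ) h1.
have h2 := evolution_period u.
have ae0 : {ae mu, forall s : T, 0 < s /\ s < 2 * pi :> R} by exact: ae_leb2pi.
by apply: filterS3 h1 h2 ae0 => s + e1 [s0 _]; rewrite e1 /Z max_r// ltW.
Qed.

(** The inverse image [u] of the orbit of [x] satisfies the identity of [evolution_inverse_orbit]
    almost everywhere. One suitable point [s] yields a solution of [W z - z = x] whose norm is
    controlled independently of [s]. *)
Lemma evolution_inverse (K : R) : 0 <= K -> boundedly_invertible (generator E) K ->
  resolvent_set (op_graph W) 1.
Proof.
move=> K0 iG; have bW := bS pi20; apply/(resolvent_set_graph1P bW.1).
have [M M0 SM] := semigroup_bound_on sS (2 * pi).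
have c0 : 0 < (2 * pi) `^ p^-1 :> R by rewrite powR_gt0 ?twopi_gt0.
(* The orbit of a fixed vector is periodic, hence invariant under the evolution semigroup and
   annihilated by its generator. *)
have inj z : W z = z -> z = 0.
  move=> Wz.
  have Ez r : 0 <= r -> r < 2 * pi -> E r (orbit_class z) = orbit_class z.
    move=> r0 r2; apply/Lp_val_eqP.
    have h1 := evolution_orbit z r0 r2; have h2 := Lp_classK p1 (in_Lp_orbit z).
    have ae0 : {ae mu, forall s : T, 0 < s /\ s < 2 * pi :> R} by exact: ae_leb2pi.
    apply: filterS3 h1 h2 ae0 => s -> -> [s0 _].
    by rewrite Wz if_same /orbit max_r// ltW.
  have G0 : generator E (orbit_class z, 0).
    apply/generatorP => e e0; exists (2 * pi); first exact: twopi_gt0.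
    move=> t t0 t2; rewrite Ez ?(ltW t0)// subrr scaler0 subr0 rnorm0.
    by rewrite mulr_ge0 ?ltW.
  have := rnorm_op_inv iG 0; rewrite (op_inv_uniq iG G0) rnorm0 mulr0 => hz.
  have oz : orbit_class z = 0 by apply: rnorm_eq0; apply/le_anti; rewrite hz rnorm_ge0.
  move: oz; rewrite -Lp_class_cst0 => /(Lp_class_eqP p1 (in_Lp_orbit z) (in_Lp_cst0 p1 X)) oz.
  have [|s [s0 s2 + _]] := @Lp_bounded_point R p p1 X 0 _ 1 ler01 oz.
    by rewrite rnorm0 mul1r.
  rewrite /orbit max_r ?(ltW s0)// => Sz; rewrite -Wz -(subrK s (2 * pi)) SD ?(ltW s0) ?subr_ge0 ?(ltW s2)// Sz.
  by rewrite (lin0 (bS _).1)// subr_ge0 ltW.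
have injB z z' : W z - z = W z' - z' -> z = z'.
  move=> zz; apply/eqP; rewrite -subr_eq0; apply/eqP/inj; rewrite (linB bW.1).
  by apply/eqP; rewrite -subr_eq0 subrACA zz subrr.
have KM0 : 0 <= K * M + 1 by rewrite addr_ge0// mulr_ge0// ltW.
pose q := (2 * pi)^-1 * (M * (K * M + 1) + 2 * pi * M).
have q0 : 0 <= q.
  by apply: mulr_ge0; rewrite ?invr_ge0//; apply: addr_ge0; apply: mulr_ge0; rewrite ?(ltW M0).
have WM y : rnorm (W y) <= M * rnorm y by exact: SM.
exists (q + M + 1) => x.
have [->|x0] := eqVneq x 0.
  exists 0; rewrite rnorm0 mulr0; split=> [|z'|//]; last first.
    by move=> /op_subs_op_graph1 h; apply: injB; rewrite h (lin0 bW.1) subrr.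
  by apply/op_subs_op_graph1; rewrite (lin0 bW.1) subrr.
have nx : 0 < rnorm x.
  by rewrite lt_def rnorm_ge0 andbT; apply: contra x0 => /eqP/rnorm_eq0/eqP.
have Gu := op_inv_graph iG (orbit_class x); set u := op_inv _ _ in Gu.
have hu := rnorm_op_inv iG (orbit_class x); rewrite -/u in hu.
have hL : rnorm (orbit_class x) <= M * rnorm x * (2 * pi) `^ p^-1.
  apply: rnorm_Lp_bounded; first by rewrite mulr_ge0 ?rnorm_ge0// ltW.
  have ae0 : {ae mu, forall s : T, 0 < s /\ s < 2 * pi :> R} by exact: ae_leb2pi.
  apply: filterS2 (Lp_classK p1 (in_Lp_orbit x)) ae0 => s -> [s0 s2].
  by rewrite /orbit max_r ?(ltW s0)// SM// ltW.
(* The bounds on [u] and on the orbit give the norm [K M |x| (2 pi)^(1/p)]; the [+ 1] makes the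
   inequality strict, which is why [x = 0] was treated apart. *)
have [||s [s0 s2 hs us]] := @Lp_bounded_point R p p1 X u _ ((K * M + 1) * rnorm x) _
    (evolution_inverse_orbit Gu).
- by rewrite mulr_ge0 ?(ltW nx).
- apply: le_lt_trans hu _; apply: le_lt_trans (ler_wpM2l K0 hL) _.
  rewrite mulrA ltr_pM2r// mulrA ltr_pM2r// ltrDl//.
have s00 := ltW s0; have s20 : 0 <= 2 * pi - s by rewrite subr_ge0 ltW.
have bR := bS s20; have cancelS y : S (2 * pi - s) (S s y) = W y by rewrite -SD// subrK.
have commW y : W (S (2 * pi - s) y) = S (2 * pi - s) (W y) by rewrite -!SD// addrC.
(* Applying [S (2 pi - s)] to the identity at [s] turns its right side into
   [s W x + (2 pi - s) W (W x)]. The term [s W x] in [b] contributes [s W (W x) - s W x], so the sum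
   [2 pi W (W x)] no longer involves [s]. *)
pose b := (2 * pi)^-1%:C%C *: (S (2 * pi - s) (Lp_val u s) + s%:C%C *: W x).
have Wb : W b - b = W (W x).
  rewrite /b (linZ bW.1) -scalerBr (linD bW.1) (linZ bW.1) commW opprD addrACA.
  rewrite -(linB bR.1) hs cancelS (linD bW.1) !(linZ bW.1).
  rewrite (rmorphB (real_complex R)) [(_ - _) *: _]scalerBl.
  rewrite [X in _ *: X](_ : _ = (2 * pi)%:C%C *: W (W x)); last first.
    by rewrite addrC addrA subrK addrC subrK.
  by rewrite rscalerA mulVf ?scale1r// gt_eqF// twopi_gt0.
have bound : rnorm b <= q * rnorm x.
  rewrite rnormZp ?invr_ge0// -[q * _]mulrA ler_wpM2l ?invr_ge0//.
  apply: le_trans (ler_rnormD _ _) _.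
  have -> : (M * (K * M + 1) + 2 * pi * M) * rnorm x =
    M * (K * M + 1) * rnorm x + 2 * pi * M * rnorm x by exact: mulrDl.
  apply: lerD.
    apply: le_trans (SM _ _ s20 _) _; first by rewrite gerBl.
    by rewrite -mulrA ler_wpM2l// ltW.
  by rewrite rnormZp// -mulrA ler_pM ?rnorm_ge0// ltW.
(* The factor [W^2] is removed by [W^2 x - (W - 1) (W x) - (W - 1) x = x]. *)
have zP : W (b - W x - x) - (b - W x - x) = x.
  rewrite !(linB bW.1) subrACA [X in X - _]subrACA Wb.
  by have e (c d : X) : c - (c - d) = d; [rewrite opprB addrC subrK|rewrite !e].
exists (b - W x - x); split.
- exact/op_subs_op_graph1.
- by move=> z' /op_subs_op_graph1 h; apply: injB; rewrite h zP.
apply: le_trans (ler_rnormB _ _) _; apply: le_trans (lerD (ler_rnormB _ _) (lexx _)) _.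
have -> : (q + M + 1) * rnorm x = q * rnorm x + M * rnorm x + rnorm x.
  by rewrite -[RHS]/(_ + _ + _) !mulrDl mul1r.
by rewrite lerD2r lerD.
Qed.

End evolution_inverse.

(** * The two bounds *)

Section feedback.
Context (R : realType) (X U : normedModType R[i]) (Y : completeNormedModType R[i]).

(** The map [z -> w - L z] is a contraction of ratio [q]; its iterates from [0] are the partial sums
    of the Neumann series, all bounded by [|w| / (1 - q)]. *)
Lemma neumann_solution (L : Y -> Y) (q : R) : linear L -> 0 <= q -> q < 1 ->
  (forall y, rnorm (L y) <= q * rnorm y) -> forall w,
  exists z, [/\ z + L z = w, forall z', z' + L z' = w -> z' = z &
    rnorm z <= rnorm w / (1 - q)].
Proof.
move=> lL q0 q1 Lq w; have q10 : 0 < 1 - q by rewrite subr_gt0.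
have w0 := rnorm_ge0 w.
have c0 : 0 <= rnorm w / (1 - q) by rewrite divr_ge0// ltW.
pose z := fix z (n : nat) : Y := if n is m.+1 then w - L (z m) else 0.
have zb n : rnorm (z n) <= rnorm w / (1 - q).
  elim: n => [|n ih] /=; first by rewrite rnorm0.
  apply: le_trans (ler_rnormB _ _) _.
  apply: le_trans (lerD (lexx _) (le_trans (Lq _) (ler_wpM2l q0 ih))) _.
  by rewrite le_eqVlt; apply/orP; left; apply/eqP; field; rewrite gt_eqF.
have zd n j : rnorm (z (n + j)%N - z n) <= q ^+ n * (rnorm w / (1 - q)).
  elim: n => [|n ih] /=; first by rewrite expr0 mul1r subr0.
  rewrite subrACA subrr sub0r rnormN -(linB lL) exprS -mulrA.
  apply: le_trans (Lq _) _; rewrite ler_wpM2l//.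
have small (e : R) : 0 < e -> exists N, forall n, (N <= n)%N -> q ^+ n * (rnorm w / (1 - q)) <= e.
  move=> e0; have d0 : 0 < e / (rnorm w / (1 - q) + 1) by rewrite divr_gt0// ltr_wpDl.
  have := @cvg_expr R q; rewrite ger0_norm// => /(_ q1)/cvgrPdist_lt/(_ _ d0)[N _ NP].
  exists N => n /NP /=; rewrite sub0r normrN ger0_norm ?exprn_ge0// ltr_pdivlMr ?ltr_wpDl//.
  move=> /ltW; apply: le_trans; rewrite ler_wpM2l ?exprn_ge0// lerDl//.
have [y yP] : exists y : Y, z n @[n --> \oo] --> y.
  apply: rnorm_cauchy_cvg => e e0; have [N NP] := small _ e0; exists N => m n.
  wlog mn : m n / (m <= n)%N.
    move=> W1 hm hn; have [/W1->//|/ltnW/W1 h] := leqP m n.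
    by rewrite rnormB h.
  by move=> Nm Nn; rewrite rnormB -(subnKC mn); apply: le_trans (zd _ _) _; exact: NP.
have zy n : rnorm (y - z n) <= q ^+ n * (rnorm w / (1 - q)).
  apply: (cvgn_rnorm_le (N := n) yP) => m nm; rewrite -(subnKC nm); exact: zd.
have yw : y + L y = w.
  apply/eqP; rewrite -subr_eq0; apply/eqP/rnorm_lt_all => e e0.
  have e2 : 0 < e / 2 by rewrite divr_gt0.
  have [N NP] := small _ e2.
  have -> : y + L y - w = (y - z N.+1) + L (y - z N).
    by rewrite (linB lL) /= opprB [RHS]addrACA; congr (_ + _); rewrite addrAC subrr sub0r.
  apply: le_trans (ler_rnormD _ _) _; rewrite [leRHS]splitr lerD//.
    by apply: le_trans (zy _) _; apply: NP; exact: leqnSn.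
  apply: le_trans (Lq _) _; apply: le_trans (NP N (leqnn N)).
  by apply: le_trans (zy _); rewrite ler_piMl ?rnorm_ge0// ltW.
exists y; split => //; last by have := zy 0; rewrite /= subr0 expr0 mul1r.
move=> y' h'; apply/eqP; rewrite -subr_eq0; apply/eqP/rnorm_eq0/le_anti.
rewrite rnorm_ge0 andbT; have : rnorm (y' - y) <= q * rnorm (y' - y).
  have e1 : y' = w - L y' by rewrite -{1}h' addrK.
  have e2 : y = w - L y by rewrite -{1}yw addrK.
  have e : y' - y = - L (y' - y) by rewrite (linB lL) {1}e1 {1}e2 subrACA subrr sub0r.
  by rewrite {1}e rnormN; exact: Lq.
by rewrite -subr_le0 -[X in X - _]mul1r -mulrBl pmulr_rle0.
Qed.

(** The equation [G u + B D C u = f] is solved through its output [z = C u], which satisfies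
    [z + C J B D z = C J f] in [Y]; then [u = J (f - B D z)]. The smallness is thus required of
    [C J B D] alone. *)
Lemma feedback_invertible (G : set (X * X)) (K : R) (B : U -> X) (D : Y -> U) (C : X -> Y)
    (q : R) : 0 <= K -> boundedly_invertible G K -> linear_graph G ->
  bounded_operator B -> bounded_operator D -> bounded_operator C -> 0 <= q -> q < 1 ->
  (forall y, rnorm (C (op_inv G (B (D y)))) <= q * rnorm y) ->
  exists2 K', 0 <= K' & boundedly_invertible (op_add G (B \o D \o C)) K'.
Proof.
move=> K0 iG lG bB bD bC q0 q1 Lq; have bJ := bounded_op_inv iG lG.
set J := op_inv G in Lq bJ *.
have lL : linear (fun y => C (J (B (D y)))).
  by move=> a x y; rewrite bD.1 bB.1 bJ.1 bC.1.
have [c c0 Cc] := bounded_operator_rnorm bC.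
have [b b0 Bb] := bounded_operator_rnorm (bounded_operator_comp bB bD).
have q10 : 0 < 1 - q by rewrite subr_gt0.
exists (K * (1 + b * (c * K / (1 - q)))).
  by rewrite mulr_ge0// addr_ge0// mulr_ge0// divr_ge0 ?(ltW q10)// mulr_ge0.
move=> f; have [z [zP zU zb]] := neumann_solution lL q0 q1 Lq (C (J f)).
pose u := J (f - B (D z)).
have Cu : C u = z by rewrite /u (linB bJ.1) (linB bC.1) -zP addrK.
exists u; split.
- exists (f - B (D z)); first exact: op_inv_graph iG _.
  by rewrite /= Cu subrK.
- move=> u' /= [v' Gv' fE]; have Jv : J v' = u' by exact: op_inv_uniq iG _ _ Gv'.
  have v'E : v' = f - B (D (C u')) by rewrite (fE : f = v' + B (D (C u'))) addrK.
  have : C u' = z.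
    apply: zU; rewrite -{1}Jv {1}v'E (linB bJ.1) (linB bC.1) subrK//.
  by move=> Cu'; rewrite /u -Jv v'E Cu'.
have hz : rnorm z <= c * K / (1 - q) * rnorm f.
  apply: le_trans zb _; rewrite mulrAC ler_wpM2r ?invr_ge0 ?(ltW q10)// -mulrA.
  by apply: le_trans (Cc _) _; rewrite ler_wpM2l//; exact: rnorm_op_inv iG _.
apply: le_trans (rnorm_op_inv iG _) _.
have -> : K * (1 + b * (c * K / (1 - q))) * rnorm f =
    K * (rnorm f + b * (c * K / (1 - q) * rnorm f)).
  by rewrite -[LHS]mulrA mulrDl mul1r; congr (_ * (_ + _)); rewrite -[LHS]mulrA.
rewrite ler_wpM2l//; apply: le_trans (ler_rnormB _ _) _; rewrite lerD2l.
by apply: le_trans (Bb _) _; rewrite ler_wpM2l.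
Qed.

End feedback.

Section expi_derivative.
Context (R : realType).

Lemma rnorm_ReIm (z : R[i]) : rnorm (z : R[i]^o) <= `|complex.Re z| + `|complex.Im z|.
Proof.
rewrite rnorm_complex -[leRHS]ger0_norm ?addr_ge0// -sqrtr_sqr ler_wsqrtr//.
by rewrite sqrrD !real_normK ?num_real// addrAC lerDl mulrn_wge0 ?mulr_ge0.
Qed.

Lemma derive0_bound (f : R -> R) (l e : R) : is_derive (0 : R) (1 : R) f l -> 0 < e ->
  exists2 d : R, 0 < d & forall h, `|h| < d -> `|f h - f 0 - l * h| <= e * `|h|.
Proof.
move=> [df fl] e0.
have : h^-1 *: ((f \o shift 0) (h *: 1) - f 0) @[h --> 0^'] --> 'D_1 f 0 by exact: df.
rewrite fl => /cvgrPdist_lt/(_ _ e0)[d /= d0 dP]; exists d => // h hd.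
have [->|h0] := eqVneq h 0; first by rewrite mulr0 subrr subr0 normr0 mulr0.
have := dP h; rewrite /= sub0r normrN => /(_ hd h0).
rewrite addr0 [h *: 1]mulr1 => /ltW hl.
have -> : f h - f 0 - l * h = - (h * (l - h^-1 *: (f h - f 0))).
  by rewrite mulrBr [h * (_ *: _)]mulrA mulfV// mul1r opprB [l * h]mulrC.
by rewrite normrN normrM mulrC ler_wpM2r.
Qed.

Lemma expi_derivative0 (e : R) : 0 < e -> exists2 d : R, 0 < d &
  forall h, `|h| < d -> rnorm (expi h - 1 - (0 +i* h)%C : R[i]^o) <= e * `|h|.
Proof.
move=> e0; have e2 : 0 < e / 2 by rewrite divr_gt0.
have [d1 d10 h1] := derive0_bound (is_derive_sin (0 : R)) e2.
have [d2 d20 h2] := derive0_bound (is_derive_cos (0 : R)) e2.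
exists (Num.min d1 d2); first by rewrite lt_min d10.
move=> h; rewrite lt_min => /andP[/h1 {}h1 /h2 {}h2].
move: h1 h2; rewrite sin0 cos0 subr0 mul1r oppr0 mul0r subr0 => h1 h2.
apply: le_trans (rnorm_ReIm _) _; rewrite /expi /= subr0 addrC.
have -> : e * `|h| = e / 2 * `|h| + e / 2 * `|h| by rewrite -mulrDl -splitr.
by rewrite lerD// subr0.
Qed.

End expi_derivative.

(** * Semigroups multiplied by a character *)

Section shifted_semigroup.
Context (R : realType) (V : completeNormedModType R[i]).

(** The semigroup generated by [A - ia]. For an integer [a = k] it coincides with [S] at time
    [2 pi], so hypotheses and conclusions about [S (2 pi)] pass between [A] and [A - ik]. *)
Definition shifted (S : R -> V -> V) (a t : R) (x : V) : V := expi (- (a * t)) *: S t x.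

Variable S : R -> V -> V.
Hypothesis sS : C0_semigroup S.

Lemma shifted_C0 a : C0_semigroup (shifted S a).
Proof.
have [bS S0 SD SP] := sS; split.
- by move=> t t0; apply: bounded_operatorZ; exact: bS.
- by apply/funext => x; rewrite /shifted mulr0 oppr0 expi0 S0 scale1r.
- move=> s t s0 t0; apply/funext => x; rewrite /shifted /= SD//.
  by rewrite (linZ (bS s s0).1) scalerA -expiD -opprD -mulrDr.
move=> x; apply/cvg0right_rnormP => e e0; have e2 : 0 < e / 2 by rewrite divr_gt0.
have x0 := rnorm_ge0 x; have x1 : 0 < rnorm x + 1 by rewrite ltr_wpDl.
have /cvg0right_rnormP/(_ _ e2)[d1 d10 h1] := SP x.
have [d2 d20 h2] := expi_cont 0 (divr_gt0 e2 x1).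
have a1 : 0 < `|a| + 1 by rewrite ltr_wpDl.
exists (Num.min d1 (d2 / (`|a| + 1))); first by rewrite lt_min d10 divr_gt0.
move=> t t0; rewrite lt_min => /andP[/h1-/(_ t0) {}h1 t2].
set th := - (a * t); have th2 : `|th - 0| < d2.
  rewrite subr0 normrN normrM (gtr0_norm t0).
  apply: le_lt_trans (_ : (`|a| + 1) * t < d2); first by rewrite ler_wpM2r ?(ltW t0)// lerDl.
  by rewrite mulrC -ltr_pdivlMr.
have := h2 _ th2; rewrite expi0 ltr_pdivlMr// => {}h2.
have -> : x - shifted S a t x = expi th *: (x - S t x) + - ((expi th - 1) *: x).
  by rewrite /shifted -/th scalerBr scalerBl scale1r opprB [RHS]addrC [RHS]addrA subrK.
apply: le_lt_trans (ler_rnormD _ _) _; rewrite rnormN !rnormZ rnorm_expi mul1r [ltRHS]splitr.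
rewrite ltrD//; apply: le_lt_trans h2.
by rewrite ler_wpM2l ?rnorm_ge0// lerDl.
Qed.

Lemma generator_shifted a : generator (shifted S a) = op_subs (generator S) (0 +i* a)%C.
Proof.
have [bS S0 SD SP] := sS; apply: generator_perturb => x e e0.
have x0 := rnorm_ge0 x; have a0 := normr_ge0 a.
have A0 : 0 < `|a| + 1 by rewrite ltr_wpDl.
have x1 : 0 < rnorm x + 1 by rewrite ltr_wpDl.
have e2 : 0 < e / 2 by rewrite divr_gt0.
(* The difference below is the sum of [(expi th - 1)] times [S t x - x] and [(expi th - 1 - i th)]
   times [x]. The constant [q] bounds [|S t x - x|], [r] is the relative error of the linearised
   exponential, and each summand becomes at most [e t / 2]. *)
pose r := e / 2 / ((`|a| + 1) * (rnorm x + 1)).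
have r0 : 0 < r by rewrite divr_gt0// mulr_gt0.
have r1 : 0 < r + 1 by rewrite ltr_wpDl// ltW.
pose q := e / 2 / ((`|a| + 1) * (r + 1)).
have q0 : 0 < q by rewrite divr_gt0// mulr_gt0.
have [d1 d10 h1] := expi_derivative0 r0.
have /cvg0right_rnormP/(_ _ q0)[d2 d20 h2] := SP x.
exists (Num.min d2 (d1 / (`|a| + 1))); first by rewrite lt_min d20 divr_gt0.
move=> t t0; rewrite lt_min => /andP[/h2-/(_ t0) {}h2 t1]; have t00 := ltW t0.
set th := - (a * t); have nth : `|th| = `|a| * t by rewrite normrN normrM (gtr0_norm t0).
have th1 : `|th| < d1.
  rewrite nth; apply: le_lt_trans (_ : (`|a| + 1) * t < d1); first by rewrite ler_wpM2r// lerDl.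
  by rewrite mulrC -ltr_pdivlMr.
move: (h1 _ th1); rewrite nth => {}h1; rewrite rnormB in h2.
have h3 : rnorm (expi th - 1 : R[i]^o) <= (r + 1) * (`|a| * t).
  rewrite mulrDl mul1r -[expi th - 1](subrK (0 +i* th)%C).
  apply: le_trans (@ler_rnormD _ R[i]^o _ _) _; rewrite lerD//.
  by apply: le_trans (rnorm_ReIm _) _; rewrite /= normr0 add0r nth.
have -> : shifted S a t x - S t x - t%:C%C *: - ((0 +i* a)%C *: x) =
    (expi th - 1) *: (S t x - x) + (expi th - 1 - (0 +i* th)%C) *: x.
  have -> : t%:C%C *: - ((0 +i* a)%C *: x) = (0 +i* th)%C *: x.
    rewrite scalerN scalerA -scaleNr; congr (_ *: _).
    by apply/eqP; rewrite eq_complex /= /th; apply/andP; split; apply/eqP; ring.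
  rewrite [(_ - (0 +i* th)%C) *: x]scalerBl scalerBr addrA subrK.
  by rewrite scalerBl scale1r.
apply: le_trans (ler_rnormD _ _) _; rewrite !rnormZ.
apply: (@le_trans _ _ ((r + 1) * (`|a| * t) * q + r * (`|a| * t) * rnorm x)).
  by apply: lerD; rewrite ?ler_pM ?rnorm_ge0 ?(ltW h2)// ler_wpM2r.
have k1 : (r + 1) * `|a| * q <= e / 2.
  rewrite /q mulrA ler_pdivrMr ?mulr_gt0// [leRHS]mulrC ler_wpM2r ?(ltW e2)//.
  by rewrite mulrC ler_wpM2r ?(ltW r1)// lerDl.
have k2 : r * `|a| * rnorm x <= e / 2.
  rewrite /r -mulrA mulrAC ler_pdivrMr ?mulr_gt0// ler_wpM2l ?(ltW e2)//.
  by rewrite ler_pM// lerDl.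
rewrite (_ : _ + _ = ((r + 1) * `|a| * q + r * `|a| * rnorm x) * t); last by clearbody q r; ring.
by rewrite ler_wpM2r// [e]splitr lerD.
Qed.

Lemma shifted_inverse (k : int) : resolvent_set (op_graph (S (2 * pi))) 1 ->
  exists2 K, 0 <= K &
    boundedly_invertible (op_subs (generator S) (0 +i* k%:~R)%C) K.
Proof.
move=> res; rewrite -generator_shifted.
apply: (@generator_invertible _ _ _ (shifted_C0 k%:~R) (2 * pi)); first exact/ltW/twopi_gt0.
rewrite (_ : shifted S k%:~R (2 * pi) = S (2 * pi))//.
apply/funext => x; rewrite /shifted (_ : - _ = 2 * pi * (- k)%:~R); last by rewrite mulrC -mulrN mulrNz.
by rewrite expi_2pi scale1r.
Qed.

(** [x] lies in the kernel of the generator of [e^(-ikt) S t]; by the mean value inequality that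
    semigroup fixes it, and at [2 pi] it is [S]. *)
Lemma eigenvector_fixed (k : int) x :
  generator S (x, (0 +i* k%:~R)%C *: x) -> S (2 * pi) x = x.
Proof.
move=> Gx; have p20 := ltW (twopi_gt0 R).
have G0 : generator (shifted S k%:~R) (x, 0).
  by rewrite generator_shifted; exists ((0 +i* k%:~R)%C *: x) => //=; rewrite subrr.
have sK := shifted_C0 k%:~R.
have := @generator_mean _ _ _ sK x 0 0 (2 * pi) 0 G0 p20.
rewrite mulr0 scaler0 subr0 /shifted.
rewrite (_ : - (k%:~R * (2 * pi)) = 2 * pi * (- k)%:~R); last by rewrite mulrC -mulrN mulrNz.
rewrite expi_2pi scale1r => h; apply/eqP; rewrite -subr_eq0; apply/eqP/rnorm_eq0/le_anti.
rewrite rnorm_ge0 andbT; apply: h => s s0 s2.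
by have [bS _ _ _] := sS; rewrite (lin0 (bS s s0).1) scaler0 subrr rnorm0.
Qed.

End shifted_semigroup.

(** * Operator norms and extended reciprocals *)

Section opnorm.
Context (R : realType) (V W : normedModType R[i]).

Lemma opnorm_ge0 (f : V -> W) : (0 <= opnorm f)%E.
Proof.
apply: (@le_trans _ _ (rnorm (f 0))%:E); first by rewrite lee_fin rnorm_ge0.
by apply: ereal_sup_ubound; exists 0 => //=; rewrite rnorm0.
Qed.

Lemma opnorm_le (f : V -> W) (r : R) : 0 <= r -> (forall x, rnorm (f x) <= r * rnorm x) ->
  (opnorm f <= r%:E)%E.
Proof.
move=> r0 fr; apply: ge_ereal_sup => _ [x /= x1 <-]; rewrite lee_fin.
by apply: le_trans (fr x) _; rewrite ler_piMr.
Qed.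

Lemma rnorm_opnorm (f : V -> W) (r : R) : linear f -> (opnorm f <= r%:E)%E ->
  forall x, rnorm (f x) <= r * rnorm x.
Proof.
move=> lf fr x; have [->|x0] := eqVneq x 0; first by rewrite (lin0 lf) !rnorm0 mulr0.
have nx : 0 < rnorm x.
  by rewrite lt_def rnorm_ge0 andbT; apply: contra x0 => /eqP/rnorm_eq0/eqP.
have : ((rnorm (f ((rnorm x)^-1%:C%C *: x)))%:E <= opnorm f)%E.
  apply: ereal_sup_ubound; exists ((rnorm x)^-1%:C%C *: x) => //=.
  by rewrite rnormZp ?invr_ge0 ?(ltW nx)// mulVf// gt_eqF.
move=> /le_trans/(_ fr); rewrite lee_fin (linZ lf) rnormZp ?invr_ge0 ?(ltW nx)//.
by rewrite ler_pdivrMl// mulrC.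
Qed.

Lemma opnorm_fin (f : V -> W) : bounded_operator f -> exists2 N : R, 0 <= N & opnorm f = N%:E.
Proof.
move=> bf; have [M M0 fM] := bounded_operator_rnorm bf.
have := opnorm_ge0 f; have := opnorm_le M0 fM.
by case: (opnorm f) => [N|//|//] _ N0; exists N.
Qed.

End opnorm.

Section reciprocal.
Context (R : realType).
Local Open Scope ereal_scope.

(** Comparison through the positive reals below [x]. It includes [x = +oo], the value of [1 / nper]
    when [nper] is zero. *)
Lemma lee_reals (x y : \bar R) : 0 < x ->
  (forall r : R, (0 < r)%R -> r%:E < x -> r%:E <= y) -> x <= y.
Proof.
move=> x0 H; rewrite leNgt; apply/negP => yx.
case: y yx H => [y| |] yx H; [|by rewrite ltNge leey in yx|].
  case: x x0 yx H => [x| |] // x0 yx H.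
    have := H ((Num.max 0 y + x) / 2)%R; rewrite !lee_fin !lte_fin in x0 yx *.
    have m0 : (0 <= Num.max 0 y)%R by rewrite le_max lexx.
    have my : (y <= Num.max 0 y)%R by rewrite le_max lexx orbT.
    have mx : (Num.max 0 y < x)%R by rewrite gt_max x0.
    move: (Num.max _ _) m0 my mx => m m0 my mx h.
    have h1 : (0 < (m + x) / 2)%R by lra.
    have h2 : ((m + x) / 2 < x)%R by lra.
    have h3 := h h1 h2; lra.
  have h : (0 < `|y| + 1)%R by rewrite ltr_wpDl.
  have := H _ h (ltry _); rewrite lee_fin; have := ler_norm y; lra.
case: x x0 yx H => [x| |] // x0 _ H.
  rewrite lte_fin in x0; have := H (x / 2)%R; rewrite lte_fin => h.
  have h1 : (0 < x / 2)%R by lra.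
  by have := h h1 ltac:(lra); rewrite leNgt ltNyr.
by have := H 1%R ltr01 (ltry _); rewrite leNgt ltNyr.
Qed.

Lemma lt_div1_fin (N r : R) : (0 <= N)%R -> r%:E < 1 / N%:E -> (r * N < 1)%R.
Proof.
move=> N0; have [->|N1] := eqVneq N 0%R; first by rewrite mulr0.
have N2 : (0 < N)%R by rewrite lt_def N1.
by rewrite div1e inver (negbTE N1) lte_fin -div1r ltr_pdivlMr.
Qed.

Lemma div1_fin_gt0 (N : R) : (0 <= N)%R -> 0 < 1 / N%:E.
Proof.
move=> N0; rewrite div1e inver; case: ifPn => // N1.
by rewrite lte_fin invr_gt0 lt_def N1.
Qed.

Lemma lee_div1 (x y : \bar R) : 0 <= x -> x <= y -> 1 / y <= 1 / x.
Proof. by move=> x0 xy; rewrite !div1e lee_pV2// inE ?(le_trans x0). Qed.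

Lemma le_div1_fin (s : \bar R) (r : R) : 0 <= s -> (0 < r)%R -> s <= (r^-1)%:E -> r%:E <= 1 / s.
Proof.
move=> s0 r0 /(lee_div1 s0); rewrite [X in X <= _]div1e inver invr_eq0 invrK.
by rewrite gt_eqF.
Qed.

End reciprocal.

Lemma bounded_Lp_map (R : realType) (p : R) (p1 : 1 <= p) (V W : normedModType R[i])
    (Q : V -> W) : bounded_operator Q ->
  bounded_operator (Lp_map (mu := leb2pi R) (p1 := p1) Q).
Proof.
move=> bQ; rewrite (_ : Lp_map Q = twist Q 0); first exact: bounded_twist.
by apply/funext => F; exact: Lp_map_twist.
Qed.

Section stability.
Context (R : realType) (X U Y : completeNormedModType R[i]).
Variables (T : R -> X -> X) (B : U -> X) (C : X -> Y).
Hypotheses (sT : C0_semigroup T) (res : resolvent_set (op_graph (T (2 * pi))) 1).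
Hypotheses (bB : bounded_operator B) (bC : bounded_operator C).

Lemma stability_lower (p : R) (p1 : 1 <= p) (N r : R) : 0 <= N -> 0 < r -> r * N < 1 ->
  (opnorm (Lp_map (p1 := p1) C \o op_inv (generator (evolution_semigroup (p1 := p1) T)) \o
     Lp_map (mu := leb2pi R) (p1 := p1) B) <= N%:E)%E ->
  forall D : Y -> U, bounded_operator D -> (opnorm D <= r%:E)%E ->
  exists2 S, generates (op_add (generator T) (B \o D \o C)) S &
    resolvent_set (op_graph (S (2 * pi))) 1.
Proof.
move=> N0 r0 rN hN D bD hD.
have bP := bounded_operator_comp (bounded_operator_comp bB bD) bC.
have [S [sS gS rate [L L0 lip]]] := bounded_perturbation sT bP.
exists S; first by split.
have sE := evolution_C0 p1 sT; have p20 := ltW (twopi_gt0 R).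
have [K K0 iG] := generator_invertible sE p20 (evolution_resolvent p1 sT res).
have lG := linear_generator sE.
have bLp := @bounded_Lp_map R p p1.
have EP := evolution_perturb p1 sT sS bP L0 rate lip.
have PE : Lp_map (B \o D \o C) = Lp_map B \o Lp_map D \o Lp_map (mu := leb2pi R) (p1 := p1) C.
  apply/funext => F /=; have bBD := bounded_operator_comp bB bD.
  by rewrite !Lp_map_twist// !twist_twist// !addr0.
have bJ := bounded_op_inv iG lG.
have lN : linear (Lp_map (p1 := p1) C \o op_inv (generator (evolution_semigroup (p1 := p1) T)) \o
     Lp_map (mu := leb2pi R) (p1 := p1) B).
  exact: (bounded_operator_comp (bounded_operator_comp (bLp _ _ _ bC) bJ) (bLp _ _ _ bB)).1.
have rN0 : 0 <= r * N by rewrite mulr_ge0// ltW.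
have [] := feedback_invertible K0 iG lG (bLp _ _ _ bB) (bLp _ _ _ bD) (bLp _ _ _ bC) rN0 rN.
  move=> y; apply: le_trans (rnorm_opnorm lN hN _) _; rewrite [r * N]mulrC -mulrA ler_wpM2l//.
  rewrite Lp_map_twist//.
  by apply: rnorm_twist => //; [exact: rnorm_opnorm bD.1 hD|exact: ltW].
move=> K'; rewrite -PE -EP => K'0 iS.
exact: (evolution_inverse sS K'0 iS).
Qed.

Lemma stability_upper (r : R) (k : int) : 0 < r ->
  (forall D : Y -> U, bounded_operator D -> (opnorm D <= r%:E)%E ->
    exists2 S, generates (op_add (generator T) (B \o D \o C)) S &
      resolvent_set (op_graph (S (2 * pi))) 1) ->
  (opnorm (C \o op_inv (op_subs (generator T) (0 +i* k%:~R)%C) \o B)%R <= (r^-1)%:E)%E.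
Proof.
move=> r0 H; apply: ge_ereal_sup => _ [u /= u1 <-]; rewrite lee_fin leNgt; apply/negP.
have [K K0 iJ] := shifted_inverse sT k res.
have Ju := op_inv_graph iJ (B u); set x := op_inv _ _ in Ju *.
set g := rnorm (C x) => rg; have g0 : 0 < g by apply: lt_trans rg; rewrite invr_gt0.
have [phi [lphi phi1 phiC]] := norming_functional (C x).
(* The sign and the factor give [D (C x) = - u], so that [B D C x] cancels [B u] in
   [A x = ik x + B u]. The norm of [D] is at most [|u| / g], below [r] because [g > 1 / r]. *)
pose D y : U := phi y *: - (g^-1%:C%C *: u).
have lD : linear D by move=> a y z; rewrite /D lphi scalerDl scalerA.
have Dr y : rnorm (D y) <= r * rnorm y.
  rewrite /D rnormZ rnormN rnormZp ?invr_ge0 ?(ltW g0)// mulrC.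
  apply: ler_pM; rewrite ?mulr_ge0 ?invr_ge0 ?(ltW g0) ?rnorm_ge0//.
  apply: (@le_trans _ _ g^-1); first by rewrite ler_piMr ?invr_ge0 ?(ltW g0).
  by rewrite -[r]invrK lef_pV2 ?posrE ?invr_gt0// ltW.
have bD := rnorm_bounded_operator lD Dr.
have [S [sS gS] /(resolvent_set_graph1P)] := H D bD (opnorm_le (ltW r0) Dr).
have [bS _ _ _] := sS.
move=> /(_ (bS _ (ltW (twopi_gt0 R))).1)[K' iS].
have DC : D (C x) = - u.
  by rewrite /D phiC -/g scalerN rscaleVK// gt_eqF.
have Sx : S (2 * pi) x = x.
  apply: (eigenvector_fixed (k := k) sS); rewrite gS.
  move: Ju => [z Az] /= Bz; exists z => //=.
  by rewrite DC (linN bB.1) Bz opprD opprK addNKr.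
have x0 : x = 0.
  have [z [_ zU _]] := iS 0; rewrite (zU x); last by apply/op_subs_op_graph1; rewrite Sx subrr.
  by rewrite -(zU 0)//; apply/op_subs_op_graph1; rewrite (lin0 (bS _ (ltW (twopi_gt0 R))).1) subrr.
by move: g0; rewrite /g x0 (lin0 bC.1) rnorm0 ltxx.
Qed.

End stability.

(** * The Hilbert case *)

(** The one consequence of the inner product that is used. It passes from [U] and [Y] to [L2] by
    integrating a pointwise identity, without an inner product on [L2]. *)
Definition parallelogram (R : realType) (V : normedModType R[i]) := forall x y : V,
  rnorm (x + y) ^+ 2 + rnorm (x - y) ^+ 2 =
  rnorm x ^+ 2 + rnorm y ^+ 2 + (rnorm x ^+ 2 + rnorm y ^+ 2).

Lemma hilbert_parallelogram (R : realType) (H : completeNormedModType R[i]) :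
  is_hilbert H -> parallelogram H.
Proof.
move=> [ip ipE] x y; apply: (@complexI R).
rewrite !rmorphD /= !rmorphXn /= !rnormC !ipE !linearDl !linearDr !linearNl !linearNr opprK.
rewrite addrACA [X in X + _]addrACA subrr addr0 [X in _ + X]addrACA subrr add0r.
exact: addrACA.
Qed.

Section parallelogram_law.
Context (R : realType) (V : normedModType R[i]).
Hypothesis pV : parallelogram V.

Let beta (x y : V) : R := rnorm (x + y) ^+ 2 - rnorm (x - y) ^+ 2.

(* The Jordan-von Neumann argument: the polarization of the squared norm is additive. *)
Lemma polarization_additive (x x' y : V) : beta (x + x') y = beta x y + beta x' y.
Proof.
have h1 := pV (x + y) x'; have h2 := pV (x - y) x'.
have h3 := pV (x' + y) x; have h4 := pV (x' - y) x.
have e1 : x + y + x' = x + x' + y by rewrite addrAC.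
have e2 : x - y + x' = x + x' - y by rewrite addrAC.
have e3 : x' + y + x = x + x' + y by rewrite addrAC [x' + x]addrC.
have e4 : x' - y + x = x + x' - y by rewrite addrAC [x' + x]addrC.
have e5 : rnorm (x' - y - x) = rnorm (x + y - x').
  by rewrite rnormB opprB addrA.
have e6 : rnorm (x' + y - x) = rnorm (x - y - x').
  by rewrite -rnormN !opprD opprK addrC addrA addrAC.
rewrite /beta; move: h1 h2 h3 h4; rewrite e1 e2 e3 e4 e5 e6 => h1 h2 h3 h4; lra.
Qed.

(** Orthogonality is the vanishing of [beta], four times the real part of an inner product.
    Additivity of [beta] makes each term orthogonal to the sum of the earlier ones, and the
    parallelogram law then gives Pythagoras. *)
Lemma rnorm_orthogonal_sum (x : nat -> V) n :
  (forall j i, (j < i)%N -> (i < n)%N -> rnorm (x j + x i) = rnorm (x j - x i)) ->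
  rnorm (\sum_(j < n) x j) ^+ 2 = \sum_(j < n) rnorm (x j) ^+ 2.
Proof.
elim: n => [|n ih] H; first by rewrite !big_ord0 rnorm0 expr0n.
rewrite !big_ord_recr /= -ih; last by move=> j i ji iN; apply: H => //; exact: ltnW.
have B0 m : (m <= n)%N -> beta (\sum_(j < m) x j) (x n) = 0.
  elim: m => [_|m im mn]; first by rewrite big_ord0 /beta add0r sub0r rnormN subrr.
  rewrite big_ord_recr /= polarization_additive im ?(ltnW mn)// add0r /beta H ?subrr//.
have := B0 n (leqnn n); have := pV (\sum_(j < n) x j) (x n).
rewrite /beta => h1 h2; lra.
Qed.

End parallelogram_law.

Section L2.
Context (R : realType) (p1 : 1 <= 2 :> R) (V : normedModType R[i]).
Local Notation mu := (leb2pi R).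
Local Notation T := (measurableTypeR R).

Lemma rnorm_L2_class (f : T -> V) : in_Lp mu 2 f ->
  ((rnorm (Lp_class mu p1 f)) ^+ 2)%:E = (\int[mu]_s ((rnorm (f s)) ^+ 2)%:E)%E.
Proof.
move=> lf; have := @Lp_norm_leP _ _ _ mu 2 p1 V f; rewrite -(rnorm_Lp_class p1 lf).
set n := rnorm _; have n0 : 0 <= n by exact: rnorm_ge0.
under eq_integral => s _ do rewrite powR_mulrn ?rnorm_ge0//.
set I := (\int[_]_s _)%E => H.
have I0 : (0 <= I)%E by apply: integral_ge0 => s _; rewrite lee_fin sqr_ge0.
have := H n n0; rewrite lexx powR_mulrn// => /esym In.
apply/le_anti; rewrite In andbT.
move: I I0 In H => [i| |] //; rewrite !lee_fin => i0 ni H.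
have := H (Num.sqrt i) (sqrtr_ge0 _); rewrite powR_mulrn ?sqrtr_ge0// sqr_sqrtr// lexx lee_fin => ns.
by rewrite -(sqr_sqrtr i0) lerXn2r ?nnegrE ?sqrtr_ge0.
Qed.

Lemma parallelogram_L2 : parallelogram V -> parallelogram (Lp mu p1 V).
Proof.
move=> pV F G; rewrite -[F]Lp_class_val -[G]Lp_class_val.
have lF := in_Lp_val F; have lG := in_Lp_val G.
rewrite -Lp_classD// -Lp_classB//; apply: EFin_inj.
rewrite !EFinD !rnorm_L2_class//; [|exact: in_LpB|exact: in_LpD].
have m (f : T -> V) : in_Lp mu 2 f -> measurable_fun setT (fun s => ((rnorm (f s)) ^+ 2)%:E).
  move=> [mf _]; rewrite (_ : (fun _ => _) = (fun s => ((rnorm (f s)) `^ 2)%:E)).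
    exact: measurable_rnorm_powR.
  by apply/funext => s; rewrite powR_mulrn ?rnorm_ge0.
have ge0 (f : T -> V) s : (0 <= ((rnorm (f s)) ^+ 2)%:E)%E by rewrite lee_fin sqr_ge0.
have mF := m _ lF; have mG := m _ lG.
have mD := m _ (in_LpD p1 lF lG); have mB := m _ (in_LpB p1 lF lG).
have D (f g : T -> \bar R) : measurable_fun setT f -> measurable_fun setT g ->
    (forall s, 0 <= f s)%E -> (forall s, 0 <= g s)%E ->
    (\int[mu]_s f s + \int[mu]_s g s = \int[mu]_s (f s + g s))%E.
  by move=> mf mg f0 g0; rewrite ge0_integralD.
have mFG := emeasurable_funD mF mG.
have FG0 s : (0 <= ((rnorm (Lp_val F s)) ^+ 2)%:E + ((rnorm (Lp_val G s)) ^+ 2)%:E)%E.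
  by rewrite adde_ge0.
rewrite (D _ _ mF mG) // (D _ _ mFG mFG) //.
apply: etrans (D _ _ mD mB (fun s => ge0 (Lp_val F \+ Lp_val G) s) (fun s => ge0 (fun s => Lp_val F s - Lp_val G s) s)) _.
by apply: eq_integral => s _; rewrite -!EFinD; congr EFin; exact: pV.
Qed.

End L2.

Section frequency.

(** An enumeration of the integers, so that trigonometric sums are indexed by initial segments of
    the naturals with distinct frequencies. *)
Definition frequency (j : nat) : int := if odd j then Negz j./2 else Posz j./2.

Lemma frequency_inj : injective frequency.
Proof.
move=> i j; rewrite /frequency; case oi: (odd i); case oj: (odd j) => // -[h];
  by rewrite -(odd_double_half i) -(odd_double_half j) oi oj h.
Qed.

Lemma frequency_surj k : exists j, frequency j = k.
Proof.
case: k => m; first by exists m.*2; rewrite /frequency odd_double doubleK.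
by exists m.*2.+1; rewrite /frequency /= odd_double uphalf_double.
Qed.

End frequency.

Section trig_sums.
Context (R : realType) (p : R) (p1 : 1 <= p) (V : normedModType R[i]).
Local Notation mu := (leb2pi R).
Local Notation iota k x := (Lp_class mu p1 (tfun k x)).

Lemma rnorm_rot (F : Lp mu p1 V) t : rnorm (twist id t F) = rnorm F.
Proof.
have lF := in_Lp_val F; apply: EFin_inj.
rewrite rnorm_Lp_class; last exact: in_Lp_rot.
by rewrite (Lp_norm_rot _ _ lF.1) rnorm_LpE.
Qed.

(** Rotation by [t] is an isometry and multiplies the two terms by [e^(-ikt)] and [e^(-ilt)]. For
    this [t] the factors are opposite, so the sum is carried to the difference up to a scalar of
    modulus one. *)
Lemma tfun_orthogonal (k l : int) (x y : V) : k != l ->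
  rnorm (iota k x + iota l y) = rnorm (iota k x - iota l y).
Proof.
move=> kl; have kl0 : (k - l)%:~R != 0 :> R by rewrite intr_eq0 subr_eq0.
pose t : R := - (pi / (k - l)%:~R).
have lin := @linear_Lp_class_tfun R p p1 V.
have bI := @bounded_operator_id R V.
rewrite -(rnorm_rot _ t) (linD (linear_twist bI t)).
rewrite (twist_tfun p1 _ _ _ bI) (twist_tfun p1 _ _ _ bI) !(linZ (lin _)).
have -> : expi (- (k%:~R * t)) = - expi (- (l%:~R * t)).
  rewrite (_ : - (k%:~R * t) = - (l%:~R * t) + pi); last first.
    by rewrite /t; move: kl0; rewrite intrB => kl0; field.
  rewrite expiD (_ : expi pi = -1) ?mulrN1//.
  by apply/eqP; rewrite /expi cospi sinpi eq_complex /= oppr0 !eqxx.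
by rewrite scaleNr addrC -scalerBr rnormZ rnorm_expi mul1r rnormB.
Qed.

Definition trig_sum (c : nat -> V) n : Lp mu p1 V := \sum_(j < n) iota (frequency j) (c j).

Lemma trig_sum_widen (c : nat -> V) n N : (n <= N)%N -> (forall j, (n <= j)%N -> c j = 0) ->
  trig_sum c N = trig_sum c n.
Proof.
move=> nN c0; rewrite -(subnKC nN); elim: (N - n)%N => [|m ih]; first by rewrite addn0.
rewrite addnS /trig_sum big_ord_recr /= [X in X + _]ih c0 ?leq_addr//.
by rewrite (lin0 (@linear_Lp_class_tfun R p p1 V _)) addr0.
Qed.

Lemma trig_sumP a (c c' : nat -> V) n :
  trig_sum (fun j => a *: c j + c' j) n = a *: trig_sum c n + trig_sum c' n.
Proof.
rewrite /trig_sum scaler_sumr -big_split /=; apply: eq_bigr => j _.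
exact: linear_Lp_class_tfun.
Qed.

Lemma trig_sum_dense (F : Lp mu p1 V) (e : R) : 0 < e -> exists n c,
  rnorm (F - trig_sum c n) <= e.
Proof.
(* Coefficients are required to vanish from [n] on, so that two sums can be padded to a common
   length. *)
pose M := [set F : Lp mu p1 V | forall e, 0 < e -> exists n c,
  (forall j, (n <= j)%N -> c j = 0) /\ rnorm (F - trig_sum c n) <= e].
suff : M F by move=> MF /MF[n [c [_ h]]]; exists n, c.
apply: trig_dense.
- move=> a F1 F2 M1 M2 r r0; pose L := rnorm (a : R[i]^o) + 1.
  have L0 : 0 < L by rewrite ltr_wpDl// rnorm_ge0.
  have r2 : 0 < r / 2 by rewrite divr_gt0.
  have [n1 [c1 [z1 h1]]] := M1 _ (divr_gt0 r2 L0); have [n2 [c2 [z2 h2]]] := M2 _ r2.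
  exists (maxn n1 n2), (fun j => a *: c1 j + c2 j); split.
    by move=> j; rewrite geq_max => /andP[/z1 -> /z2 ->]; rewrite scaler0 addr0.
  rewrite trig_sumP (trig_sum_widen (leq_maxl n1 n2) z1) (trig_sum_widen (leq_maxr n1 n2) z2).
  rewrite opprD addrACA -scalerBr; apply: le_trans (ler_rnormD _ _) _; rewrite [leRHS]splitr lerD//.
  rewrite rnormZ; move: h1; rewrite ler_pdivlMr// mulrC.
  by apply: le_trans; rewrite ler_wpM2r ?rnorm_ge0// lerDl.
- move=> F1 H r r0; have r2 : 0 < r / 2 by rewrite divr_gt0.
  have [G MG FG] := H _ r2; have [n [c [z h]]] := MG _ r2; exists n, c; split=> //.
  by apply: le_trans (ler_rnorm_tri G _ _) _; rewrite [leRHS]splitr lerD.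
move=> k x r r0; have [j jk] := frequency_surj k.
exists j.+1, (fun i => if i == j then x else 0); split.
  by move=> i ji; rewrite gtn_eqF.
rewrite /trig_sum big_ord_recr /= eqxx jk big1 => [|i _].
  by rewrite add0r subrr rnorm0 ltW.
rewrite (ltn_eqF (ltn_ord i)).
exact: (lin0 (@linear_Lp_class_tfun R p p1 V _)).
Qed.

End trig_sums.

Section L2_multiplier.
Context (R : realType) (p1 : 1 <= 2 :> R) (U Y : normedModType R[i]).
Local Notation mu := (leb2pi R).
Hypotheses (pU : parallelogram U) (pY : parallelogram Y).
Variables (Phi : Lp mu p1 U -> Lp mu p1 Y) (m : int -> U -> Y) (s : R).
Hypotheses (bPhi : bounded_operator Phi) (s0 : 0 <= s).
Hypothesis Phi_tfun : forall k u,
  Phi (Lp_class mu p1 (tfun k u)) = Lp_class mu p1 (tfun k (m k u)).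
Hypothesis m_bound : forall k u, rnorm (m k u) <= s * rnorm u.

Let tfun_bound k u : rnorm (Lp_class mu p1 (tfun k (m k u))) <= s * rnorm (Lp_class mu p1 (tfun k u)).
Proof.
have lu := in_Lp_tfun p1 k u; have lm := in_Lp_tfun p1 k (m k u).
rewrite -lee_fin EFinM !rnorm_Lp_class//.
have -> : s%:E = (rnorm (s%:C%C : R[i]^o))%:E.
  by rewrite rnorm_complex /= expr0n addr0 sqrtr_sqr ger0_norm.
rewrite -Lp_normZ//; last exact: lu.1.
apply: Lp_norm_le => //; first exact: lm.1.
  by apply: measurable_rnorm; apply: strongly_measurableZ; exact: lu.1.
by move=> x; rewrite rnormZp// !rnorm_tfun.
Qed.

Let rnorm_trig_sum (V : normedModType R[i]) (c : nat -> V) n : parallelogram V ->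
  rnorm (trig_sum p1 c n) ^+ 2 =
  \sum_(j < n) rnorm (Lp_class mu p1 (tfun (frequency j) (c j))) ^+ 2.
Proof.
move=> pV; rewrite /trig_sum.
apply: (@rnorm_orthogonal_sum _ _ (parallelogram_L2 (p1 := p1) pV)
  (fun j => Lp_class mu p1 (tfun (frequency j) (c j)))) => j i ji _.
by apply: tfun_orthogonal; rewrite (inj_eq frequency_inj) ltn_eqF.
Qed.

Lemma L2_multiplier F : rnorm (Phi F) <= s * rnorm F.
Proof.
have [L L0 PL] := bounded_operator_rnorm bPhi.
have trig c n : rnorm (Phi (trig_sum p1 c n)) <= s * rnorm (trig_sum p1 c n).
  rewrite -ler_sqr ?nnegrE ?mulr_ge0 ?rnorm_ge0//.
  have -> : Phi (trig_sum p1 c n) = trig_sum p1 (fun j => m (frequency j) (c j)) n.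
    by rewrite /trig_sum (lin_sum bPhi.1); apply: eq_bigr => j _.
  rewrite exprMn !rnorm_trig_sum// mulr_sumr; apply: ler_sum => j _.
  by rewrite -exprMn ler_sqr ?nnegrE ?mulr_ge0 ?rnorm_ge0.
apply/ler_addgt0Pr => e e0.
(* With [G] the approximating sum, [|Phi F| <= L |F - G| + s |G| <= s |F| + (L + s) |F - G|]; the
   [+ 1] keeps the divisor positive. *)
have Ls : 0 < L + s + 1 by rewrite ltr_wpDl// addr_ge0.
have [n [c h]] := trig_sum_dense F (divr_gt0 e0 Ls).
set G := trig_sum p1 c n in h; have hG : rnorm (Phi G) <= s * rnorm G by exact: trig.
have h1 : rnorm (Phi F) <= rnorm (Phi (F - G)) + rnorm (Phi G).
  by rewrite -{1}(subrK G F) (linD bPhi.1); exact: ler_rnormD.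
have h2 : rnorm G <= rnorm (F - G) + rnorm F.
  by rewrite rnormB -{1}(subrK F G); exact: ler_rnormD.
have h3 : (L + s + 1) * rnorm (F - G) <= e by rewrite mulrC -ler_pdivlMr.
have := PL (F - G); have := rnorm_ge0 (F - G); have := ler_wpM2l s0 h2; nra.
Qed.

End L2_multiplier.

(** On the functions [e^(iks) x] the evolution semigroup acts as [e^(-ikt) T t] on [x], so the rate
    at which the shifted difference quotient converges in [X] carries over, up to the factor
    [(2 pi)^(1/p)]. *)
Lemma generator_tfun (R : realType) (p : R) (p1 : 1 <= p) (X : completeNormedModType R[i])
    (T : R -> X -> X) (k : int) (x y : X) : C0_semigroup T ->
  op_subs (generator T) (0 +i* k%:~R)%C (x, y) ->
  generator (evolution_semigroup (p1 := p1) T)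
    (Lp_class (leb2pi R) p1 (tfun k x), Lp_class (leb2pi R) p1 (tfun k y)).
Proof.
move=> sT; rewrite -(generator_shifted sT) => /generatorP H; apply/generatorP => e e0.
have c0 : 0 < (2 * pi) `^ p^-1 :> R by rewrite powR_gt0 ?twopi_gt0.
have [d d0 dP] := H _ (divr_gt0 e0 c0); exists d => // t t0 td.
have [bT _ _ _] := sT; have lin := @linear_Lp_class_tfun R p p1 X k.
have -> : evolution_semigroup T t (Lp_class (leb2pi R) p1 (tfun k x)) =
    Lp_class (leb2pi R) p1 (tfun k (shifted T k%:~R t x)).
  exact: (twist_tfun p1 _ _ _ (bT t (ltW t0))).
rewrite -(linB lin) -(linZ lin) -(linB lin); apply: le_trans (rnorm_Lp_class_tfun p1 _ _) _.
have := dP t t0 td; rewrite mulrAC ler_pdivlMr// mulrC; exact.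
Qed.

Theorem theorem4p4 (R : realType) (X U Y : completeNormedModType R[i])
    (p : R) (p1 : 1 <= p)
    (A : set (X * X)) (T : R -> X -> X) (hA : generates A T)
    (h1 : resolvent_set (op_graph (T (2 * pi))) 1)
    (B : U -> X) (hB : bounded_operator B)
    (C : X -> Y) (hC : bounded_operator C) :
  let Gper := generator (evolution_semigroup (p1 := p1) T) in
  let nper := opnorm (Lp_map (p1 := p1) C \o op_inv Gper \o
                      Lp_map (mu := leb2pi R) (p1 := p1) B) in
  let nres (k : int) := opnorm (C \o op_inv (op_subs A (0 +i* k%:~R)%C) \o B) in
  let rc := rc_stab1 A B C in
  let sres := ereal_sup [set nres k | k in [set: int]] in
  ((1 / nper <= rc)%E /\ (rc <= 1 / sres)%E) /\
  (is_hilbert U -> is_hilbert Y -> p = 2 ->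
     (1 / nper)%E = rc /\ rc = (1 / sres)%E).
Proof.
move=> Gper nper nres rc sres; have [sT gT] := hA; subst A.
have sE := evolution_C0 p1 sT; have p20 := ltW (twopi_gt0 R).
have [K K0 iG] := generator_invertible sE p20 (evolution_resolvent p1 sT h1).
have bPhi := bounded_operator_comp
  (bounded_operator_comp (bounded_Lp_map p1 hC) (bounded_op_inv iG (linear_generator sE)))
  (bounded_Lp_map p1 hB).
have [N N0 nperE] := opnorm_fin bPhi; rewrite -/Gper -/nper in nperE.
have nres_ub k : (nres k <= sres)%E by apply: ereal_sup_ubound; exists k.
have sres0 : (0 <= sres)%E by apply: le_trans (nres_ub 0); exact: opnorm_ge0.
have lower : (1 / nper <= rc)%E.
  rewrite nperE; apply: lee_reals; first exact: div1_fin_gt0.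
  move=> r r0 /(lt_div1_fin N0) rN; apply: ereal_sup_ubound; exists r => //; split=> //.
  have nN : (nper <= N%:E)%E by rewrite nperE.
  exact: (stability_lower sT h1 hB hC N0 r0 rN nN).
have upper : (rc <= 1 / sres)%E.
  apply: ge_ereal_sup => _ [r [r0 H] <-]; apply: le_div1_fin => //.
  by apply: ge_ereal_sup => _ [k _ <-]; exact: stability_upper.
split=> // hU hY p2; suff : (nper <= sres)%E.
  move=> /(lee_div1 (opnorm_ge0 _)) h; split; apply/le_anti.
    by rewrite lower (le_trans upper).
  by rewrite upper (le_trans h).
(* An infinite supremum leaves nothing to prove; a finite one is the uniform bound of the
   multiplier. *)
move: nres_ub sres0; case: sres upper => [s| |] // _ nres_ub s0; last exact: leey.
subst p; apply: opnorm_le => //; rewrite lee_fin in s0.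
apply: (L2_multiplier (hilbert_parallelogram hU) (hilbert_parallelogram hY)
  (m := fun k => C \o op_inv (op_subs (generator T) (0 +i* k%:~R)%C) \o B) bPhi s0).
- move=> k u /=; have [K' _ iJ] := shifted_inverse sT k h1.
  rewrite (Lp_map_class p1 hB); last exact: in_Lp_tfun.
  have -> : B \o tfun k u = tfun k (B u) by apply/funext => s'; rewrite /= /tfun (linZ hB.1).
  rewrite (op_inv_uniq iG (generator_tfun (p1 := p1) sT (op_inv_graph iJ (B u)))).
  rewrite (Lp_map_class p1 hC); last exact: in_Lp_tfun.
  by congr Lp_class; apply/funext => s'; rewrite /= /tfun (linZ hC.1).
move=> k; apply: rnorm_opnorm (nres_ub k).
have [K' _ iJ] := shifted_inverse sT k h1.
apply: (bounded_operator_comp (bounded_operator_comp hC _) hB).1.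
rewrite -(generator_shifted sT) in iJ *.
exact: (bounded_op_inv iJ (linear_generator (shifted_C0 sT _))).
Qed.
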